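(* Assume $N\epsilon_N\to0$ and $\ln(\epsilon_N)/N\to0$. Then $\widehat\mu_N^{(\xi)}$ satisfies a large deviation principle in $\mathcal P([0,1])$ with speed $N^2$ and good rate function $J^{(\xi)}=I^{(\xi)}-\inf I^{(\xi)}$, where $I^{(\xi)}=-H^{(\xi)}-K_0^{(\xi)}-M^{(\xi)}$ with $H^{(\xi)},M^{(\xi)}$ as below and (i) $\xi\in(-\gamma^2,0]$: $K_0^{(\xi)}(\mu)=\kappa(1-\gamma^2-\xi)\int\ln(1-x^\theta)d\mu(x)$; (ii) $\xi\in(0,1-\gamma^2]$: $K_0^{(\xi)}(\mu)=\kappa(1-\gamma^2-\xi)\int\ln(1-x^\theta)d\mu(x)$; (iii) $\xi\in(1-\gamma^2,1]$: $K_0^{(\xi)}(\mu)=\kappa(\xi+\gamma^2-1)\int\ln(1-x^\eta)d\mu(x)$.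
   Context: Fix $\eta,\theta>0$, $\gamma\in(0,1)$, $\alpha\in\mathbb R$ with $\alpha+\frac{\eta+\theta}{2}>0$, $\xi\in(-\gamma^2,1]$. For $N\in\mathbb N$ put $M=\gamma^2N$, $t=\xi N$ (assumed integers), take $\epsilon_N>0$, and $q=e^{-\epsilon_N}$, $a=e^{-\alpha\epsilon_N}$, $Q=q^\eta$, $\tilde Q=q^\theta$. Let $L_\xi=(\gamma^2-|\xi|)N$, $\gamma^2N$, $(1-\xi)N$ according as $\xi\in(-\gamma^2,0]$, $(0,1-\gamma^2]$, $(1-\gamma^2,1]$, and $\kappa=L_\xi/N$. With $(x;q)_n=\prod_{0\le i<n}(1-xq^i)$, define $w_d(x)=a^x(Q\tilde Q)^{x/2}Q^{|t|x}(\tilde Q^{x-|t|+1};\tilde Q)_{N-(M-|t|)}$ if $t\le0$; $w_d(x)=a^x(Q\tilde Q)^{x/2}\tilde Q^{tx}(\tilde Q^{x+1};\tilde Q)_{N-t-M}$ if $t>0,N-t\ge M$; $w_d(x)=a^x(Q\tilde Q)^{x/2}\tilde Q^{tx}(Q^{x+N-t-M+1};Q)_{M-(N-t)}$ if $t>0,N-t<M$. $\mathbb P$ is the probability measure on strictly decreasing tuples $\ell_1>\dots>\ell_{L_\xi}\ge M-L_\xi$ of integers given by $\mathbb P(\ell)=Z_d^{-1}\prod_{i<j}(Q^{\ell_j}-Q^{\ell_i})(\tilde Q^{\ell_j}-\tilde Q^{\ell_i})\prod_iw_d(\ell_i)$ (law of the shifted diagonal slice of a random plane partition on an $M\times N$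 base weighted $\propto(aq^{(\eta+\theta)/2})^{\mathrm{CentralVol}}q^{\eta\mathrm{LeftVol}+\theta\mathrm{RightVol}}$), and $\widehat\mu_N^{(\xi)}=L_\xi^{-1}\sum_i\delta_{e^{-\epsilon_N\ell_i}}$. $H^{(\xi)}(\mu)=\frac{\kappa^2}{2}\iint(\ln|x^\theta-y^\theta|+\ln|x^\eta-y^\eta|)d\mu d\mu$; $M^{(\xi)}(\mu)=\kappa\eta|\xi|\int\ln x\,d\mu$ in case (i) and $M^{(\xi)}(\mu)=\kappa\theta\xi\int\ln x\,d\mu$ in cases (ii), (iii).
   Formalization: The endpoint ξ=1 is excluded: there L_ξ=(1-ξ)N=0, so the empirical measure L_ξ^{-1}∑δ is undefined; the theorem covers all ξ in (-γ²,1), along any increasing sequence of N with γ²N and ξN integers. *)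

(* Defs.v *)
From mathcomp Require Import all_boot all_order all_algebra.
From mathcomp Require Import all_classical all_reals all_analysis.
Set Implicit Arguments.
Unset Strict Implicit.
Unset Printing Implicit Defensive.
Import numFieldNormedType.Exports.
Import Order.TTheory GRing.Theory Num.Theory.
Local Open Scope classical_set_scope.
Local Open Scope ring_scope.

Section Defs.
Variable R : realType.

Definition elog (r : R) : \bar R := if 0 < r then (ln r)%:E else -oo%E.

Definition Meas := {measure set R -> \bar R}.

Definition P01 (mu : Meas) : Prop :=
  mu setT = 1%E /\ mu (~` `[0%R, 1%R]) = 0%E.

(* integral of a (continuous, hence bounded) real function on [0,1] *)
Definition intC (mu : Meas) (f : R -> R) : R :=
  fine (\int[mu]_(x in `[0%R, 1%R]) (f x)%:E)%E.

(* open sets of the weak topology on P([0,1]) (topology generated by the maps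
   mu |-> int f dmu, f in C([0,1])); only points of P01 matter *)
Definition wopen (G : set Meas) : Prop :=
  forall mu, P01 mu -> G mu ->
    exists (n : nat) (fs : 'I_n -> R -> R) (e : R),
      0 < e /\ (forall i, {within `[0%R, 1%R], continuous (fs i)}) /\
      forall nu, P01 nu ->
        (forall i, `|intC nu (fs i) - intC mu (fs i)| < e) -> G nu.

Definition wclosed (F : set Meas) : Prop := wopen (~` F).

Definition wcompact (K : set Meas) : Prop :=
  K `<=` P01 /\
  forall (I : Type) (U : I -> set Meas), (forall i, wopen (U i)) ->
    (forall mu, K mu -> exists i, U i mu) ->
    exists (n : nat) (f : 'I_n -> I), forall mu, K mu -> exists j, U (f j) mu.

Definition good_rate (J : Meas -> \bar R) : Prop :=
  (forall mu, P01 mu -> (0 <= J mu)%E) /\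
  (forall c : R, wclosed [set mu | P01 mu /\ (J mu <= c%:E)%E]) /\
  (forall c : R, wcompact [set mu | P01 mu /\ (J mu <= c%:E)%E]).

Definition infJ (J : Meas -> \bar R) (F : set Meas) : \bar R :=
  ereal_inf (J @` (F `&` P01)).

(* Large deviation principle in P([0,1]) with speed s_k and good rate
   function J, for laws prob k (prob k A = probability that the k-th random
   measure lies in A) *)
Definition LDP (prob : nat -> set Meas -> R) (s : nat -> R)
    (J : Meas -> \bar R) : Prop :=
  good_rate J /\
  (forall F, wclosed F ->
     (limn_esup (fun k => ((s k)^-1)%:E * elog (prob k F)) <= - infJ J F)%E) /\
  (forall G, wopen G ->
     (- infJ J G <= limn_einf (fun k => ((s k)^-1)%:E * elog (prob k G)))%E).

(* (q^c)^x with q = exp(-eps) *)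
Definition qp (eps c x : R) : R := expR (- (eps * c * x)).

Definition qpoch (x qq : R) (n : nat) : R := \prod_(i < n) (1 - x * qq ^+ i).

Definition wd (eta theta alpha : R) (N M : nat) (t : int) (eps : R)
    (x : int) : R :=
  let X : R := x%:~R in
  let at_ := `|t|%N in
  let base := expR (- (alpha * eps * X)) * qp eps ((eta + theta) / 2) X in
  if (t <= 0)%R then
    base * qp eps eta (at_%:R * X) *
    qpoch (qp eps theta (X - at_%:R + 1)) (qp eps theta 1) (N - (M - at_))
  else if (M <= N - at_)%N then
    base * qp eps theta (at_%:R * X) *
    qpoch (qp eps theta (X + 1)) (qp eps theta 1) (N - at_ - M)
  else
    base * qp eps theta (at_%:R * X) *
    qpoch (qp eps eta (X + N%:R - at_%:R - M%:R + 1)) (qp eps eta 1)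
      (M - (N - at_)).

(* L_xi = number of particles *)
Definition Lnum (N M : nat) (t : int) : nat :=
  if (t <= 0)%R then (M - `|t|)%N
  else if (M <= N - `|t|)%N then M else (N - `|t|)%N.

Definition States (N M : nat) (t : int) : set (seq int) :=
  [set s | size s = Lnum N M t /\ sorted (fun a b => b < a) s /\
           all (fun x => (M%:Z - (Lnum N M t)%:Z <= x)%R) s].

Definition weight (eta theta alpha : R) (N M : nat) (t : int) (eps : R)
    (s : seq int) : R :=
  let L := Lnum N M t in
  (\prod_(i < L) \prod_(j < L | (i < j)%N)
      ((qp eps eta (nth 0 s j)%:~R - qp eps eta (nth 0 s i)%:~R) *
       (qp eps theta (nth 0 s j)%:~R - qp eps theta (nth 0 s i)%:~R))) *
  \prod_(i < L) wd eta theta alpha N M t eps (nth 0 s i).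

Definition empirical (N M : nat) (t : int) (eps : R) (s : seq int) : Meas :=
  mscale (((Lnum N M t)%:R : R)^-1)%:nng
    (msum (fun i => \d_(expR (- (eps * (nth 0 s i)%:~R))) : Meas)
          (Lnum N M t)).

Definition prob_emp (eta theta alpha : R) (N M : nat) (t : int) (eps : R)
    (A : set Meas) : R :=
  fine (\esum_(s in States N M t `&` [set s | A (empirical N M t eps s)])
          (weight eta theta alpha N M t eps s)%:E) /
  fine (\esum_(s in States N M t) (weight eta theta alpha N M t eps s)%:E).

Definition kappa (gamma xi : R) : R :=
  if xi <= 0 then gamma ^+ 2 - `|xi|
  else if xi <= 1 - gamma ^+ 2 then gamma ^+ 2 else 1 - xi.

Definition Hfun (eta theta gamma xi : R) (mu : Meas) : \bar R :=
  ((kappa gamma xi ^+ 2 / 2)%:E *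
   \int[mu]_(x in `[0%R, 1%R]) \int[mu]_(y in `[0%R, 1%R])
      (elog (`|x `^ theta - y `^ theta|)%R + elog (`|x `^ eta - y `^ eta|)%R))%E.

Definition K0fun (eta theta gamma xi : R) (mu : Meas) : \bar R :=
  if xi <= 1 - gamma ^+ 2 then
    ((kappa gamma xi * (1 - gamma ^+ 2 - xi))%:E *
     \int[mu]_(x in `[0%R, 1%R]) elog (1 - x `^ theta)%R)%E
  else
    ((kappa gamma xi * (xi + gamma ^+ 2 - 1))%:E *
     \int[mu]_(x in `[0%R, 1%R]) elog (1 - x `^ eta)%R)%E.

Definition Mfun (eta theta gamma xi : R) (mu : Meas) : \bar R :=
  if xi <= 0 then
    ((kappa gamma xi * eta * `|xi|)%:E * \int[mu]_(x in `[0%R, 1%R]) elog x)%E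
  else
    ((kappa gamma xi * theta * xi)%:E * \int[mu]_(x in `[0%R, 1%R]) elog x)%E.

Definition Ifun (eta theta gamma xi : R) (mu : Meas) : \bar R :=
  (- Hfun eta theta gamma xi mu - K0fun eta theta gamma xi mu
   - Mfun eta theta gamma xi mu)%E.

Definition Jfun (eta theta gamma xi : R) (mu : Meas) : \bar R :=
  (Ifun eta theta gamma xi mu - infJ (Ifun eta theta gamma xi) setT)%E.

End Defs.

(* Main.v *)
(** Truncating the logarithms at [-K] turns the rate functional into weakly continuous
functionals [IK K] that increase to it, which gives lower semicontinuity, and the space of
probability measures on [0,1] is weakly compact.

Upper bound: up to [exp(o(N^2))], the weight of a state with empirical measure [mu] is at most
[exp(- N^2 * IK K mu)] times a product of geometric weights, whose sum over all states is
[exp(o(N^2))] because [ln eps / N] tends to 0.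

Lower bound: a single good state suffices.  Restrict [mu] to [[delta, 1]] and choose points one
by one so that the conditional expectation, under i.i.d. sampling, of the discrete energy plus a
penalty for the deviations of finitely many test functions never increases.  In the coordinates
[- ln x / eps] the chosen points are rounded to distinct integers in such a way that no gap
decreases, so the Vandermonde factors survive, while the points move by [O(N * eps)] only. *)

From HB Require Import structures.
Require Import Defs.
From mathcomp Require Import all_boot all_order all_algebra.
From mathcomp Require Import all_classical all_reals all_analysis.
From mathcomp Require Import measurable_realfun ring lra.
Import numFieldNormedType.Exports.
Import Order.TTheory GRing.Theory Num.Theory.
Local Open Scope classical_set_scope.
Local Open Scope ring_scope.

Set Implicit Arguments.
Unset Strict Implicit.
Unset Printing Implicit Defensive.

(** * Averages and weak compactness *)

(** The three ranges of [xi] are one model with different parameters: a Vandermonde product times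
    one-particle weights made of a geometric factor [exp(- c eps x)], a power of the position and
    [nu N] Pochhammer factors.

    The level [K] plays opposite roles in the two bounds. In the upper bound it is fixed before N
    grows, because replacing the Pochhammer factors by their limit costs a multiple of [exp K];
    compactness supplies one [K] for a whole closed set. In the lower bound [K] is chosen after the
    number of particles: the bound on the sampled cost leaves out the diagonal and is uniform in
    [K], so [K] can exceed it. All costs being nonnegative, no logarithm is then truncated at the
    sampled points, and [mu] need not be regularised.

    The penalty has a coefficient [Lam] independent of N. Its test functions are centred, so its
    mean is only of order N, while a large [Lam] forces small deviations. The restriction to
    [delta, 1] keeps the geometric factors bounded below, and finite energy makes the lost mass
    small. *)

Section UniformContinuity.
Context {R : realType}.
Implicit Types (h g : R -> R) (x y e d : R).

(** Uniform continuity on [0,1] with an explicit modulus; by the next two lemmas this is the class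
    of test functions used in [wopen]. *)
Definition ucont01 h := forall e, 0 < e -> exists2 d, 0 < d &
  forall x y, 0 <= x <= 1 -> 0 <= y <= 1 -> `|x - y| < d -> `|h x - h y| < e.

(** Heine-Cantor, by the near-covering form of compactness applied to the filter of right
    neighbourhoods of 0 for the modulus [d]. *)
Lemma within_ucont01 h : {within `[0%R, 1%R], continuous h} -> ucont01 h.
Proof.
move=> hc e e0.
have := @segment_compact R 0 1; rewrite compact_near_coveringP => /(_ R (0^'+)
  (fun d x => forall y, 0 <= y <= 1 -> 0 <= x <= 1 -> `|x - y| < d -> `|h x - h y| < e)).
have F0 : Filter (0^'+ : set_system R) by apply: filter_filter.
move=> /(_ F0) H.
have : \forall d \near 0^'+, `[0%R, 1%R] `<=` (fun x => forall y, 0 <= y <= 1 ->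
   0 <= x <= 1 -> `|x - y| < d -> `|h x - h y| < e).
  apply: H => x x01.
  have e20 : 0 < e / 2 by rewrite divr_gt0.
  have /subspace_continuousP/(_ x x01)/cvgrPdist_lt/(_ _ e20) := hc.
  rewrite /within /= => -[r /= r0 hr].
  exists (ball x (r/2), [set d | 0 < d < r/2]).
    split=> /=; first exact/nbhsx_ballx/divr_gt0.
    have r2 : 0 < r / 2 by rewrite divr_gt0.
    exists (r/2) => //= d; rewrite /= sub0r normrN => + d0.
    by rewrite gtr0_norm// => ->; rewrite d0.
  move=> [x' d] /= [xx' /andP[d0 dr]] y y01 x'01 x'y.
  have h1 : `|h x - h x'| < e / 2.
    apply: hr; last by rewrite /= in_itv.
    by move: xx'; rewrite /ball /= => xx'; lra.
  have h2 : `|h x - h y| < e / 2.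
    apply: hr; last by rewrite /= in_itv.
    move: xx'; rewrite /ball /= => xx'.
    have -> : x - y = (x - x') + (x' - y) by ring.
    by rewrite (le_lt_trans (ler_normD _ _))//; lra.
  have -> : h x' - h y = (h x - h y) - (h x - h x') by ring.
  by rewrite (le_lt_trans (ler_normB _ _))//; lra.
move=> [d /= d0 Hd].
exists (d/2); first by rewrite divr_gt0.
move=> x y x01 y01 xy; apply: (Hd (d/2)) => //=.
  by rewrite /ball /= sub0r normrN gtr0_norm ?divr_gt0//; lra.
by rewrite divr_gt0.
Qed.

Lemma ucont01_within h : ucont01 h -> {within `[0%R, 1%R], continuous h}.
Proof.
move=> hu; apply/subspace_continuousP => x /=; rewrite in_itv /= => x01.
apply/cvgrPdist_lt => e e0; have [d d0 hd] := hu _ e0.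
rewrite /within /=; exists d => //= y xy; rewrite in_itv /= => y01.
exact: hd.
Qed.

Lemma ucont01_bounded h : ucont01 h ->
  exists2 B, 0 < B & forall x, 0 <= x <= 1 -> `|h x| <= B.
Proof.
move=> /ucont01_within hc.
have := continuous_compact hc (@segment_compact R 0 1).
move=> /compact_bounded [M [Mr hM]].
exists (`|M| + 1) => [|x x01]; first by have := normr_ge0 M; lra.
apply: (hM (`|M| + 1)); first by have := ler_norm M; lra.
by exists x => //=; rewrite in_itv.
Qed.

End UniformContinuity.

Section BoundedMeasurable.
Context {R : realType} (mu : Meas R) (D : set R).
Implicit Types (h g : R -> R).

(** A class of integrands stable under all the operations below and integrable for any measure
    finite on [D]. The integral [av] is not divided by the mass of [D]; its normalised version is
    [mean]. *)
Definition bmeas h := measurable_fun D h /\ exists B, forall x, D x -> `|h x| <= B.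
Definition av h : R := fine (\int[mu]_(x in D) (h x)%:E)%E.

Lemma ucont01_bmeas h : D `<=` `[0%R, 1%R] -> measurable D -> ucont01 h -> bmeas h.
Proof.
move=> D01 mD hu; split.
  apply: (measurable_funS _ D01) => //.
  apply: subspace_continuous_measurable_fun => //.
  exact: ucont01_within.
have [B B0 hB] := ucont01_bounded hu.
by exists B => x /D01 /=; rewrite in_itv /=; exact: hB.
Qed.

Lemma bmeas_cst c : bmeas (fun=> c).
Proof. by split; [exact: measurable_cst|exists `|c|]. Qed.

Lemma bmeasD h g : bmeas h -> bmeas g -> bmeas (fun x => h x + g x).
Proof.
move=> [mh [B hB]] [mg [C gC]]; split; first exact: measurable_funD.
by exists (B + C) => x Dx; rewrite (le_trans (ler_normD _ _))// lerD ?hB ?gC.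
Qed.

Lemma bmeasM h g : bmeas h -> bmeas g -> bmeas (fun x => h x * g x).
Proof.
move=> [mh [B hB]] [mg [C gC]]; split; first exact: measurable_funM.
by exists (B * C) => x Dx; rewrite normrM ler_pM ?hB ?gC.
Qed.

Lemma bmeasZ c h : bmeas h -> bmeas (fun x => c * h x).
Proof. by move=> hh; apply: bmeasM => //; exact: bmeas_cst. Qed.

Lemma bmeasB h g : bmeas h -> bmeas g -> bmeas (fun x => h x - g x).
Proof.
move=> hh gg; have := bmeasD hh (bmeasZ (-1) gg).
by under eq_fun do rewrite mulN1r.
Qed.

Lemma bmeas_sum (I : Type) (s : seq I) (h : I -> R -> R) :
  (forall i, bmeas (h i)) -> bmeas (fun x => \sum_(i <- s) h i x).
Proof.
move=> hh; elim: s => [|i s ih].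
  by under eq_fun do rewrite big_nil; exact: bmeas_cst.
by under eq_fun do rewrite big_cons; apply: bmeasD.
Qed.

Hypothesis mD : measurable D.
Hypothesis finD : (mu D < +oo)%E.

Lemma bmeas_integrable h : bmeas h -> mu.-integrable D (EFin \o h).
Proof.
move=> [mh [B hB]]; apply: measurable_bounded_integrable => //.
exists B; split; first exact: num_real.
by move=> M BM x /= Dx; rewrite (le_trans (hB _ Dx))// ltW.
Qed.

Lemma avD h g : bmeas h -> bmeas g -> av (fun x => h x + g x) = av h + av g.
Proof. by move=> hh gg; apply: RintegralD => //; exact: bmeas_integrable. Qed.

Lemma avB h g : bmeas h -> bmeas g -> av (fun x => h x - g x) = av h - av g.
Proof. by move=> hh gg; apply: RintegralB => //; exact: bmeas_integrable. Qed.

Lemma avZ c h : bmeas h -> av (fun x => c * h x) = c * av h.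
Proof. by move=> hh; apply: RintegralZl => //; exact: bmeas_integrable. Qed.

Lemma av_cst c : av (fun=> c) = c * fine (mu D).
Proof. exact: Rintegral_cst. Qed.

Lemma av_le h g : bmeas h -> bmeas g -> (forall x, D x -> h x <= g x) -> av h <= av g.
Proof. by move=> hh gg hg; apply: le_Rintegral => //; exact: bmeas_integrable. Qed.

Lemma av_ge0 h : (forall x, D x -> 0 <= h x) -> 0 <= av h.
Proof. exact: Rintegral_ge0. Qed.

Lemma eq_av h g : (forall x, D x -> h x = g x) -> av h = av g.
Proof. by move=> hg; apply: eq_Rintegral => x; rewrite inE; exact: hg. Qed.

Lemma av_sum (I : Type) (s : seq I) (h : I -> R -> R) :
  (forall i, bmeas (h i)) ->
  av (fun x => \sum_(i <- s) h i x) = \sum_(i <- s) av (h i).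
Proof.
move=> hh; elim: s => [|i s ih].
  by rewrite big_nil; under eq_fun do rewrite big_nil; rewrite av_cst mul0r.
rewrite big_cons -ih -avD//; last exact: bmeas_sum.
by congr av; apply/funext => x; rewrite big_cons.
Qed.

Lemma av_EFin h : bmeas h -> ((av h)%:E = \int[mu]_(x in D) (h x)%:E)%E.
Proof.
move=> hh; rewrite /av fineK//; apply: integrable_fin_num => //.
exact: (bmeas_integrable hh).
Qed.

Lemma av_norm_le h B : bmeas h -> (forall x, D x -> `|h x| <= B) ->
  `|av h| <= B * fine (mu D).
Proof.
move=> hh hB; rewrite ler_norml -mulNr -!av_cst.
by apply/andP; split; apply: av_le => //; try exact: bmeas_cst;
  move=> x /hB; rewrite ler_norml => /andP[].
Qed.

(** Otherwise [h] minus its mean would be positive on [D] with zero integral, hence zero almost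
    everywhere, and [D] would be null. This is the step from an expectation to an actual point in
    the sampling. *)
Lemma exists_le_av h : 0 < fine (mu D) -> bmeas h ->
  exists2 x, D x & h x * fine (mu D) <= av h.
Proof.
move=> D0 hh; apply/not_exists2P => H.
have hlt x : D x -> av h < h x * fine (mu D).
  by move=> Dx; rewrite ltNge; apply/negP; case: (H x).
have [mh _] := hh.
set m := fine (mu D); set a := av h / m.
have ah x : D x -> a < h x by move=> Dx; rewrite ltr_pdivrMr//; exact: hlt.
have hb : bmeas (fun x => h x - a) by apply: bmeasB => //; exact: bmeas_cst.
have : av (fun x => h x - a) = 0.
  rewrite avB//; last exact: bmeas_cst.
  by rewrite av_cst /a mulfVK ?subrr// gt_eqF.
move=> av0.
have : (\int[mu]_(x in D) `|(h x - a)%:E| = 0)%E.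
  rewrite (eq_integral (fun x => (h x - a)%:E)).
    by rewrite -av_EFin// av0.
  by move=> x; rewrite inE => Dx; rewrite gee0_abs// lee_fin subr_ge0 ltW// ah.
move/ae_eq_integral_abs => /= /(_ mD).
have mha : measurable_fun D (fun x => (h x - a)%:E).
  by apply/measurable_EFinP; case: hb.
move=> /(_ mha) [A [mA A0 DA]].
have : D `<=` A.
  move=> x Dx; apply: DA => /= /(_ Dx) [] /eqP; rewrite subr_eq0 => /eqP hxa.
  by have := ah _ Dx; rewrite hxa ltxx.
move=> DA'; have : (mu D <= mu A)%E by apply: le_measure; rewrite ?inE.
have -> : mu A = 0%E by [].
move=> D00.
move: D0; rewrite ltNge => /negP; apply.
have /eqP -> : mu D == 0%E by rewrite eq_le D00 /=.
by [].
Qed.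

End BoundedMeasurable.

(** * Limits along ultrafilters and measures with a given distribution function *)

Section UltraLimits.
Context {R : realType}.

Lemma ultra_bounded_cvg (T : Type) (G : set_system T) (h : T -> R) (B : R) :
  UltraFilter G -> G [set x | `|h x| <= B] ->
  exists l : R, forall e, 0 < e -> G [set x | `|h x - l| < e].
Proof.
move=> UG GB.
have PG : ProperFilter G := ultra_proper.
have : (h @ G) `[- B, B]%classic.
  rewrite /= /fmap /=; apply: filterS GB => x /=.
  by rewrite in_itv /= -ler_norml.
have PH : ProperFilter (h @ G) by exact: fmap_proper_filter.
move=> /(@segment_compact R (- B) B _ PH) [l [_ ll]].
exists l => e e0.
have [//|Gn] := in_ultra_setVsetC [set x | `|h x - l| < e] UG.
have bl : nbhs l (ball l e) by exact: nbhsx_ballx.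
have [y []] := ll _ _ (Gn : (h @ G) [set y | ~ (`|y - l| < e)]) bl.
by move=> /= + by_; case; move: by_; rewrite /ball /= distrC.
Qed.

(** Pigeonhole: among [m + 1] equally spaced points inside [(a, b)], with [m * e > 1], the
    increments of [G] cannot all exceed [e]. It provides points where a distribution function is
    almost continuous. *)
Lemma monotone_small_increment (G : R -> R) (a b e : R) :
  {homo G : x y / x <= y} -> (forall x, 0 <= G x <= 1) -> a < b -> 0 < e ->
  exists s t, [/\ a < s, s < t, t < b & G t - G s <= e].
Proof.
move=> nd G01 ab e0; apply: contrapT => H.
set m := (Num.truncn e^-1).+1.
have me : 1 < m%:R * e.
  by rewrite -ltr_pdivrMr// mul1r truncnS_gt.
pose p i : R := a + (b - a) * (i.+1)%:R / (m.+2)%:R.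
have m0 : 0 < (m.+2)%:R :> R by rewrite ltr0n.
have inc i : (i < m)%N -> G (p i) + e < G (p i.+1).
  move=> im; rewrite -ltrBrDl ltNge; apply/negP => Hle; apply: H.
  exists (p i), (p i.+1); split => //.
  - by rewrite ltrDl divr_gt0// mulr_gt0 ?subr_gt0.
  - by rewrite ltrD2l ltr_pM2r ?invr_gt0// ltr_pM2l ?subr_gt0// ltr_nat.
  - rewrite /p -ltrBrDl ltr_pdivrMr// ltr_pM2l ?subr_gt0// ltr_nat.
    by rewrite ltnS.
have : G (p 0%N) + m%:R * e <= G (p m).
  suff H2 : forall i, (i <= m)%N -> G (p 0%N) + i%:R * e <= G (p i) by exact: H2.
  elim=> [|i ih] im; first by rewrite mul0r addr0.
  rewrite (le_trans _ (ltW (inc _ im)))// -natr1 mulrDl mul1r addrA lerD2r.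
  exact/ih/ltnW.
have /andP[? _] := G01 (p 0%N); have /andP[_ ?] := G01 (p m); lra.
Qed.

(* [measurableTypeR R] and [R] carry the same sigma-algebra under different displays. *)
Lemma measurableTypeR_Meas (P : {measure set (measurableTypeR R) -> \bar R}) :
  exists nu : Meas R, nu = P :> (set R -> \bar R).
Proof.
pose m : set R -> \bar R := P.
have m0 : m set0 = 0%E by exact: (measure0 P).
have mge0 A : (0 <= m A)%E by exact: (measure_ge0 P).
have mss : semi_sigma_additive m by exact: (@measure_semi_sigma_additive _ _ _ P).
pose c := isMeasure.Build _ _ _ m m0 mge0 mss.
pose nu : Meas R := HB.pack m c.
by exists nu.
Qed.

(** The Lebesgue-Stieltjes measure of [G]. Nothing is assumed at 0 beyond right continuity, so an
    atom at 0 is possible. *)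
Lemma cumulative_measure (G : R -> R) :
  {homo G : x y / x <= y} -> (forall x, G y @[y --> x^'+] --> G x) ->
  (forall x, x < 0 -> G x = 0) -> (forall x, 1 <= x -> G x = 1) ->
  exists2 nu : Meas R, P01 nu & forall x, nu `]-oo, x]%classic = (G x)%:E.
Proof.
move=> nd rc G0 G1.
have Ny0 : G y @[y --> -oo] --> (0 : R).
  apply: cvg_near_cst; near=> y; rewrite G0//.
have y1 : G y @[y --> +oo] --> (1 : R).
  apply: cvg_near_cst; near=> y; rewrite G1//.
pose c1 := isCumulative.Build R _ R G nd rc.
pose c2 := isCumulativeBounded.Build R 0 1 G Ny0 y1.
pose f : cumulativeBounded (0:R) (1:R) := HB.pack G c1 c2.
have cd x := cdf_lebesgue_stieltjes_id f x.
have [nu nuP] := measurableTypeR_Meas (lebesgue_stieltjes_measure f).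
have nuE x : nu `]-oo, x]%classic = (G x)%:E by rewrite nuP; exact: cd.
have nuT : nu setT = 1%E.
  by rewrite nuP; exact: (@probability_setT _ _ _ (lebesgue_stieltjes_measure f)).
exists nu => //; split => //.
have -> : ~` `[0%R, 1%R]%classic = `]-oo, 0%R[%classic `|` `]1%R, +oo[%classic :> set R.
  apply/seteqP; split=> x /=; rewrite !in_itv /= ?andbT.
    by move/negP; rewrite negb_and -!ltNge => /orP.
  by move=> H; apply/negP; rewrite negb_and -!ltNge; apply/orP.
apply/eqP; rewrite eq_le measure_ge0 andbT.
have m1 : nu `]1%R, +oo[%classic = 0%E.
  have h : (nu (~` `]-oo, 1%R]%classic) = 1 - nu `]-oo, 1%R]%classic)%E.
    rewrite nuP; exact: (@probability_setC _ _ _ (lebesgue_stieltjes_measure f)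
      `]-oo, 1%R]%classic (measurable_itv _)).
  by rewrite -setCitvl h nuE G1// subee.
(* [G] gives the mass of closed half-lines and [G 0] may be positive, so the open half-line is
   exhausted by closed ones. *)
have m0 : nu `]-oo, 0%R[%classic = 0%E.
  have : nu.-negligible (\bigcup_n `]-oo, - (n.+1%:R^-1)]%classic).
    apply: negligible_bigcup => n; exists `]-oo, - (n.+1%:R^-1)]%classic; split => //.
    by rewrite nuE G0// oppr_lt0 invr_gt0.
  have -> : \bigcup_n `]-oo, - (n.+1%:R^-1)]%classic = `]-oo, 0%R[%classic :> set R.
    apply/seteqP; split=> x /=; rewrite in_itv /=.
      by move=> [n _ /=]; rewrite in_itv /= => /le_lt_trans; apply; rewrite oppr_lt0 invr_gt0.
    move=> x0; exists (Num.truncn (- x)^-1) => //=; rewrite in_itv /= lerNr.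
    rewrite -[leRHS]invrK lef_pV2 ?posrE ?invr_gt0 ?oppr_gt0//.
    exact/ltW/truncnS_gt.
  by move/negligibleP; apply.
apply: (@le_trans _ _ (nu `]-oo, 0%R[%classic + nu `]1%R, +oo[%classic)%E).
  by apply: measureU2; exact: measurable_itv.
by rewrite m0 m1 adde0.
Unshelve. all: by end_near. Qed.

End UltraLimits.

Section WeakCompactness.
Context {R : realType}.
Implicit Types (mu nu : Meas R) (f : R -> R) (t e x : R).

Local Notation I01 := (`[0%R, 1%R]%classic : set R).

Lemma measurable_I01 : measurable I01. Proof. exact: measurable_itv. Qed.

Lemma P01_mu01 mu : P01 mu -> mu I01 = 1%E.
Proof.
move=> [muT mu0]; have m01 := measurable_I01.
have h : (mu (~` I01 `|` I01) = mu (~` I01) + mu I01)%E.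
  by apply: measureU; rewrite ?setICl//; exact: measurableC.
by move: h; rewrite mu0 setvU muT add0e.
Qed.

Lemma P01_lty mu : P01 mu -> (mu I01 < +oo)%E.
Proof. by move=> /P01_mu01 ->; rewrite ltry. Qed.

Lemma P01_fine mu : P01 mu -> fine (mu I01) = 1.
Proof. by move=> /P01_mu01 ->. Qed.

Definition step t x : R := ((x <= t)%R)%:R.

Lemma stepE t : step t = \1_(`]-oo, t]%classic).
Proof.
apply/funext => x; rewrite /step indicE; congr (_ %:R); congr nat_of_bool.
by apply/idP/idP; rewrite inE /= in_itv.
Qed.

Lemma bmeas_step t D : measurable D -> bmeas D (step t).
Proof.
move=> mD; split; first by rewrite stepE; exact: measurable_indic.
by exists 1 => x _; rewrite /step; case: (x <= t); rewrite ?normr1 ?normr0.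
Qed.

Definition dist01 mu t := av mu I01 (step t).

Lemma dist01E mu t : P01 mu -> (dist01 mu t)%:E = mu `]-oo, t]%classic.
Proof.
move=> Pmu; have m01 := measurable_I01.
rewrite av_EFin//; [|exact: P01_lty|exact: bmeas_step].
rewrite stepE integral_indic//.
have -> : mu `]-oo, t]%classic = (mu (`]-oo, t]%classic `&` I01) +
    mu (`]-oo, t]%classic `\` I01))%E.
  by rewrite addeC -measureDI.
rewrite [X in (_ + X)%E](_ : _ = 0%E) ?adde0//.
apply/eqP; rewrite eq_le measure_ge0 andbT.
case: Pmu => _ <-; apply: le_measure; rewrite ?inE.
- exact: measurableD.
- exact: measurableC.
- by move=> x [].
Qed.

Lemma dist01_ge0 mu t : P01 mu -> 0 <= dist01 mu t.
Proof. by move=> _; apply: av_ge0 => x _; rewrite /step ler0n. Qed.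

Lemma dist01_le1 mu t : P01 mu -> dist01 mu t <= 1.
Proof.
move=> Pmu; rewrite -(P01_fine Pmu) -[leRHS]mul1r -av_cst//.
apply: av_le => //; [exact: P01_lty|exact: bmeas_step|exact: bmeas_cst|].
by move=> x _; rewrite /step; case: (x <= t).
Qed.

Lemma dist01_homo mu t t' : P01 mu -> t <= t' -> dist01 mu t <= dist01 mu t'.
Proof.
move=> Pmu tt'; apply: av_le => //; [exact: P01_lty|exact: bmeas_step..|].
by move=> x _; rewrite /step ler_nat; case: (leP x t) => // /le_trans ->.
Qed.

Lemma dist01_lt0 mu t : P01 mu -> t < 0 -> dist01 mu t = 0.
Proof.
move=> Pmu t0; have <- : av mu I01 (fun=> 0) = 0 by rewrite av_cst// mul0r.
apply: eq_av => x /=; rewrite in_itv /step /= => /andP[x0 _].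
by rewrite leNgt (lt_le_trans t0 x0).
Qed.

Lemma dist01_ge1 mu t : P01 mu -> 1 <= t -> dist01 mu t = 1.
Proof.
move=> Pmu t0; rewrite -(P01_fine Pmu) -[RHS]mul1r -av_cst//.
apply: eq_av => x /=; rewrite in_itv /step /= => /andP[_ x1].
by rewrite (le_trans x1 t0).
Qed.

(* Riemann-Stieltjes sum of [f] along [p 0 < ... < p n.+1] tagged at the points [i / n]. *)
Lemma av_riemann mu f (e : R) (n : nat) (p : nat -> R) :
  P01 mu -> ucont01 f -> (0 < n)%N ->
  (forall i, (i%:R - 1) / n%:R < p i < i%:R / n%:R) ->
  (forall x y, 0 <= x <= 1 -> 0 <= y <= 1 -> `|x - y| < 2 / n%:R -> `|f x - f y| < e) ->
  `|av mu I01 f - \sum_(i < n.+1) f (i%:R / n%:R) *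
        (dist01 mu (p i.+1) - dist01 mu (p i))| <= e.
Proof.
move=> Pmu uf n0 pP fe; have m01 := measurable_I01; have fin := P01_lty Pmu.
have n0' : 0 < n%:R :> R by rewrite ltr0n.
pose g x := \sum_(i < n.+1) f (i%:R / n%:R) * (step (p i.+1) x - step (p i) x).
have bs t : bmeas I01 (step t) by exact: bmeas_step.
have bd i : bmeas I01 (fun x => step (p i.+1) x - step (p i) x) by exact: bmeasB.
have bg : bmeas I01 g by apply: bmeas_sum => i; exact: bmeasZ.
have bf : bmeas I01 f by exact: ucont01_bmeas.
rewrite [X in _ - X](_ : _ = av mu I01 g); last first.
  rewrite /g av_sum//; last by move=> i; exact: bmeasZ.
  by apply: eq_bigr => i _; rewrite avZ// avB.
rewrite -avB//; have -> : e = e * fine (mu I01) by rewrite P01_fine// mulr1.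
apply: av_norm_le => //; first exact: bmeasB.
move=> x; rewrite /= in_itv /= => /andP[x0 x1].
have pmono i : p i <= p i.+1.
  have /andP[_ h1] := pP i; have /andP[h2 _] := pP i.+1.
  by apply/ltW/(lt_trans h1); move: h2; rewrite -[i.+1%:R]natr1 addrK.
(* The differences are the indicators of the intervals [(p i, p i.+1]], which cover [0,1] because
   [p 0 < 0] and [p n.+1 > 1]. *)
have tel : \sum_(i < n.+1) (step (p i.+1) x - step (p i) x) = 1.
  rewrite -(big_mkord xpredT (fun i => step (p i.+1) x - step (p i) x)).
  rewrite (telescope_sumr (fun i => step (p i) x))// /step.
  have /andP[hp1 _] := pP n.+1; have /andP[_ hp2] := pP 0%N.
  rewrite mul0r in hp2; rewrite (leNgt x (p 0%N)) (lt_le_trans hp2 x0) subr0.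
  rewrite (le_trans x1)//; apply/ltW/(le_lt_trans _ hp1).
  by rewrite -[n.+1%:R]natr1 addrK divff// gt_eqF.
rewrite /g -[f x]mulr1 -[X in f x * X]tel mulr_sumr -sumrB.
rewrite (le_trans (ler_norm_sum _ _ _))// -[leRHS]mulr1 -[X in _ <= _ * X]tel mulr_sumr.
apply: ler_sum => i _; rewrite -mulrBl normrM.
have -> : `|step (p i.+1) x - step (p i) x| = step (p i.+1) x - step (p i) x.
  rewrite ger0_norm// subr_ge0 /step ler_nat.
  by case: (leP x (p i)) => // /le_trans ->.
rewrite /step; case: (leP x (p i)) => [xp|px].
  by rewrite (le_trans xp)// subrr !mulr0.
case: (leP x (p i.+1)) => [xp|px']; last by rewrite subrr !mulr0.
rewrite subr0 !mulr1; apply/ltW/fe; first by rewrite x0.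
  apply/andP; split; first by rewrite divr_ge0 ?ler0n.
  by rewrite ler_pdivrMr// mul1r ler_nat -ltnS.
have /andP[h1 _] := pP i; have /andP[_ h2] := pP i.+1.
have e1 : (i%:R - 1) / n%:R = i%:R / n%:R - 1 / n%:R :> R by rewrite mulrBl.
have e2 : i.+1%:R / n%:R = i%:R / n%:R + 1 / n%:R :> R by rewrite -natr1 mulrDl.
have e3 : 2 / n%:R = 1 / n%:R + 1 / n%:R :> R by rewrite -mulrDl.
have e4 : 0 < 1 / n%:R :> R by rewrite divr_gt0.
rewrite e1 in h1; rewrite e2 in h2; rewrite e3 ltr_norml; apply/andP; split; lra.
Qed.

End WeakCompactness.

Section Prokhorov.
Context {R : realType}.
Implicit Types (mu nu : Meas R) (f : R -> R).

Local Notation I01 := (`[0%R, 1%R]%classic : set R).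

(** Helly selection along an ultrafilter: the distribution functions converge pointwise to [F],
    whose right-continuous regularisation [Gf] defines [nu]. Integrals are compared through
    Riemann-Stieltjes sums with division points at which [F] and [Gf] nearly agree. *)
Lemma P01_ultra_limit (G : set_system (Meas R)) :
  UltraFilter G -> G (@P01 R) ->
  exists2 nu, P01 nu & forall f e, ucont01 f -> 0 < e ->
    G [set mu | `|av mu I01 f - av nu I01 f| < e].
Proof.
move=> UG GP; have PG : ProperFilter G := ultra_proper.
have /choice[F FP] : forall t, exists l : R, forall e, 0 < e ->
    G [set mu | `|dist01 mu t - l| < e].
  move=> t; apply: (@ultra_bounded_cvg _ _ _ _ 1) => //.
  apply: filterS GP => mu /= Pmu.
  by rewrite ger0_norm ?dist01_ge0 ?dist01_le1.
have Fcmp t t' c : (forall mu, P01 mu -> dist01 mu t <= dist01 mu t' + c) -> F t <= F t' + c.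
  move=> H; rewrite leNgt; apply/negP => lt.
  pose e := (F t - (F t' + c)) / 2.
  have e0 : 0 < e by rewrite divr_gt0// subr_gt0.
  have [mu [[/= h1 h2] h3]] := filter_ex (filterI (filterI (FP t e e0) (FP t' e e0)) GP).
  have := H mu h3; move: h1 h2; rewrite !ltr_norml /e => /andP[? ?] /andP[? ?]; lra.
have Fmono t t' : t <= t' -> F t <= F t'.
  move=> tt'; rewrite -[leRHS]addr0; apply: Fcmp => mu Pmu.
  by rewrite addr0 dist01_homo.
have Feq t c : (forall mu, P01 mu -> dist01 mu t = c) -> F t = c.
  move=> H; apply/eqP; rewrite -subr_eq0 -normr_le0 leNgt; apply/negP => lt.
  have [mu [/= h1 h3]] := filter_ex (filterI (FP t _ lt) GP).
  by move: h1; rewrite H// distrC ltxx.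
have F0 t : t < 0 -> F t = 0 by move=> t0; apply: Feq => mu Pmu; rewrite dist01_lt0.
have F1 t : 1 <= t -> F t = 1 by move=> t0; apply: Feq => mu Pmu; rewrite dist01_ge1.
have F01 t : 0 <= F t <= 1.
  apply/andP; split.
    rewrite -(F0 (Num.min t (-1))) ?Fmono ?ge_min ?lexx//.
    by rewrite gt_min ltrN10 orbT.
  rewrite -(F1 (Num.max t 1)) ?Fmono ?le_max ?lexx ?orbT//.
pose Gf x := inf [set F y | y in `]x, +oo[%classic].
have Gne x : [set F y | y in `]x, +oo[%classic] !=set0.
  by exists (F (x + 1)), (x + 1) => //=; rewrite in_itv /= andbT ltrDl.
have Glb x : has_lbound [set F y | y in `]x, +oo[%classic].
  by exists 0 => _ [y _ <-]; have /andP[] := F01 y.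
have Gle x y : x < y -> Gf x <= F y.
  by move=> xy; apply: ge_inf => //; exists y => //=; rewrite in_itv /= andbT.
have Gge x c : (forall y, x < y -> c <= F y) -> c <= Gf x.
  move=> H; apply: lb_le_inf => // _ [y xy <-]; apply: H.
  by move: xy; rewrite /= in_itv /= andbT.
have FG x : F x <= Gf x by apply: Gge => y /ltW; exact: Fmono.
have Gmono : {homo Gf : x y / x <= y}.
  by move=> x y xy; apply: Gge => z yz; apply: Gle; exact: le_lt_trans yz.
have Grc x : Gf y @[y --> x^'+] --> Gf x.
  apply/cvgrPdist_lt => e e0.
  have [_ [y xy <-] yle] := inf_adherent e0 (conj (Gne x) (Glb x)).
  move: xy; rewrite /= in_itv /= andbT => xy.
  near=> z; rewrite ler0_norm ?subr_le0 ?Gmono// opprB ltrBlDl.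
  by rewrite (le_lt_trans _ yle)// Gle//; near: z; exact: nbhs_right_lt.
have G0 x : x < 0 -> Gf x = 0.
  move=> x0; apply/eqP; rewrite eq_le (le_trans (Gle x (x/2) _)) ?F0//; [|lra|lra].
  by apply: Gge => y _; have /andP[] := F01 y.
have G1 x : 1 <= x -> Gf x = 1.
  move=> x1; apply/eqP; rewrite eq_le (le_trans (Gle x (x+1) _)) ?F1//; [|lra|lra].
  by apply: Gge => y xy; rewrite F1// ltW// (le_lt_trans x1).
have [nu Pnu nuE] := cumulative_measure Gmono Grc G0 G1.
have G01 x : 0 <= Gf x <= 1.
  have [x0|x0] := ltP x 0; first by rewrite G0// lexx ler01.
  rewrite (le_trans _ (FG x)) ?(le_trans (Gle x (x + 1) _)) ?ltrDl//.
    by have /andP[] := F01 (x + 1).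
  by have /andP[] := F01 x.
have nuG x : dist01 nu x = Gf x by apply: EFin_inj; rewrite dist01E.
exists nu => // f e uf e0.
have e30 : 0 < e / 4 by rewrite divr_gt0.
have [d d0 fd] := uf _ e30.
have [B B0 fB] := ucont01_bounded uf.
pose n := (Num.truncn (2 / d)).+1.
have n0 : 0 < n%:R :> R by rewrite ltr0n.
have nd : 2 / n%:R < d by rewrite ltr_pdivrMr// -ltr_pdivrMl// mulrC truncnS_gt.
(* Each of the [n.+1] terms of the Riemann sum differs by at most [B * (4 * e')]: at both ends of
   the interval, [e'] for the ultrafilter limit and [e'] for [Gf - F]. In total this is [e / 4]. *)
pose e' : R := e / (16 * B * n.+1%:R).
have e'0 : 0 < e' by rewrite divr_gt0// !mulr_gt0// ltr0n.
(* If [s < t] and [Gf t - Gf s <= e'], then [Gf s <= F t <= Gf t] bounds [Gf t - F t] by [e']. *)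
have /choice[p pP] : forall i : nat, exists t : R,
    ((i%:R - 1) / n%:R < t < i%:R / n%:R) /\ `|F t - Gf t| <= e'.
  move=> i; have ab : (i%:R - 1) / n%:R < i%:R / n%:R :> R.
    by rewrite ltr_pM2r ?invr_gt0// ltrBlDr ltrDl.
  have [s [t [as_ st tb Hst]]] := monotone_small_increment Gmono G01 ab e'0.
  exists t; split; first by rewrite (lt_trans as_ st) tb.
  have := FG t; have := Gle _ _ st => h1 h2.
  by rewrite ler0_norm ?subr_le0// opprB; apply: le_trans Hst; lra.
have near_p : G [set mu | forall i : 'I_n.+2, `|dist01 mu (p i) - F (p i)| < e'].
  by apply: filter_forall => i; exact: FP.
apply: filterS (filterI near_p GP) => mu [/= Hp Pmu].
pose S (m : Meas R) := \sum_(i < n.+1) f (i%:R / n%:R) *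
        (dist01 m (p i.+1) - dist01 m (p i)).
have fe x y : 0 <= x <= 1 -> 0 <= y <= 1 -> `|x - y| < 2 / n%:R -> `|f x - f y| < e / 4.
  by move=> x01 y01 xy; apply: fd => //; exact: lt_trans nd.
have p1 i := (pP i).1.
have R1 := av_riemann Pmu uf (ltn0Sn _) p1 fe.
have R2 := av_riemann Pnu uf (ltn0Sn _) p1 fe.
rewrite -/(S mu) in R1; rewrite -/(S nu) in R2.
have RS : `|S mu - S nu| <= e / 4.
  rewrite /S -sumrB (le_trans (ler_norm_sum _ _ _))//.
  have -> : e / 4 = \sum_(i < n.+1) B * (4 * e').
    rewrite sumr_const card_ord -mulr_natr /e'.
    have : n.+1%:R != 0 :> R by rewrite pnatr_eq0.
    by have : B != 0 by [rewrite gt_eqF]; move=> ? ?; field; apply/andP.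
  apply: ler_sum => i _; rewrite -mulrBr normrM; apply: ler_pM => //.
    apply: fB; apply/andP; split; first by rewrite divr_ge0 ?ler0n.
    by rewrite ler_pdivrMr// mul1r ler_nat -ltnS.
  rewrite !nuG.
  have := Hp (lift ord0 i); rewrite lift0 => h1.
  have := Hp (widen_ord (leqnSn _) i) => /= h2.
  have [_ h3] := pP i; have [_ h4] := pP i.+1.
  move: h1 h2 h3 h4; rewrite !ltr_norml !ler_norml.
  move=> /andP[? ?] /andP[? ?] /andP[? ?] /andP[? ?].
  apply/andP; split; lra.
move: R1 R2 RS; rewrite !ler_norml ltr_norml.
move=> /andP[? ?] /andP[? ?] /andP[? ?].
apply/andP; split; lra.
Unshelve. all: by end_near. Qed.

Lemma P01_wcompact : wcompact (@P01 R).
Proof.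
split => // I U oU cU; apply: contrapT => H.
(* The filter generated by [P01] and the complements of the members of the cover. It is proper when
   there is no finite subcover, and the limit of a finer ultrafilter then lies in no [U i]. *)
pose FF (A : set (Meas R)) := exists (n : nat) (f : 'I_n -> I),
  forall mu, P01 mu -> (forall j, ~ U (f j) mu) -> A mu.
have FFp : ProperFilter FF.
  apply: Build_ProperFilter_ex.
    move=> A [n [f fA]]; apply: contrapT => A0; apply: H; exists n, f => mu Pmu.
    apply: contrapT => /forallNP nU; apply: A0; exists mu; exact: fA.
  split.
  - by exists 0%N, (fun i : 'I_0 => match i with Ordinal m Hm => match notF Hm with end end).
  - move=> A B [n [f fA]] [m [g gB]].
    exists (n + m)%N, (fun i : 'I_(n + m) => match fintype.split i with inl a => f a | inr b => g b end).
    move=> mu Pmu nU; split.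
      apply: fA => // j; have := nU (lshift m j).
      by rewrite (unsplitK (inl j)).
    apply: gB => // j; have := nU (rshift n j).
    by rewrite (unsplitK (inr j)).
  - by move=> A B AB [n [f fA]]; exists n, f => mu Pmu nU; apply/AB/fA.
have [G [UG FG]] := ultraFilterLemma FFp.
have GP : G (@P01 R).
  apply: FG; exists 0%N, (fun i : 'I_0 => match i with Ordinal m Hm => match notF Hm with end end).
  by [].
have PG : ProperFilter G := ultra_proper.
have [nu Pnu nuP] := P01_ultra_limit UG GP.
have [i Ui] := cU _ Pnu.
have [n [fs [e [e0 [cfs He]]]]] := oU i nu Pnu Ui.
have Gn : G [set mu | ~ U i mu].
  by apply: FG; exists 1%N, (fun=> i) => mu Pmu /(_ ord0).
have Gu : G [set mu | forall j : 'I_n, `|av mu I01 (fs j) - av nu I01 (fs j)| < e].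
  by apply: filter_forall => j; apply: nuP => //; exact: within_ucont01.
have [mu [[/= h1 h2] h3]] := filter_ex (filterI (filterI Gn Gu) GP).
by apply: h1; apply: He.
Qed.

End Prokhorov.

(** * Truncated energy *)

Section TruncatedLog.
Context {R : realType}.
Implicit Types (K r a b : R).

(** The maximum is taken inside the logarithm, so that [lnt K r] equals [- K] for every
    [r <= exp(- K)], zero and negative [r] included. *)
Definition lnt K r : R := ln (Num.max r (expR (- K))).

Lemma lnt_max_gt0 K r : 0 < Num.max r (expR (- K)).
Proof. by rewrite lt_max expR_gt0 orbT. Qed.

Lemma lnt_ge K r : - K <= lnt K r.
Proof.
by rewrite /lnt -[leLHS](expRK (- K)) ler_ln ?posrE ?expR_gt0 ?lnt_max_gt0// le_max lexx orbT.
Qed.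

Lemma lnt_le0 K r : 0 <= K -> r <= 1 -> lnt K r <= 0.
Proof.
by move=> K0 r1; apply: ln_le0; rewrite ge_max r1 -expR0 ler_expR oppr_le0.
Qed.

Lemma lnt_leK K a b : a <= b -> lnt K a <= lnt K b.
Proof.
move=> ab; rewrite /lnt ler_ln ?posrE ?lnt_max_gt0// ge_max le_max ab/=.
by rewrite le_max lexx orbT.
Qed.

Lemma lnt_anti K K' r : K <= K' -> lnt K' r <= lnt K r.
Proof.
move=> KK'; rewrite /lnt ler_ln ?posrE ?lnt_max_gt0// ge_max le_max lexx/=.
by rewrite le_max ler_expR lerN2 KK' orbT.
Qed.

Lemma lnt0 K : lnt K 0 = - K.
Proof. by rewrite /lnt max_r ?expR_ge0// expRK. Qed.

Lemma lnt_gt K r : - K < lnt K r -> 0 < r /\ lnt K r = ln r.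
Proof.
rewrite /lnt; case: (leP r (expR (- K))) => [|h _]; first by rewrite expRK ltxx.
by split => //; rewrite (lt_trans _ h)// expR_gt0.
Qed.

Lemma lntE K r : expR (- K) <= r -> lnt K r = ln r.
Proof. by move=> h; rewrite /lnt max_l. Qed.

Lemma le_expR_lnt K r : r <= expR (lnt K r).
Proof. by rewrite lnK ?posrE ?lnt_max_gt0// le_max lexx. Qed.

Lemma ln_sub_le a b : 0 < b -> b <= a -> ln a - ln b <= (a - b) / b.
Proof.
move=> b0 ba; have a0 := lt_le_trans b0 ba.
rewrite -ln_div ?posrE//.
have -> : a / b = 1 + (a - b) / b by rewrite mulrBl divff ?gt_eqF// addrC subrK.
by apply/le_ln1Dx/(lt_le_trans (ltrN10 R)); rewrite divr_ge0 ?subr_ge0 ?(ltW b0).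
Qed.

(** The logarithm is evaluated only at points at least [exp(- K)], where its slope is at most
    [exp K]. *)
Lemma lnt_lip K a b : lnt K a - lnt K b <= expR K * `|a - b|.
Proof.
set M := Num.max b (expR (- K)).
have M0 : 0 < M := lnt_max_gt0 K b.
have [ab|ba] := leP a b.
  apply: (@le_trans _ _ 0); first by rewrite subr_le0 lnt_leK.
  by rewrite mulr_ge0 ?expR_ge0.
rewrite (le_trans (ln_sub_le (lnt_max_gt0 K b) _))//.
  by rewrite -/M ge_max !le_max (ltW ba) lexx orbT.
rewrite -/M mulrC ler_pM ?invr_ge0 ?(ltW M0)//.
- by rewrite subr_ge0 /M ge_max !le_max (ltW ba) lexx orbT.
- by rewrite -[leRHS]invrK lef_pV2 ?posrE// ?invr_gt0 ?expR_gt0// -expRN le_max lexx orbT.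
rewrite gtr0_norm ?subr_gt0//.
rewrite lerBlDr ge_max -/M; apply/andP; split.
  by rewrite -lerBlDl opprB addrC subrK le_max lexx.
by rewrite (@le_trans _ _ M)// ?le_max ?lexx ?orbT// lerDr subr_ge0 ltW.
Qed.

Lemma lnt_lip_norm K a b : `|lnt K a - lnt K b| <= expR K * `|a - b|.
Proof.
rewrite ler_norml lnt_lip andbT lerNl opprB.
by rewrite (le_trans (lnt_lip _ _ _))// distrC.
Qed.

Lemma ucont01_lip K (g h : R -> R) :
  (forall x y, `|g x - g y| <= K * `|h x - h y|) -> ucont01 h -> ucont01 g.
Proof.
move=> gh uh e e0.
have K0 : 0 < `|K| + 1 by rewrite ltr_wpDl.
have [d d0 hd] := uh (e / (`|K| + 1)) (divr_gt0 e0 K0).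
exists d => // x y x01 y01 xy; rewrite (le_lt_trans (gh _ _))//.
have := hd _ _ x01 y01 xy; rewrite ltr_pdivlMr// => /(le_lt_trans _); apply.
by rewrite mulrC ler_wpM2l// ler_wpDr// ler_norm.
Qed.

Lemma ucont01D (g h : R -> R) : ucont01 g -> ucont01 h -> ucont01 (fun x => g x + h x).
Proof.
move=> ug uh e e0; have e2 : 0 < e / 2 by rewrite divr_gt0.
have [d d0 hd] := ug _ e2; have [d' d'0 hd'] := uh _ e2.
exists (Num.min d d') => [|x y x01 y01]; first by rewrite lt_min d0.
rewrite lt_min => /andP[/hd h1 /hd' h2].
have := h1 x01 y01; have := h2 x01 y01; rewrite !ltr_norml.
by move=> /andP[? ?] /andP[? ?]; apply/andP; split; lra.
Qed.

Lemma ucont01Z c (g : R -> R) : ucont01 g -> ucont01 (fun x => c * g x).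
Proof. by apply: (@ucont01_lip `|c|) => x y; rewrite -mulrBr normrM. Qed.

Lemma ucont01_cst c : ucont01 (fun=> c : R).
Proof. by move=> e e0; exists 1 => // x y _ _ _; rewrite subrr normr0. Qed.

Lemma ucont01_id : ucont01 (fun x : R => x).
Proof. by move=> e e0; exists e. Qed.

Lemma ucont01_powR (p : R) : 0 < p -> ucont01 (fun x : R => x `^ p).
Proof.
move=> p0; apply: within_ucont01; apply/subspace_continuousP => x /=.
rewrite in_itv /= => /andP[]; rewrite le_eqVlt => /predU1P[<- _|x0 _].
  rewrite /from_subspace; apply/cvgrPdist_lt => e e0 /=; rewrite powR0 ?gt_eqF//.
  have d0 : 0 < e `^ p^-1 by rewrite powR_gt0.
  exists (e `^ p^-1) => // y ye; rewrite /= in_itv /= => /andP[y0 y1].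
  rewrite sub0r normrN (ger0_norm (powR_ge0 _ _)).
  have -> : e = (e `^ p^-1) `^ p by rewrite -powRrM mulVf ?gt_eqF// powRr1 ?ltW.
  rewrite gt0_ltr_powR ?nnegrE ?powR_ge0//.
  by move: ye; rewrite /ball_ /= sub0r normrN ger0_norm.
apply: cvg_within_filter.
have : {for x, continuous (powR (R := R) ^~ p)}; last by [].
apply: differentiable_continuous; apply/derivable1_diffP.
by apply: derivable_powR; rewrite in_itv /= x0.
Qed.

Lemma powR_le1 (x p : R) : 0 < p -> 0 <= x <= 1 -> 0 <= x `^ p <= 1.
Proof.
move=> p0 /andP[x0 x1]; rewrite powR_ge0 /=.
have : x `^ p <= 1 `^ p by rewrite ge0_ler_powR ?nnegrE ?(ltW p0).
by rewrite powR1.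
Qed.

End TruncatedLog.

Section Kernels.
Context {R : realType}.
Variables (eta theta zeta kap c0 c1 : R).
Hypotheses (eta0 : 0 < eta) (theta0 : 0 < theta) (zeta0 : 0 < zeta).
Hypotheses (kap0 : 0 < kap) (c00 : 0 <= c0) (c10 : 0 <= c1).
Implicit Types (K : nat) (x y : R).

(** Truncated interaction and external field with reversed signs, so that on [0,1] both are
    nonnegative and nondecreasing in [K]. The diagonal value [kap ^+ 2 * K] is finite, so [IK] makes
    sense for empirical measures. *)
Definition BK K x y : R := (kap ^+ 2 / 2) *
  (- lnt K%:R `|x `^ theta - y `^ theta| - lnt K%:R `|x `^ eta - y `^ eta|).

Definition VK K x : R := - (c0 * lnt K%:R (1 - x `^ zeta)) - c1 * lnt K%:R x.

Lemma BK_sym K x y : BK K x y = BK K y x.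
Proof. by rewrite /BK distrC [X in _ - lnt _ X]distrC. Qed.

Lemma BK_diag K x : BK K x x = kap ^+ 2 * K%:R.
Proof. by rewrite /BK !subrr normr0 lnt0; lra. Qed.

Let kap2 : 0 < kap ^+ 2 / 2. Proof. by rewrite divr_gt0 ?exprn_gt0. Qed.

Lemma powR_dist_le1 (p : R) x y : 0 < p -> 0 <= x <= 1 -> 0 <= y <= 1 ->
  `|x `^ p - y `^ p| <= 1.
Proof.
move=> p0 /(powR_le1 p0)/andP[? ?] /(powR_le1 p0)/andP[? ?].
by rewrite ler_norml; apply/andP; split; lra.
Qed.

Lemma BK_ge0 K x y : 0 <= x <= 1 -> 0 <= y <= 1 -> 0 <= BK K x y.
Proof.
move=> x01 y01; rewrite /BK mulr_ge0 ?(ltW kap2)//.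
by rewrite addr_ge0// oppr_ge0 lnt_le0 ?powR_dist_le1.
Qed.

Lemma BK_homo K K' x y : (K <= K')%N -> BK K x y <= BK K' x y.
Proof.
move=> KK'; rewrite ler_pM2l//.
by rewrite lerD// lerN2 lnt_anti// ler_nat.
Qed.

Lemma VK_ge0 K x : 0 <= x <= 1 -> 0 <= VK K x.
Proof.
move=> x01; have /andP[? ?] := powR_le1 zeta0 x01; have /andP[? ?] := x01.
rewrite /VK addr_ge0// oppr_ge0 mulr_ge0_le0// lnt_le0//; lra.
Qed.

Lemma VK_homo K K' x : (K <= K')%N -> VK K x <= VK K' x.
Proof.
move=> KK'; rewrite lerD// lerN2 ler_wpM2l// lnt_anti// ler_nat//.
Qed.

Lemma ucont01_VK K : ucont01 (VK K).
Proof.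
apply: ucont01D.
  under eq_fun do rewrite -mulNr.
  apply: ucont01Z; apply: (@ucont01_lip _ (expR K%:R) _ (fun x => x `^ zeta)).
    by move=> x y; rewrite (le_trans (lnt_lip_norm _ _ _))// opprB addrC addrA subrK distrC.
  exact: ucont01_powR.
under eq_fun do rewrite -mulNr.
apply: ucont01Z; apply: (@ucont01_lip _ (expR K%:R) _ id); last exact: ucont01_id.
by move=> x y; exact: lnt_lip_norm.
Qed.

(** The modulus does not depend on [y]; hence potentials of finite measures inherit uniform
    continuity, and integrals of [BK K x] need to be controlled only for [x] on a finite grid. *)
Lemma BK_equicont K e : 0 < e -> exists2 d, 0 < d & forall x x' y,
  0 <= x <= 1 -> 0 <= x' <= 1 -> `|x - x'| < d -> `|BK K x y - BK K x' y| < e.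
Proof.
move=> e0.
set C := (kap ^+ 2 / 2) * expR K%:R.
have C0 : 0 < C by rewrite mulr_gt0 ?expR_gt0.
have eC : 0 < e / (2 * C) by rewrite divr_gt0 ?mulr_gt0.
have [d d0 hd] := ucont01_powR theta0 eC.
have [d' d'0 hd'] := ucont01_powR eta0 eC.
exists (Num.min d d') => [|x x' y x01 x'01]; first by rewrite lt_min d0.
rewrite lt_min => /andP[/(hd _ _ x01 x'01) h1 /(hd' _ _ x01 x'01) h2].
have step1 (p : R) : `|lnt K%:R `|x `^ p - y `^ p| - lnt K%:R `|x' `^ p - y `^ p| |
    <= expR K%:R * `|x `^ p - x' `^ p|.
  rewrite (le_trans (lnt_lip_norm _ _ _))// ler_wpM2l ?expR_ge0//.
  rewrite (le_trans (ler_dist_dist _ _))//.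
  by rewrite opprB addrA subrK.
rewrite /BK -mulrBr normrM gtr0_norm//.
have : `|x `^ theta - x' `^ theta| + `|x `^ eta - x' `^ eta| < e / C.
  have -> : e / C = e / (2 * C) + e / (2 * C).
    by have : C != 0 by [rewrite gt_eqF]; move=> ?; field.
  exact: ltrD.
rewrite ltr_pdivlMr// => /(le_lt_trans _); apply.
rewrite [leRHS]mulrC /C -[leRHS]mulrA ler_wpM2l ?(ltW kap2)// mulrDr.
apply: le_trans (lerD (step1 theta) (step1 eta)).
set a := lnt _ _; set b := lnt _ _; set a' := lnt _ _; set b' := lnt _ _.
have -> : - a - b - (- a' - b') = (a' - a) + (b' - b) by ring.
by rewrite (le_trans (ler_normD _ _))// ![`|_ - a|]distrC ![`|_ - b|]distrC.
Qed.


End Kernels.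

Lemma dist_trans4 {R : realFieldType} (a b c d e1 e2 e3 : R) :
  `|a - b| <= e1 -> `|b - c| <= e2 -> `|c - d| <= e3 -> `|a - d| <= e1 + e2 + e3.
Proof.
rewrite !ler_norml => /andP[? ?] /andP[? ?] /andP[? ?].
by apply/andP; split; lra.
Qed.

Section KernelEnergy.
Context {R : realType}.
Variables (eta theta zeta kap c0 c1 : R).
Hypotheses (eta0 : 0 < eta) (theta0 : 0 < theta) (zeta0 : 0 < zeta).
Hypotheses (kap0 : 0 < kap) (c00 : 0 <= c0) (c10 : 0 <= c1).
Implicit Types (K n : nat) (x y : R) (mu nu : Meas R).

Local Notation I01 := (`[0%R, 1%R]%classic : set R).
Local Notation BK := (BK eta theta kap).
Local Notation VK := (VK zeta c0 c1).

Definition IK K mu : R :=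
  av mu I01 (fun x => av mu I01 (BK K x)) + av mu I01 (VK K).

Lemma in_I01 x : I01 x -> 0 <= x <= 1.
Proof. by rewrite /= in_itv. Qed.

Lemma ucont01_BK K x : 0 <= x <= 1 -> ucont01 (BK K x).
Proof.
move=> x01 e e0; have [d d0 hd] := BK_equicont eta0 theta0 kap0 K e0.
by exists d => // y y' y01 y'01 yy'; rewrite ![BK K x _]BK_sym; exact: hd.
Qed.

Lemma bmeas_BK K x : 0 <= x <= 1 -> bmeas I01 (BK K x).
Proof.
by move=> x01; apply: ucont01_bmeas => //; exact: ucont01_BK.
Qed.

Lemma ucont01_av_BK mu D K : D `<=` I01 -> measurable D -> (mu D < +oo)%E ->
  ucont01 (fun x => av mu D (BK K x)).
Proof.
move=> D01 mD finD e e0.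
have m0 : 0 < fine (mu D) + 1 by rewrite ltr_wpDl// fine_ge0.
have e20 : 0 < e / (fine (mu D) + 1) by rewrite divr_gt0.
have [d d0 hd] := BK_equicont eta0 theta0 kap0 K e20.
exists d => // x x' x01 x'01 xx'.
have bm z : 0 <= z <= 1 -> bmeas D (BK K z).
  by move=> z01; apply: ucont01_bmeas => //; exact: ucont01_BK.
rewrite -avB//; try exact: bm.
apply: (@le_lt_trans _ _ (e / (fine (mu D) + 1) * fine (mu D))).
  apply: av_norm_le => //; first by apply: bmeasB; exact: bm.
  by move=> y Dy; apply/ltW/hd.
rewrite mulrAC ltr_pdivrMr// ltr_pM2l// ltrDl//.
Qed.

(** The energy is quadratic in the measure. Closeness on a grid of functions [BK K x] makes the
    potentials of [nu] and [mu] uniformly close, within [3 * (e / 5)]; the fixed potential of [mu]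
    and the field [VK] cost [e / 5] each. *)
Lemma IK_near mu K e : P01 mu -> 0 < e -> exists n (fs : 'I_n -> R -> R) d,
  [/\ 0 < d, forall i, ucont01 (fs i) & forall nu, P01 nu ->
    (forall i, `|av nu I01 (fs i) - av mu I01 (fs i)| < d) -> `|IK K nu - IK K mu| < e].
Proof.
move=> Pmu e0.
have e50 : 0 < e / 5 by rewrite divr_gt0.
have [d d0 hd] := BK_equicont eta0 theta0 kap0 K e50.
pose m := (Num.truncn (1 / d)).+1.
have m0 : 0 < m%:R :> R by rewrite ltr0n.
have md : 1 / m%:R < d by rewrite ltr_pdivrMr// -ltr_pdivrMl// mulrC truncnS_gt.
(* Indices [0] to [m] are the grid points [i / m], index [m.+1] is the potential of [mu], and [m.+2]
   is the external field. *)
pose fs (i : 'I_m.+3) := if (i < m.+1)%N then BK K (i%:R / m%:R) else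
  if i == m.+1 :> nat then (fun x => av mu I01 (BK K x)) else VK K.
have m01 := @measurable_I01 R; have fmu := P01_lty Pmu.
exists m.+3, fs, (e / 5); split => //.
  move=> i; rewrite /fs; case: ifPn => [im|_].
    apply: ucont01_BK; rewrite divr_ge0 ?ler0n//= ler_pdivrMr// mul1r ler_nat -ltnS//.
  by case: ifP => _; [exact: ucont01_av_BK|exact: ucont01_VK].
move=> nu Pnu H; have fnu := P01_lty Pnu.
have lt1 : (m.+1 < m.+3)%N by [].
have lt2 : (m.+2 < m.+3)%N by [].
have := H (Ordinal lt1); rewrite /fs /= ltnn eqxx => h1.
have fs2 : fs (Ordinal lt2) = VK K.
  by rewrite /fs ifF ?ifF//; apply/negbTE; rewrite ?gtn_eqF// -leqNgt leqnSn.
have := H (Ordinal lt2); rewrite fs2 => h2.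
have unif x : 0 <= x <= 1 -> `|av nu I01 (BK K x) - av mu I01 (BK K x)| <= 3 * (e / 5).
  move=> x01; have [i [im ix]] : exists i, (i < m.+1)%N /\ `|x - i%:R / m%:R| < d.
    have /andP[x0 x1] := x01.
    have xm0 : 0 <= x * m%:R by rewrite mulr_ge0// ltW.
    have /andP[t1 t2] := truncn_itv xm0.
    exists (Num.truncn (x * m%:R)); split.
      by rewrite ltnS -(ler_nat R) (le_trans t1)// ler_piMl// ltW.
    apply: le_lt_trans md.
    have e1 : x = x * m%:R / m%:R by rewrite mulfK// gt_eqF.
    rewrite {1}e1 -mulrBl normrM [X in _ * X]gtr0_norm ?invr_gt0//.
    rewrite ler_pM2r ?invr_gt0// ger0_norm ?subr_ge0//.
    by rewrite lerBlDl natr1 ltW.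
  have i01 : 0 <= (i%:R / m%:R : R) <= 1.
    by rewrite divr_ge0 ?ler0n//= ler_pdivrMr// mul1r ler_nat -ltnS.
  have im3 : (i < m.+3)%N by rewrite (leq_trans im)// leqW.
  have := H (Ordinal im3); rewrite /fs /= im => h3.
  have dif (rho : Meas R) : P01 rho ->
      `|av rho I01 (BK K x) - av rho I01 (BK K (i%:R / m%:R))| <= e / 5.
    move=> Prho; have frho := P01_lty Prho.
    rewrite -avB//; try exact: bmeas_BK.
    have -> : e / 5 = e / 5 * fine (rho I01) by rewrite P01_fine// mulr1.
    apply: av_norm_le => //; first by apply: bmeasB; exact: bmeas_BK.
    by move=> y /in_I01 y01; apply/ltW/hd.
  have -> : 3 * (e / 5) = e / 5 + e / 5 + e / 5 by ring.
  apply: (dist_trans4 (dif _ Pnu) (ltW h3)).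
  by rewrite distrC; exact: dif.
have h3 : `|av nu I01 (fun x => av nu I01 (BK K x)) -
            av nu I01 (fun x => av mu I01 (BK K x))| <= 3 * (e / 5).
  have bm rho : P01 rho -> bmeas I01 (fun x => av rho I01 (BK K x)).
    by move=> Pr; apply: ucont01_bmeas => //; apply: ucont01_av_BK => //; exact: P01_lty.
  rewrite -avB//; try exact: bm.
  have -> : 3 * (e / 5) = 3 * (e / 5) * fine (nu I01) by rewrite P01_fine// mulr1.
  apply: av_norm_le => //.
    by apply: bmeasB; exact: bm.
rewrite /IK; move: h1 h2 h3.
set a := av nu _ (fun x => av mu _ _); set b := av mu _ _; set c := av nu _ (VK K).
set c' := av mu _ _; set a' := av nu _ _ => h1 h2 h3.
have h4 := dist_trans4 h3 (ltW h1) (lexx `|b - b|).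
rewrite subrr normr0 addr0 in h4.
have -> : a' + c - (b + c') = a' - b + (c - c') by ring.
rewrite (le_lt_trans (ler_normD _ _))// (lt_le_trans (ler_ltD h4 h2))//.
by have -> : 3 * (e / 5) + e / 5 + e / 5 = e by field.
Qed.

Lemma IK_gt_wopen K c : Defs.wopen [set mu | c < IK K mu].
Proof.
move=> mu Pmu /= cmu.
have e0 : 0 < IK K mu - c by rewrite subr_gt0.
have [n [fs [d [d0 ufs Hd]]]] := IK_near K Pmu e0.
exists n, fs, d; split => //; split; first by move=> i; exact: ucont01_within.
move=> nu Pnu /(Hd nu Pnu); rewrite ltr_norml => /andP[? ?]; lra.
Qed.

Lemma av_monotone_cvg mu (h : nat -> R -> R) (g : R -> \bar R) : P01 mu ->
  (forall n, bmeas I01 (h n)) -> (forall n x, 0 <= x <= 1 -> 0 <= h n x) ->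
  (forall n m x, (n <= m)%N -> 0 <= x <= 1 -> h n x <= h m x) ->
  (forall x, 0 <= x <= 1 -> (h n x)%:E @[n --> \oo] --> g x) ->
  (av mu I01 (h n))%:E @[n --> \oo] --> (\int[mu]_(x in I01) g x)%E.
Proof.
move=> Pmu bh h0 hm hg; have m01 := @measurable_I01 R; have fmu := P01_lty Pmu.
rewrite (eq_integral (fun x => limn (fun n => (h n x)%:E))); last first.
  by move=> x; rewrite inE => /in_I01 x01; apply/esym/cvg_lim => //; exact: hg.
under eq_fun do rewrite av_EFin//.
apply: (@cvg_monotone_convergence _ _ _ mu I01 m01 (fun n x => (h n x)%:E)).
- by move=> n; apply/measurable_EFinP; case: (bh n).
- by move=> n x /in_I01 x01; rewrite lee_fin h0.
- by move=> x /in_I01 x01 n m nm; rewrite lee_fin hm.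
Qed.

Lemma lnt_cvg (r : R) : (- lnt n%:R r)%:E @[n --> \oo] --> (- elog r)%E.
Proof.
rewrite /elog; case: ifPn => [r0|]; last first.
  rewrite -leNgt => r0 /=.
  have -> : (fun n => (- lnt n%:R r)%:E) = (fun n => n%:R%:E).
    apply/funext => n; rewrite /lnt max_r ?(le_trans r0) ?expR_ge0//.
    by rewrite expRK opprK.
  apply/cvgeryP; exact: cvgr_idn.
rewrite -EFinN; apply: cvg_near_cst; near=> n.
rewrite lntE// -[leRHS](lnK r0) ler_expR lerNl.
rewrite (le_trans (ler_norm _))//.
near: n; exact: nbhs_infty_ger.
Unshelve. all: by end_near. Qed.

Lemma elog_le0 (r : R) : r <= 1 -> (elog r <= 0)%E.
Proof. by move=> r1; rewrite /elog; case: ifP => // _; rewrite lee_fin ln_le0. Qed.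

(** The rate functional before subtraction of its infimum, with parameters that cover the three
    ranges of [xi]: [zeta] is the exponent in K_0, and [c0], [c1] are the coefficients of K_0 and
    M. *)
Definition Igen mu : \bar R :=
  (- ((kap ^+ 2 / 2)%:E * \int[mu]_(x in I01) \int[mu]_(y in I01)
      (elog (`|x `^ theta - y `^ theta|)%R + elog (`|x `^ eta - y `^ eta|)%R))
   - (c0%:E * \int[mu]_(x in I01) elog (1 - x `^ zeta)%R)
   - (c1%:E * \int[mu]_(x in I01) elog x))%E.

End KernelEnergy.

Lemma eq_ucont01 {R : realType} (g h : R -> R) :
  (forall x, 0 <= x <= 1 -> g x = h x) -> ucont01 h -> ucont01 g.
Proof.
move=> gh uh e e0; have [d d0 hd] := uh _ e0.
by exists d => // x y x01 y01 xy; rewrite !gh//; exact: hd.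
Qed.

Lemma integral_le0N {R : realType} (mu : Meas R) (D : set R) (f : R -> \bar R) :
  (forall x, D x -> (f x <= 0)%E) ->
  (- (\int[mu]_(x in D) f x))%E = (\int[mu]_(x in D) - f x)%E.
Proof.
move=> f0; rewrite -[RHS]oppeK; congr (- _)%E; rewrite -integral_ge0N; last first.
  by move=> x Dx; rewrite leeNr oppe0 f0.
by apply: eq_integral => x _; rewrite oppeK.
Qed.

Lemma integral_le0 {R : realType} (mu : Meas R) (D : set R) (f : R -> \bar R) :
  (forall x, D x -> (f x <= 0)%E) -> (\int[mu]_(x in D) f x <= 0)%E.
Proof.
move=> f0; rewrite -leeN2 oppe0 integral_le0N//; apply: integral_ge0 => x Dx.
by rewrite leeNr oppe0 f0.
Qed.

Section EnergyLimit.
Context {R : realType}.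
Variables (eta theta zeta kap c0 c1 : R).
Hypotheses (eta0 : 0 < eta) (theta0 : 0 < theta) (zeta0 : 0 < zeta).
Hypotheses (kap0 : 0 < kap) (c00 : 0 <= c0) (c10 : 0 <= c1).
Implicit Types (K n : nat) (x y : R) (mu nu : Meas R).

Local Notation I01 := (`[0%R, 1%R]%classic : set R).
Local Notation BK := (BK eta theta kap).
Local Notation VK := (VK zeta c0 c1).
Local Notation IK := (IK eta theta zeta kap c0 c1).
Local Notation Igen := (Igen eta theta zeta kap c0 c1).

Lemma integral_elog mu (h : R -> R) : P01 mu -> ucont01 h ->
  (forall x, 0 <= x <= 1 -> h x <= 1) ->
  (av mu I01 (fun x => - lnt n%:R (h x)))%:E @[n --> \oo] -->
    (- \int[mu]_(x in I01) elog (h x))%E.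
Proof.
move=> Pmu uh h1.
rewrite integral_le0N; last by move=> x /in_I01 x01; rewrite elog_le0// h1.
apply: av_monotone_cvg => //.
- move=> n; apply: ucont01_bmeas => //.
  apply: (@ucont01_lip _ (expR n%:R) _ h) => // x y.
  by rewrite -opprD normrN lnt_lip_norm.
- by move=> n x x01; rewrite oppr_ge0 lnt_le0 ?h1.
- by move=> n m x nm x01; rewrite lerN2 lnt_anti ?ler_nat.
- by move=> x x01; exact: lnt_cvg.
Qed.

Lemma integral_elog_ge0 mu (h : R -> R) : (forall x, 0 <= x <= 1 -> h x <= 1) ->
  (0 <= - \int[mu]_(x in I01) elog (h x))%E.
Proof.
move=> h1; rewrite leeNr oppe0; apply: integral_le0 => x /in_I01 x01.
by rewrite elog_le0// h1.
Qed.

Let bn n x y : R := - lnt n%:R `|x `^ theta - y `^ theta| - lnt n%:R `|x `^ eta - y `^ eta|.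

Let BKE n x : BK n x = (fun y => (kap ^+ 2 / 2) * bn n x y).
Proof. by apply/funext => y. Qed.

Let elog2 x y : \bar R :=
  (elog (`|x `^ theta - y `^ theta|)%R + elog (`|x `^ eta - y `^ eta|)%R)%E.

Let kap2 : 0 < kap ^+ 2 / 2. Proof. by rewrite divr_gt0 ?exprn_gt0. Qed.

Let bnE n x : bn n x = (fun y => (kap ^+ 2 / 2)^-1 * BK n x y).
Proof. by rewrite BKE; apply/funext => y; rewrite mulKf ?gt_eqF. Qed.

Let bn_ge0 n x y : 0 <= x <= 1 -> 0 <= y <= 1 -> 0 <= bn n x y.
Proof. by move=> x01 y01; rewrite bnE mulr_ge0 ?invr_ge0 ?(ltW kap2) ?BK_ge0. Qed.

Let bn_homo n m x y : (n <= m)%N -> bn n x y <= bn m x y.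
Proof. by move=> nm; rewrite !bnE ler_wpM2l ?invr_ge0 ?(ltW kap2) ?BK_homo. Qed.

Let ucont01_bn n x : 0 <= x <= 1 -> ucont01 (bn n x).
Proof. by move=> x01; rewrite bnE; apply/ucont01Z/ucont01_BK. Qed.

Let elog2_le0 x y : 0 <= x <= 1 -> 0 <= y <= 1 -> (elog2 x y <= 0)%E.
Proof. by move=> x01 y01; rewrite adde_le0 ?elog_le0 ?powR_dist_le1. Qed.

Let elog2_cvg x y : 0 <= x <= 1 -> 0 <= y <= 1 ->
  (bn n x y)%:E @[n --> \oo] --> (- elog2 x y)%E.
Proof.
move=> x01 y01; rewrite /bn /elog2.
have h1 := elog_le0 (powR_dist_le1 theta0 x01 y01).
have h2 := elog_le0 (powR_dist_le1 eta0 x01 y01).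
under eq_fun do rewrite EFinD.
rewrite oppeD; last by rewrite /adde_def; move: h1 h2; case: (elog _); case: (elog _).
apply: cvgeD; [|exact: lnt_cvg..].
by apply: ge0_adde_def; rewrite inE leeNr oppe0.
Qed.

Lemma integral_elog2 mu : P01 mu ->
  (av mu I01 (fun x => av mu I01 (bn n x)))%:E @[n --> \oo] -->
    (- \int[mu]_(x in I01) \int[mu]_(y in I01) elog2 x y)%E.
Proof.
move=> Pmu; have m01 := @measurable_I01 R; have fmu := P01_lty Pmu.
have bb n x : 0 <= x <= 1 -> bmeas I01 (bn n x).
  by move=> x01; apply: ucont01_bmeas => //; exact: ucont01_bn.
rewrite integral_le0N; last first.
  by move=> x /in_I01 x01; apply: integral_le0 => y /in_I01; exact: elog2_le0.
apply: (@av_monotone_cvg _ mu (fun n x => av mu I01 (bn n x))); first exact: Pmu.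
- move=> n; apply: ucont01_bmeas => //.
  apply: (@eq_ucont01 _ _ (fun x => (kap ^+ 2 / 2)^-1 * av mu I01 (BK n x))).
    by move=> x x01; rewrite bnE avZ//; exact: bmeas_BK.
  exact/ucont01Z/ucont01_av_BK.
- by move=> n x x01; apply: av_ge0 => y /in_I01; exact: bn_ge0.
- move=> n m x nm x01; apply: av_le => //; [exact: bb..|].
  by move=> y _; exact: bn_homo.
- move=> x x01; rewrite integral_le0N => [|y /in_I01]; last exact: elog2_le0.
  apply: (@av_monotone_cvg _ mu (fun n => bn n x)); first exact: Pmu.
  + by move=> n; exact: bb.
  + by move=> n y; exact: bn_ge0.
  + by move=> n m y nm _; exact: bn_homo.
  + by move=> y; exact: elog2_cvg.
Qed.

(** Monotone convergence in each of the three terms, twice for the interaction. All limits are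
    nonnegative, so no difference of infinities arises in their sum. *)
Lemma IK_cvg mu : P01 mu -> (IK n mu)%:E @[n --> \oo] --> Igen mu.
Proof.
move=> Pmu; have m01 := @measurable_I01 R; have fmu := P01_lty Pmu.
pose a n := av mu I01 (fun x => av mu I01 (bn n x)).
pose b n := av mu I01 (fun x => - lnt n%:R (1 - x `^ zeta)).
pose c n := av mu I01 (fun x => - lnt n%:R x).
have h1 x : 0 <= x <= 1 -> 1 - x `^ zeta <= 1.
  by move=> x01; rewrite gerBl powR_ge0.
have u1 : ucont01 (fun x : R => 1 - x `^ zeta).
  have := ucont01D (ucont01_cst 1) (ucont01Z (-1) (ucont01_powR zeta0)).
  by under eq_fun do rewrite mulN1r.
have bl (h : R -> R) n : ucont01 h -> bmeas I01 (fun x => - lnt n%:R (h x)).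
  move=> uh; apply: ucont01_bmeas => //.
  apply: (@ucont01_lip _ (expR n%:R) _ h) => // x y.
  by rewrite -opprD normrN lnt_lip_norm.
have bb n x : 0 <= x <= 1 -> bmeas I01 (bn n x).
  by move=> x01; apply: ucont01_bmeas => //; exact: ucont01_bn.
have IE n : IK n mu = (kap ^+ 2 / 2) * a n + c0 * b n + c1 * c n.
  rewrite /IK -addrA; congr +%R.
    rewrite /a -avZ//; last first.
      apply: ucont01_bmeas => //.
      apply: (@eq_ucont01 _ _ (fun x => (kap ^+ 2 / 2)^-1 * av mu I01 (BK n x))).
        by move=> x x01; rewrite bnE avZ//; exact: bmeas_BK.
      exact/ucont01Z/ucont01_av_BK.
    by apply: eq_av => x /in_I01 x01; rewrite BKE avZ//; exact: bb.
  rewrite /b /c -!avZ//; [|exact: bl ucont01_id|exact: bl u1].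
  rewrite -avD//; [|exact/bmeasZ/(bl _ _ u1)|exact/bmeasZ/(bl _ _ ucont01_id)].
  by apply: eq_av => x _; rewrite /VK; ring.
under eq_fun do rewrite IE !EFinD !EFinM.
have la := integral_elog2 Pmu.
have lb := integral_elog Pmu u1 h1.
have h2 x : 0 <= x <= 1 -> (x : R) <= 1 by move=> /andP[].
have lc := integral_elog Pmu ucont01_id h2.
have gb := integral_elog_ge0 mu h1.
have gc := integral_elog_ge0 mu h2.
have ga : (0 <= - (\int[mu]_(x in I01) \int[mu]_(y in I01) elog2 x y))%E.
  rewrite leeNr oppe0; apply: integral_le0 => x /in_I01 x01.
  by apply: integral_le0 => y /in_I01 y01; exact: elog2_le0.
rewrite /Igen -!muleN.
have k0 := ltW kap2.
apply: cvgeD.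
- apply: ge0_adde_def; rewrite inE ?adde_ge0 ?mule_ge0 ?lee_fin//.
- apply: cvgeD.
  + by apply: ge0_adde_def; rewrite inE mule_ge0 ?lee_fin.
  + by apply: cvgeZl.
  + by apply: cvgeZl.
- by apply: cvgeZl.
Qed.

Lemma IK_homo mu n m : P01 mu -> (n <= m)%N -> IK n mu <= IK m mu.
Proof.
move=> Pmu nm; have m01 := @measurable_I01 R; have fmu := P01_lty Pmu.
rewrite /IK; apply: lerD; last first.
  have bV k : bmeas I01 (VK k) by apply: ucont01_bmeas => //; exact: ucont01_VK.
  apply: (av_le m01 fmu (bV n) (bV m)) => x _; exact: VK_homo.
have bA k : bmeas I01 (fun x => av mu I01 (BK k x)).
  by apply: ucont01_bmeas => //; exact: ucont01_av_BK.
apply: (av_le m01 fmu (bA n) (bA m)) => x /in_I01 x01.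
apply: (av_le m01 fmu (bmeas_BK eta0 theta0 kap0 n x01) (bmeas_BK eta0 theta0 kap0 m x01)) => y _.
exact: BK_homo.
Qed.

Lemma IK_le_Igen mu n : P01 mu -> ((IK n mu)%:E <= Igen mu)%E.
Proof.
move=> Pmu; have L := IK_cvg Pmu.
rewrite -(cvg_lim _ L)//; apply: lime_ge; first by apply/cvg_ex; exists (Igen mu).
by near=> m; rewrite lee_fin IK_homo//; near: m; exact: nbhs_infty_ge.
Unshelve. all: by end_near. Qed.

Lemma Igen_gt mu (c : R) : P01 mu -> (c%:E < Igen mu)%E -> exists n, c < IK n mu.
Proof.
move=> Pmu; apply: contraPP => /forallNP H; apply/negP; rewrite -leNgt.
have L := IK_cvg Pmu; rewrite -(cvg_lim _ L)//.
apply: lime_le; first by apply/cvg_ex; exists (Igen mu).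
by apply: nearW => n; rewrite lee_fin leNgt; apply/negP.
Qed.

Lemma Igen_ge0 mu : P01 mu -> (0 <= Igen mu)%E.
Proof.
move=> Pmu; apply: le_trans (IK_le_Igen 0 Pmu); rewrite lee_fin addr_ge0//.
  by apply: av_ge0 => x /in_I01 x01; apply: av_ge0 => y /in_I01; exact: BK_ge0.
by apply: av_ge0 => x /in_I01; exact: VK_ge0.
Qed.


End EnergyLimit.

(** * Sampling and rounding *)

Section Sampling.
Context {R : realType}.
Variables (mu : Meas R) (D : set R).
Hypotheses (mD : measurable D) (finD : (mu D < +oo)%E) (D0 : 0 < fine (mu D)).
Variables (W : R -> R -> R) (U : R -> R).

Definition mean (h : R -> R) : R := av mu D h / fine (mu D).

(** The double sum runs over all ordered pairs of positions and includes the diagonal; where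
    self-interaction is to be discarded, [U] subtracts it. *)
Definition pair_cost (s : seq R) : R :=
  \sum_(x <- s) \sum_(y <- s) W x y + \sum_(x <- s) U x.

Hypothesis Wsym : forall x y, W x y = W y x.
Hypothesis bW : forall x, D x -> bmeas D (W x).
Hypothesis bg : bmeas D (fun x => mean (W x)).
Hypothesis bV : bmeas D (fun x => W x x + U x).

Let V x := W x x + U x.
Let g x := mean (W x).

Lemma meanD h k : bmeas D h -> bmeas D k -> mean (fun x => h x + k x) = mean h + mean k.
Proof. by move=> hh kk; rewrite /mean avD// mulrDl. Qed.

Lemma meanZ c h : bmeas D h -> mean (fun x => c * h x) = c * mean h.
Proof. by move=> hh; rewrite /mean avZ// mulrA. Qed.

Lemma mean_sum (I : Type) (s : seq I) (h : I -> R -> R) : (forall i, bmeas D (h i)) ->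
  mean (fun x => \sum_(i <- s) h i x) = \sum_(i <- s) mean (h i).
Proof. by move=> hh; rewrite /mean av_sum// mulr_suml. Qed.

Lemma mean_cst c : mean (fun=> c) = c.
Proof. by rewrite /mean av_cst// mulfK// gt_eqF. Qed.

Lemma exists_le_mean h : bmeas D h -> exists2 x, D x & h x <= mean h.
Proof.
move=> hh; have [x Dx hx] := exists_le_av mD finD D0 hh.
by exists x => //; rewrite ler_pdivlMr.
Qed.

Lemma pair_cost_cons x s : pair_cost (x :: s) = pair_cost s + (V x + 2 * \sum_(y <- s) W y x).
Proof.
rewrite /pair_cost !big_cons /V.
have -> : \sum_(z <- s) \sum_(y <- x :: s) W z y =
    \sum_(z <- s) W z x + \sum_(z <- s) \sum_(y <- s) W z y.
  by rewrite -big_split; apply: eq_bigr => z _; rewrite big_cons.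
have -> : \sum_(y <- s) W x y = \sum_(y <- s) W y x by apply: eq_bigr => y _.
ring.
Qed.

(* Conditional expectations: [r] further independent points drawn from [mu] restricted to [D]
   cost on average the right-hand side, so they can be chosen one by one. *)
Lemma extend_sample r s : {in s, forall x, D x} ->
  exists s', [/\ size s' = (r + size s)%N, {in s', forall x, D x} &
    pair_cost s' <= pair_cost s + r%:R * (2 * (\sum_(y <- s) g y) + mean V) +
      r%:R * (r%:R - 1) * mean g].
Proof.
elim: r s => [|r ih] s sD.
  by exists s; split => //; rewrite !mul0r !addr0.
(* The increase of the cost caused by the new point [x], plus twice its expected interaction with
   the [r] points still to be drawn. *)
pose h x := V x + 2 * (\sum_(y <- s) W y x) + 2 * r%:R * g x.
have bs : bmeas D (fun x => \sum_(y <- s) W y x).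
  elim: s {h} sD => [|y s ihs] sD.
    by under eq_fun do rewrite big_nil; exact: bmeas_cst.
  under eq_fun do rewrite big_cons; apply: bmeasD.
    by apply/bW/sD; rewrite mem_head.
  by apply: ihs => x xs; apply: sD; rewrite in_cons xs orbT.
have ms : mean (fun x => \sum_(y <- s) W y x) = \sum_(y <- s) g y.
  elim: s {h bs} sD => [|y s ihs] sD.
    by rewrite big_nil; under eq_fun do rewrite big_nil; rewrite mean_cst.
  have bs' t : {in t, forall x, D x} -> bmeas D (fun x => \sum_(y <- t) W y x).
    elim: t => [|z t iht] tD.
      by under eq_fun do rewrite big_nil; exact: bmeas_cst.
    under eq_fun do rewrite big_cons; apply: bmeasD.
      by apply/bW/tD; rewrite mem_head.
    by apply: iht => x xs; apply: tD; rewrite in_cons xs orbT.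
  have sD' : {in s, forall x, D x} by move=> x xs; apply: sD; rewrite in_cons xs orbT.
  rewrite big_cons -ihs//; under eq_fun do rewrite big_cons.
  rewrite meanD//; [by apply/bW/sD; rewrite mem_head|exact: bs'].
have bh : bmeas D h.
  apply: bmeasD; last exact: bmeasZ.
  by apply: bmeasD => //; exact: bmeasZ.
have [x Dx hx] := exists_le_mean bh.
have mh : mean h = mean V + 2 * (\sum_(y <- s) g y) + 2 * r%:R * mean g.
  rewrite /h meanD; [|apply: bmeasD => //; exact: bmeasZ|exact: bmeasZ].
  rewrite meanD//; last exact: bmeasZ.
  by rewrite meanZ// meanZ// ms.
have xsD : {in x :: s, forall x, D x}.
  by move=> y; rewrite in_cons => /predU1P[->//|]; exact: sD.
have [s' [ss s'D cs]] := ih (x :: s) xsD.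
exists s'; split => //; first by rewrite ss /= addnS.
rewrite (le_trans cs)// pair_cost_cons big_cons.
move: hx; rewrite mh /h.
move: (pair_cost s) (V x) (g x) (mean V) (mean g) (\sum_(y <- s) W y x) (\sum_(y <- s) g y).
move=> p v gx mv mg a b hx; rewrite -[in leRHS]natr1; nra.
Qed.

Lemma sample n : exists s, [/\ size s = n, {in s, forall x, D x} &
    pair_cost s <= n%:R * (n%:R - 1) * mean g + n%:R * mean V].
Proof.
have [//|s [ss sD cs]] := @extend_sample n [::].
exists s; split => //; first by rewrite ss addn0.
rewrite (le_trans cs)// /pair_cost !big_nil mulr0 !add0r addrC//.
Qed.

End Sampling.

Lemma sum_sym {R : realType} (L : nat) (b : 'I_L -> 'I_L -> R) :
  (forall i j, b i j = b j i) ->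
  \sum_(i < L) \sum_(j < L) b i j =
  \sum_(i < L) b i i + 2 * \sum_(i < L) \sum_(j < L | (i < j)%N) b i j.
Proof.
move=> bs.
have E i : \sum_j b i j = b i i + \sum_(j < L | (i < j)%N) b i j
    + \sum_(j < L | (j < i)%N) b i j.
  rewrite (bigD1 i)//= -addrA; congr +%R.
  rewrite (bigID (fun j : 'I_L => (i < j)%N))/=; congr +%R.
    by apply: eq_bigl => j; rewrite -val_eqE /=; case: ltngtP.
  by apply: eq_bigl => j; rewrite -val_eqE /=; case: ltngtP.
under eq_bigr do rewrite E.
rewrite !big_split /= -addrA; congr +%R.
rewrite mulr_natl mulr2n; congr +%R.
rewrite (exchange_big_dep xpredT)//=; apply: eq_bigr => i _.
by apply: eq_bigr => j _.
Qed.

Lemma sum_pairs {R : realType} (L : nat) (b : 'I_L -> 'I_L -> R) (k d : R) :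
  (forall i j, b i j = b j i) -> (forall i, b i i = d) -> k != 0 ->
  \sum_(i < L) \sum_(j < L | (i < j)%N) (- (2 / k) * b i j) =
  - (\sum_(i < L) \sum_(j < L) b i j) / k + L%:R * (d / k).
Proof.
move=> bs bd k0; rewrite sum_sym//.
rewrite (eq_bigr (fun=> d) (P := xpredT) (F1 := fun i => b i i))// sumr_const card_ord.
have -> : \sum_(i < L) \sum_(j < L | (i < j)%N) (- (2 / k) * b i j) =
    - (2 / k) * \sum_(i < L) \sum_(j < L | (i < j)%N) b i j.
  by rewrite mulr_sumr; apply: eq_bigr => i _; rewrite mulr_sumr.
by rewrite -mulr_natl; field.
Qed.

(** * The particle system with generic parameters *)

Section DiscreteModel.
Context {R : realType}.
Variables (eta theta zeta rho c nu tau kap eps : R) (N L n at_ lo : nat).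
Hypotheses (eta0 : 0 < eta) (theta0 : 0 < theta) (zeta0 : 0 < zeta) (rho0 : 0 < rho).
Hypotheses (c_gt0 : 0 < c) (nu0 : 0 <= nu) (tau0 : 0 <= tau) (kap0 : 0 < kap) (eps0 : 0 < eps).
Hypotheses (LE : L%:R = kap * N%:R) (nE : n%:R = nu * N%:R) (atE : at_%:R = tau * N%:R).
Hypotheses (N0 : (0 < N)%N) (LN : (L + lo <= 2 * N)%N).

Local Notation BK := (BK eta theta kap).
Local Notation VK := (VK zeta (kap * nu) (kap * rho * tau)).

(** The three formulas for the one-particle weight in one. [lo] is the lowest admissible site, so
    that all [n] Pochhammer factors are positive on states; [c] will be
    [alpha + (eta + theta) / 2]. *)
Definition gwd (x : int) : R :=
  expR (- (c * eps * x%:~R)) * expR (- (eps * rho * (at_%:R * x%:~R))) *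
  \prod_(i < n) (1 - expR (- (eps * zeta * (x%:~R - lo%:R + 1 + i%:R)))).

Definition gweight (s : seq int) : R :=
  (\prod_(i < L) \prod_(j < L | (i < j)%N)
    ((qp eps eta (nth 0 s j)%:~R - qp eps eta (nth 0 s i)%:~R) *
     (qp eps theta (nth 0 s j)%:~R - qp eps theta (nth 0 s i)%:~R))) *
  \prod_(i < L) gwd (nth 0 s i).

Definition pos (x : int) : R := expR (- (eps * x%:~R)).

Lemma qp_pos p x : qp eps p x%:~R = pos x `^ p.
Proof. by rewrite /qp /pos -expRM; congr expR; ring. Qed.

Lemma pos01 (x : int) : 0 <= x -> 0 < pos x <= 1.
Proof.
move=> x0; rewrite expR_gt0 /= expR_le1 oppr_le0 mulr_ge0 ?(ltW eps0)//.
by rewrite ler0z.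
Qed.

Lemma expR_le_lnt (K z : R) : z <= lnt K (expR z).
Proof. by rewrite -ler_expR -[leLHS]/(expR z) le_expR_lnt. Qed.

Lemma le_lo_intr (x : int) : lo%:Z <= x -> lo%:R <= x%:~R :> R.
Proof. by move=> lox; rewrite -[lo%:R]/(lo%:Z%:~R) ler_int. Qed.

Lemma poch_factor_ge0 (x : int) (i : nat) : lo%:Z <= x ->
  0 <= 1 - expR (- (eps * zeta * (x%:~R - lo%:R + 1 + i%:R))).
Proof.
move=> /le_lo_intr lox; rewrite subr_ge0 expR_le1 oppr_le0.
apply: mulr_ge0; first by rewrite mulr_ge0 ?ltW.
by do 2 rewrite addr_ge0//; rewrite subr_ge0.
Qed.

Lemma gwd_ge0 x : lo%:Z <= x -> 0 <= gwd x.
Proof.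
move=> lox; rewrite /gwd !mulr_ge0 ?expR_ge0//; apply: prodr_ge0 => i _.
exact: poch_factor_ge0.
Qed.

Lemma gwd_upper K x : lo%:Z <= x ->
  gwd x <= expR (- (c * eps * x%:~R)) * expR (- (N%:R / kap * VK K (pos x)) +
     n%:R * (expR K%:R * (eps * zeta * (n%:R + 1)))).
Proof.
move=> lox; rewrite /gwd -mulrA ler_wpM2l ?expR_ge0//.
have x0 : 0 <= x by rewrite (le_trans _ lox).
have /andP[y0 y1] := pos01 x0.
have -> : - (N%:R / kap * VK K (pos x)) + n%:R * (expR K%:R * (eps * zeta * (n%:R + 1))) =
   rho * at_%:R * lnt K%:R (pos x) +
   n%:R * (lnt K%:R (1 - pos x `^ zeta) + expR K%:R * (eps * zeta * (n%:R + 1))).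
  rewrite atE nE /VK.
  by have : kap != 0 by [rewrite gt_eqF]; move=> ?; field.
rewrite expRD ler_pM ?expR_ge0//.
- by apply: prodr_ge0 => i _; exact: poch_factor_ge0.
- rewrite ler_expR.
  have -> : - (eps * rho * (at_%:R * x%:~R)) = rho * at_%:R * - (eps * x%:~R) by ring.
  by rewrite ler_wpM2l ?mulr_ge0 ?(ltW rho0) ?ler0n// expR_le_lnt.
set z := (X in n%:R * X).
have -> : n%:R * z = \sum_(i < n) z by rewrite sumr_const card_ord mulr_natl.
rewrite expR_sum {}/z.
apply: ler_prod => i _; apply/andP; split; first exact: poch_factor_ge0.
set d := eps * zeta * (n%:R + 1).
have d0 : 0 <= d by rewrite !mulr_ge0 ?(ltW eps0) ?(ltW zeta0)// addr_ge0.
have /andP[z0 z1] : 0 <= pos x `^ zeta <= 1 by rewrite powR_le1// (ltW y0).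
have step1 : 1 - expR (- (eps * zeta * (x%:~R - lo%:R + 1 + i%:R))) <= 1 - pos x `^ zeta + d.
  suff : pos x `^ zeta - d <= expR (- (eps * zeta * (x%:~R - lo%:R + 1 + i%:R))) by lra.
  apply: (@le_trans _ _ (pos x `^ zeta * expR (- d))).
    apply: (@le_trans _ _ (pos x `^ zeta * (1 - d))).
      by rewrite mulrBr mulr1 lerD2l lerN2 ler_piMl.
    by rewrite ler_wpM2l// expR_ge1Dx.
  rewrite -qp_pos /qp -expRD ler_expR -opprD lerN2 /d -mulrDr ler_wpM2l ?mulr_ge0 ?(ltW eps0) ?(ltW zeta0)//.
  have : i%:R <= n%:R :> R by rewrite ler_nat ltnW.
  have : 0 <= lo%:R :> R by rewrite ler0n.
  lra.
rewrite (le_trans step1)// (le_trans (le_expR_lnt K%:R _))// ler_expR.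
have := lnt_lip K%:R (1 - pos x `^ zeta + d) (1 - pos x `^ zeta).
rewrite lerBlDl => /le_trans; apply; rewrite lerD2l.
have -> : 1 - pos x `^ zeta + d - (1 - pos x `^ zeta) = d by ring.
by rewrite ger0_norm.
Qed.


Lemma pair_bound K (x y : R) :
  `|x `^ eta - y `^ eta| * `|x `^ theta - y `^ theta| <=
  expR (- (2 / kap ^+ 2) * BK K x y).
Proof.
have -> : - (2 / kap ^+ 2) * BK K x y =
    lnt K%:R `|x `^ eta - y `^ eta| + lnt K%:R `|x `^ theta - y `^ theta|.
  by rewrite /BK; have : kap != 0 by [rewrite gt_eqF]; move=> ?; field.
by rewrite expRD ler_pM// le_expR_lnt.
Qed.

(** The product runs over pairs [i < j], whereas the double sum contains [L] diagonal terms
    [kap ^+ 2 * K]. Giving them back costs [L * K], negligible against [N ^+ 2] for fixed [K]. *)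
Lemma vandermonde_upper K (s : seq int) : size s = L ->
  sorted (fun a b => b < a) s ->
  0 <= \prod_(i < L) \prod_(j < L | (i < j)%N)
    ((qp eps eta (nth 0 s j)%:~R - qp eps eta (nth 0 s i)%:~R) *
     (qp eps theta (nth 0 s j)%:~R - qp eps theta (nth 0 s i)%:~R)) <=
  expR (- (\sum_(i < L) \sum_(j < L) BK K (pos (nth 0 s i)) (pos (nth 0 s j))) / kap ^+ 2
    + L%:R * K%:R).
Proof.
move=> ss srt.
have lt_s (i j : 'I_L) : (i < j)%N -> nth 0 s j < nth 0 s i.
  move=> ij; apply: (sorted_ltn_nth _ _ srt) => //.
  - by move=> x y z yx zy; exact: lt_trans zy yx.
  - by rewrite inE ss.
  - by rewrite inE ss.
have qpd p (i j : 'I_L) : 0 < p -> (i < j)%N ->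
    qp eps p (nth 0 s j)%:~R - qp eps p (nth 0 s i)%:~R =
    `|pos (nth 0 s i) `^ p - pos (nth 0 s j) `^ p|.
  move=> p0 ij; rewrite !qp_pos distrC ger0_norm// subr_ge0.
  rewrite -!qp_pos /qp ler_expR lerN2 ler_wpM2l ?mulr_ge0 ?ltW//.
  by rewrite ltr_int lt_s.
apply/andP; split.
  by apply: prodr_ge0 => i _; apply: prodr_ge0 => j ij; rewrite !qpd// mulr_ge0.
have E : - (\sum_(i < L) \sum_(j < L) BK K (pos (nth 0 s i)) (pos (nth 0 s j))) / kap ^+ 2
    + L%:R * K%:R =
    \sum_(i < L) \sum_(j < L | (i < j)%N) (- (2 / kap ^+ 2) * BK K (pos (nth 0 s i)) (pos (nth 0 s j))).
  have k0 : kap ^+ 2 != 0 by rewrite expf_neq0// gt_eqF.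
  have d0 : kap ^+ 2 * K%:R / kap ^+ 2 = K%:R by rewrite mulrAC divff// mul1r.
  have b1 (i j : 'I_L) : BK K (pos (nth 0 s i)) (pos (nth 0 s j)) =
      BK K (pos (nth 0 s j)) (pos (nth 0 s i)) by exact: BK_sym.
  have b2 (i : 'I_L) : BK K (pos (nth 0 s i)) (pos (nth 0 s i)) = kap ^+ 2 * K%:R by exact: BK_diag.
  by rewrite -[X in L%:R * X]d0 (sum_pairs b1 b2 k0).
rewrite E expR_sum; apply: ler_prod => i _; apply/andP; split.
  by apply: prodr_ge0 => j ij; rewrite !qpd// mulr_ge0.
rewrite expR_sum; apply: ler_prod => j ij; rewrite !qpd// mulr_ge0//=.
exact: pair_bound.
Qed.

Lemma gweight_upper K (s : seq int) : size s = L ->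
  sorted (fun a b => b < a) s -> all (fun x => lo%:Z <= x) s ->
  0 <= gweight s <= \prod_(i < L) expR (- (c * eps * (nth 0 s i)%:~R)) *
    expR (- (\sum_(i < L) \sum_(j < L) BK K (pos (nth 0 s i)) (pos (nth 0 s j))) / kap ^+ 2
      - N%:R / kap * (\sum_(i < L) VK K (pos (nth 0 s i)))
      + L%:R * (K%:R + n%:R * (expR K%:R * (eps * zeta * (n%:R + 1))))).
Proof.
move=> ss srt al.
have lo_s (i : 'I_L) : lo%:Z <= nth 0 s i by apply: (allP al); rewrite mem_nth// ss.
have /andP[v0 v1] := vandermonde_upper K ss srt.
have g0 : 0 <= \prod_(i < L) gwd (nth 0 s i) by apply: prodr_ge0 => i _; exact: gwd_ge0.
rewrite /gweight mulr_ge0//=.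
have gu : \prod_(i < L) gwd (nth 0 s i) <=
  \prod_(i < L) expR (- (c * eps * (nth 0 s i)%:~R)) *
  expR (- (N%:R / kap) * (\sum_(i < L) VK K (pos (nth 0 s i))) +
    L%:R * (n%:R * (expR K%:R * (eps * zeta * (n%:R + 1))))).
  have -> : - (N%:R / kap) * (\sum_(i < L) VK K (pos (nth 0 s i))) +
    L%:R * (n%:R * (expR K%:R * (eps * zeta * (n%:R + 1)))) =
    \sum_(i < L) (- (N%:R / kap * VK K (pos (nth 0 s i))) +
      n%:R * (expR K%:R * (eps * zeta * (n%:R + 1)))).
    rewrite [RHS]big_split /=; congr +%R; last by rewrite sumr_const card_ord mulr_natl.
    by rewrite mulr_sumr; apply: eq_bigr => i _; rewrite mulNr.
  rewrite expR_sum -[leRHS]big_split /=; apply: ler_prod => i _.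
  by rewrite gwd_ge0//= gwd_upper.
apply: (le_trans (ler_pM v0 g0 v1 gu)).
rewrite mulrCA ler_wpM2l//; first by apply: prodr_ge0 => i _; exact: expR_ge0.
rewrite -expRD ler_expR.
set a := \sum_(i < L) _; set b := \sum_(i < L) _; set d := n%:R * _.
by rewrite le_eqVlt; apply/orP; left; apply/eqP; ring.
Qed.

End DiscreteModel.

Lemma le_sum1 {R : realFieldType} (I : finType) (P : pred I) (F : I -> R) (i : I) :
  (forall j, P j -> 0 <= F j) -> P i -> F i <= \sum_(j | P j) F j.
Proof.
move=> F0 Pi; rewrite (bigD1 i)//= lerDl; apply: sumr_ge0 => j /andP[Pj _].
exact: F0.
Qed.

(** * Rounding sampled points to a state *)

Section Rounding.
Context {R : realType}.
Variables (eta theta zeta rho c nu tau kap eps delta : R) (N L n at_ lo : nat).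
Hypotheses (eta0 : 0 < eta) (theta0 : 0 < theta) (zeta0 : 0 < zeta) (rho0 : 0 < rho).
Hypotheses (c_gt0 : 0 < c) (nu0 : 0 <= nu) (tau0 : 0 <= tau) (kap0 : 0 < kap) (eps0 : 0 < eps).
Hypotheses (LE : L%:R = kap * N%:R) (nE : n%:R = nu * N%:R) (atE : at_%:R = tau * N%:R).
Hypotheses (N0 : (0 < N)%N) (LN : (L + lo <= 2 * N)%N).
Variables (xs : seq R).
Hypotheses (d0 : 0 < delta) (xs_srt : sorted <=%R xs) (sxs : size xs = L).
Hypothesis xsD : forall i, (i < L)%N -> delta <= nth 0 xs i <= 1.

Local Notation BK := (BK eta theta kap).
Local Notation VK := (VK zeta (kap * nu) (kap * rho * tau)).
Local Notation x := (nth 0 xs).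
Local Notation pos := (pos eps).

Definition ucoord i : R := - ln (x i) / eps.
(* The summand [L - i] makes the gaps of the rounded points at least those of the [ucoord]s. *)
Definition round i : int := Num.floor (ucoord i) + (L - i)%:Z + lo%:Z.
Definition rounded : seq int := mkseq round L.

Let x_gt0 i : (i < L)%N -> 0 < x i.
Proof. by move=> /xsD/andP[h _]; exact: lt_le_trans h. Qed.

Let x01 i : (i < L)%N -> 0 <= x i <= 1.
Proof. by move=> iL; rewrite ltW ?x_gt0//; have /andP[] := xsD iL. Qed.

Lemma expR_ucoord i : (i < L)%N -> expR (- (eps * ucoord i)) = x i.
Proof.
move=> iL; rewrite /ucoord mulrCA divff ?gt_eqF// mulr1 opprK lnK//.
by rewrite posrE x_gt0.
Qed.

Lemma qp_ucoord p i : (i < L)%N -> qp eps p (ucoord i) = x i `^ p.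
Proof.
move=> iL; rewrite -(expR_ucoord iL) -expRM /qp; congr expR; ring.
Qed.

Lemma ucoord_ge0 i : (i < L)%N -> 0 <= ucoord i.
Proof.
move=> iL; rewrite /ucoord divr_ge0 ?(ltW eps0)// oppr_ge0 ln_le0//.
by have /andP[] := xsD iL.
Qed.

Lemma ucoord_anti i j : (i < j)%N -> (j < L)%N -> ucoord j <= ucoord i.
Proof.
move=> ij jL; have iL := ltn_trans ij jL.
rewrite /ucoord ler_pM2r ?invr_gt0// lerN2 ler_ln ?posrE ?x_gt0//.
apply: (sorted_leq_nth le_trans lexx) => //; last exact: ltnW.
  by rewrite inE sxs.
by rewrite inE sxs.
Qed.

Lemma roundR i : (round i)%:~R = (Num.floor (ucoord i))%:~R + (L - i)%:R + lo%:R :> R.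
Proof. by rewrite /round !intrD. Qed.

Lemma round_le i : (i < L)%N -> (round i)%:~R <= ucoord i + 2 * N%:R.
Proof.
move=> iL; rewrite roundR -addrA lerD ?floor_le//.
by rewrite -natrD -natrM ler_nat (leq_trans _ LN)// leq_add2r leq_subr.
Qed.

Lemma round_ge i : (i < L)%N -> ucoord i + lo%:R <= (round i)%:~R.
Proof.
move=> iL; rewrite roundR lerD2r.
have := floorD1_gt (ucoord i); rewrite intrD => /ltW /le_trans; apply.
by rewrite lerD2l ler1n subn_gt0.
Qed.

(** Taking floors loses less than 1 of the gap, and [L - i] exceeds [L - j] by at least 1. *)
Lemma round_gap i j : (i < j)%N -> (j < L)%N ->
  ucoord i - ucoord j <= (round i)%:~R - (round j)%:~R.
Proof.
move=> ij jL; rewrite !roundR.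
have := floorD1_gt (ucoord i); rewrite intrD => /ltW h1.
have h2 := floor_le (ucoord j).
have h3 : (L - j)%:R + 1 <= (L - i)%:R :> R.
  by rewrite natr1 ler_nat ltn_sub2l// (ltn_trans ij).
move: h1 h2 h3; move: (Num.floor _)%:~R (Num.floor _)%:~R (L - j)%:R (L - i)%:R => a b a' b'.
rewrite -[1%:~R]/(1 : R); lra.
Qed.

Lemma round_lt i j : (i < j)%N -> (j < L)%N -> round j < round i.
Proof.
move=> ij jL; rewrite /round ltrD2r; apply: ler_ltD.
  exact/le_floor/ucoord_anti.
by rewrite ltz_nat ltn_sub2l// (ltn_trans ij).
Qed.

Lemma rounded_state : [/\ size rounded = L, sorted (fun a b : int => b < a) rounded &
  all (fun z => lo%:Z <= z) rounded].
Proof.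
split; first by rewrite size_mkseq.
  rewrite /rounded /mkseq sorted_map.
  apply: (@sub_in_sorted _ (fun i => (i < L)%N) ltn).
  - by move=> i j iL jL ij; exact: (round_lt ij jL).
  - by apply/allP => i; rewrite mem_iota.
  - exact: iota_ltn_sorted.
apply/(all_nthP 0) => i; rewrite size_mkseq => iL; rewrite nth_mkseq//.
by rewrite /round lerDr addr_ge0// floor_ge0 ucoord_ge0.
Qed.

Lemma round_close i : (i < L)%N -> `|pos (round i) - x i| <= 2 * N%:R * eps.
Proof.
move=> iL; have h1 := round_le iL; have h2 := round_ge iL.
have p1 : pos (round i) <= x i.
  rewrite -(expR_ucoord iL) ler_expR lerN2 ler_wpM2l ?(ltW eps0)//.
  by rewrite (le_trans _ h2)// lerDl.
rewrite distrC ger0_norm ?subr_ge0//.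
have p2 : x i * (1 - 2 * N%:R * eps) <= pos (round i).
  apply: (@le_trans _ _ (x i * expR (- (2 * N%:R * eps)))).
    by rewrite ler_wpM2l ?expR_ge1Dx ?(ltW (x_gt0 iL)).
  rewrite -(expR_ucoord iL) -expRD ler_expR -opprD lerN2 /=.
  have -> : eps * ucoord i + 2 * N%:R * eps = eps * (ucoord i + 2 * N%:R) by ring.
  by rewrite ler_wpM2l ?(ltW eps0).
have /andP[_ xi1] := xsD iL.
have e0 : 0 <= 2 * N%:R * eps by rewrite mulr_ge0 ?(ltW eps0).
move: p2; rewrite mulrBr mulr1 => p2.
have p3 : x i * (2 * N%:R * eps) <= 2 * N%:R * eps by rewrite ler_piMl.
by rewrite lerBlDl -lerBlDr (le_trans _ p2)// lerD2l lerN2.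
Qed.

(** With [q = exp(- eps)], write [q^(p a) - q^(p b) = q^(p a) * (1 - q^(p (b - a)))]. Rounding
    shifts [a] by at most [2 * N], which gives the exponential loss, and does not decrease [b - a],
    so the second factor does not drop. *)
Lemma vandermonde_factor (p : R) i j : 0 < p -> (i < j)%N -> (j < L)%N ->
  expR (- (2 * N%:R * eps * p)) * `|x i `^ p - x j `^ p| <=
  qp eps p (round j)%:~R - qp eps p (round i)%:~R.
Proof.
move=> p0 ij jL; have iL := ltn_trans ij jL.
have ep : 0 < eps * p by rewrite mulr_gt0.
have E (a b : R) : qp eps p a - qp eps p b = expR (- (eps * p * a)) * (1 - expR (- (eps * p * (b - a)))).
  by rewrite mulrBr mulr1 -expRD /qp; congr (_ - expR _); ring.
rewrite distrC -!qp_ucoord// ger0_norm; last first.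
  by rewrite subr_ge0 ler_expR lerN2 ler_wpM2l ?(ltW ep)// ucoord_anti.
rewrite !E mulrA -expRD ler_pM ?expR_ge0//.
- by rewrite subr_ge0 expR_le1 oppr_le0 mulr_ge0 ?(ltW ep)// subr_ge0 ucoord_anti.
- rewrite ler_expR -opprD lerN2.
  have -> : 2 * N%:R * eps * p + eps * p * ucoord j = eps * p * (ucoord j + 2 * N%:R) by ring.
  by rewrite ler_wpM2l ?(ltW ep)// round_le.
by rewrite lerD2l lerN2 ler_expR lerN2 ler_wpM2l ?(ltW ep)// round_gap.
Qed.

Lemma gwd_lower (K : nat) i : (i < L)%N -> expR (- K%:R) <= delta ->
  (n = 0%N \/ expR (- K%:R) <= 1 - x i `^ zeta) ->
  expR (- (N%:R / kap * VK K (x i)) -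
     (c * (2 * N%:R * eps - ln delta) + 2 * N%:R * eps * rho * at_%:R)) <=
  gwd zeta rho c eps n at_ lo (round i).
Proof.
move=> iL Kd Kn.
have h1 := round_le iL; have h2 := round_ge iL.
have /andP[dx x1] := xsD iL.
have -> : - (N%:R / kap * VK K (x i)) -
     (c * (2 * N%:R * eps - ln delta) + 2 * N%:R * eps * rho * at_%:R) =
   - (c * (2 * N%:R * eps - ln delta)) +
   (rho * at_%:R * lnt K%:R (x i) - 2 * N%:R * eps * rho * at_%:R) +
   n%:R * lnt K%:R (1 - x i `^ zeta).
  rewrite atE nE /VK; have : kap != 0 by [rewrite gt_eqF]; move: (lnt _ _) (lnt _ _) => a b ?.
  by field.
rewrite !expRD /gwd ler_pM ?mulr_ge0 ?expR_ge0// ?ler_pM ?expR_ge0//.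
- rewrite ler_expR lerN2 -mulrA ler_wpM2l ?(ltW c_gt0)//.
  apply: (@le_trans _ _ (eps * (ucoord i + 2 * N%:R))); first by rewrite ler_wpM2l ?(ltW eps0).
  have : ln delta <= ln (x i) by rewrite ler_ln ?posrE ?x_gt0.
  rewrite mulrDr /ucoord [eps * (_ / _)]mulrCA divff ?gt_eqF// mulr1.
  move: (ln _) (ln _) => a b ab.
  have -> : eps * (2 * N%:R) = 2 * N%:R * eps by ring.
  lra.
- rewrite -expRD ler_expR lntE; last exact: le_trans dx.
  have -> : ln (x i) = - (eps * ucoord i).
    by rewrite /ucoord mulrCA divff ?gt_eqF// mulr1 opprK.
  have -> : rho * at_%:R * - (eps * ucoord i) - 2 * N%:R * eps * rho * at_%:R =
     - (eps * rho * at_%:R * (ucoord i + 2 * N%:R)) by ring.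
  by rewrite lerN2 [leLHS]mulrA ler_wpM2l ?mulr_ge0 ?(ltW eps0) ?(ltW rho0).
have : n%:R * lnt K%:R (1 - x i `^ zeta) = \sum_(k < n) lnt K%:R (1 - x i `^ zeta).
  by rewrite sumr_const card_ord mulr_natl.
move=> ->; rewrite expR_sum; apply: ler_prod => k _; rewrite expR_ge0/=.
case: Kn => [n00|Kn]; first by case: k => k; rewrite n00.
rewrite lntE// lnK; last by rewrite posrE (lt_le_trans _ Kn)// expR_gt0.
rewrite lerD2l lerN2 -qp_ucoord// ler_expR lerN2 ler_wpM2l ?mulr_ge0 ?(ltW eps0) ?(ltW zeta0)//.
apply: (@le_trans _ _ ((round i)%:~R - lo%:R)); first by rewrite lerBrDr.
by rewrite -addrA lerDl addr_ge0.
Qed.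

End Rounding.

Lemma lnt_gt_expR {R : realType} (K r : R) : - K < lnt K r -> expR (- K) <= r.
Proof.
by move=> h; have [r0 e] := lnt_gt h; rewrite -[leRHS]lnK ?posrE// ler_expR -e ltW.
Qed.

Section RoundingWeight.
Context {R : realType}.
Variables (eta theta zeta rho c nu tau kap eps delta : R) (N L n at_ lo : nat).
Hypotheses (eta0 : 0 < eta) (theta0 : 0 < theta) (zeta0 : 0 < zeta) (rho0 : 0 < rho).
Hypotheses (c_gt0 : 0 < c) (nu0 : 0 <= nu) (tau0 : 0 <= tau) (kap0 : 0 < kap) (eps0 : 0 < eps).
Hypotheses (LE : L%:R = kap * N%:R) (nE : n%:R = nu * N%:R) (atE : at_%:R = tau * N%:R).
Hypotheses (N0 : (0 < N)%N) (LN : (L + lo <= 2 * N)%N).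
Variables (xs : seq R).
Hypotheses (d0 : 0 < delta) (xs_srt : sorted <=%R xs) (sxs : size xs = L).
Hypothesis xsD : forall i, (i < L)%N -> delta <= nth 0 xs i <= 1.

Local Notation BK := (BK eta theta kap).
Local Notation VK := (VK zeta (kap * nu) (kap * rho * tau)).
Local Notation x := (nth 0 xs).

(** The hypothesis says that two nonnegative truncated logarithms, taken with a minus sign, sum to
    less than [K]; then neither of them is truncated. *)
Lemma pair_untruncated (K : nat) (i j : nat) : (i < L)%N -> (j < L)%N ->
  2 * BK K (x i) (x j) < kap ^+ 2 * K%:R ->
  `|x i `^ eta - x j `^ eta| * `|x i `^ theta - x j `^ theta| =
  expR (- (2 / kap ^+ 2) * BK K (x i) (x j)).
Proof.
move=> iL jL.
have x01 k : (k < L)%N -> 0 <= x k <= 1.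
  by move=> /xsD/andP[h ->]; rewrite (le_trans _ h)// ltW.
have K0 : 0 <= K%:R :> R by [].
have a0 := lnt_le0 K0 (powR_dist_le1 theta0 (x01 _ iL) (x01 _ jL)).
have b0 := lnt_le0 K0 (powR_dist_le1 eta0 (x01 _ iL) (x01 _ jL)).
have k2 : 0 < kap ^+ 2 by rewrite exprn_gt0.
have -> : - (2 / kap ^+ 2) * BK K (x i) (x j) =
    lnt K%:R `|x i `^ eta - x j `^ eta| + lnt K%:R `|x i `^ theta - x j `^ theta|.
  rewrite /BK; have : kap != 0 by [rewrite gt_eqF].
  by move: (lnt _ _) (lnt _ _) => a b ?; field.
rewrite /BK => H.
have {}H : - lnt K%:R `|x i `^ theta - x j `^ theta| - lnt K%:R `|x i `^ eta - x j `^ eta| < K%:R.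
  by rewrite -(ltr_pM2l k2) (le_lt_trans _ H)// [leRHS]mulrA [2 * _]mulrC divfK// pnatr_eq0.
have [h1 e1] : 0 < `|x i `^ eta - x j `^ eta| /\
    lnt K%:R `|x i `^ eta - x j `^ eta| = ln `|x i `^ eta - x j `^ eta|.
  by apply: lnt_gt; move: H a0 b0; move: (lnt _ _) (lnt _ _) => a b; lra.
have [h2 e2] : 0 < `|x i `^ theta - x j `^ theta| /\
    lnt K%:R `|x i `^ theta - x j `^ theta| = ln `|x i `^ theta - x j `^ theta|.
  by apply: lnt_gt; move: H a0 b0; move: (lnt _ _) (lnt _ _) => a b; lra.
by rewrite e1 e2 expRD !lnK.
Qed.

(** After removal of the diagonal all terms of the cost are nonnegative, so each one is bounded by
    [T]. Since [K] is beyond [T], no logarithm is truncated and the weight is computed exactly, up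
    to rounding. When [n = 0] there is no Pochhammer factor to control. *)
Lemma gweight_lower (K : nat) (T : R) : expR (- K%:R) <= delta ->
  \sum_(i < L) \sum_(j < L) BK K (x i) (x j) - \sum_(i < L) BK K (x i) (x i)
    + L%:R * \sum_(i < L) VK K (x i) <= T ->
  T < kap ^+ 2 * K%:R -> (n = 0%N \/ T < kap * nu * K%:R) ->
  expR (- (T / kap ^+ 2) - (L%:R ^+ 2 * (2 * N%:R * eps * (eta + theta)) +
    L%:R * (c * (2 * N%:R * eps - ln delta) + 2 * N%:R * eps * rho * at_%:R))) <=
  gweight eta theta zeta rho c eps L n at_ lo (rounded eps L lo xs).
Proof.
move=> Kd HT TK Tn.
have x01 k : (k < L)%N -> 0 <= x k <= 1.
  by move=> /xsD/andP[h ->]; rewrite (le_trans _ h)// ltW.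
have k2 : 0 < kap ^+ 2 by rewrite exprn_gt0.
pose B (i j : 'I_L) := BK K (x i) (x j).
pose V (i : 'I_L) := VK K (x i).
have c00 : 0 <= kap * nu by rewrite mulr_ge0 ?(ltW kap0).
have c10 : 0 <= kap * rho * tau by rewrite !mulr_ge0 ?(ltW kap0) ?(ltW rho0).
have B0 i j : 0 <= B i j by apply: BK_ge0 => //; exact: x01.
have V0 i : 0 <= V i.
  exact: (VK_ge0 zeta0 c00 c10 K (x01 _ (ltn_ord i))).
have Bs i j : B i j = B j i by exact: BK_sym.
pose S2 := \sum_(i < L) \sum_(j < L | (i < j)%N) B i j.
pose SV := \sum_(i < L) V i.
have SV0 : 0 <= SV by apply: sumr_ge0.
have S20 : 0 <= S2 by apply: sumr_ge0 => i _; apply: sumr_ge0.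
have {}HT : 2 * S2 + L%:R * SV <= T.
  have : (\sum_(i < L) \sum_(j < L) B i j) - \sum_(i < L) B i i + L%:R * SV <= T by exact: HT.
  rewrite (sum_sym Bs) -/S2; move: (\sum_(i < L) B i i) => D.
  by rewrite [D + _]addrC addrK.
have LSV0 : 0 <= L%:R * SV by rewrite mulr_ge0.
have BT (i j : 'I_L) : (i < j)%N -> 2 * B i j <= T.
  move=> ij; have h1 : B i j <= \sum_(j < L | (i < j)%N) B i j.
    by apply: (@le_sum1 _ _ (fun j : 'I_L => (i < j)%N) (B i)).
  have h2 : \sum_(j < L | (i < j)%N) B i j <= S2.
    apply: (@le_sum1 _ _ xpredT (fun i : 'I_L => \sum_(j < L | (i < j)%N) B i j)); last by [].
    by move=> i' _; apply: sumr_ge0.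
  lra.
have VT (i : 'I_L) : V i <= T.
  have h1 : V i <= SV by apply: (@le_sum1 _ _ xpredT V).
  have L1 : 1 <= L%:R :> R by rewrite ler1n (leq_ltn_trans _ (ltn_ord i)).
  have : SV <= L%:R * SV by rewrite ler_peMl.
  lra.
have Kn (i : 'I_L) : n = 0%N \/ expR (- K%:R) <= 1 - x i `^ zeta.
  case: Tn => [->|Tn]; [by left|right].
  have T0 : 0 <= T by lra.
  have kn : 0 < kap * nu.
    rewrite lt_neqAle mulr_ge0 ?(ltW kap0)// andbT eq_sym; apply/negP => /eqP k0.
    by move: Tn; rewrite k0 mul0r ltNge T0.
  apply: lnt_gt_expR; rewrite ltrNl -(ltr_pM2l kn); apply: le_lt_trans Tn.
  apply: le_trans (VT i); rewrite /V /VK mulrN lerDl oppr_ge0.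
  rewrite mulr_ge0_le0 ?mulr_ge0 ?(ltW kap0) ?(ltW rho0)//.
  by rewrite lnt_le0//; have /andP[] := x01 _ (ltn_ord i).
(* The rounding loss of one pair, from its [eta] and [theta] factors together; the pairs are counted
   generously as [L ^+ 2]. *)
set w := 2 * N%:R * eps * (eta + theta).
have w0 : 0 <= w by rewrite !mulr_ge0 ?addr_ge0 ?(ltW eps0) ?(ltW eta0) ?(ltW theta0).
set e := c * _ + _.
have vand : expR (- (L%:R ^+ 2 * w) - (2 / kap ^+ 2) * S2) <=
    \prod_(i < L) \prod_(j < L | (i < j)%N)
    ((qp eps eta (nth 0 (rounded eps L lo xs) j)%:~R - qp eps eta (nth 0 (rounded eps L lo xs) i)%:~R) *
     (qp eps theta (nth 0 (rounded eps L lo xs) j)%:~R - qp eps theta (nth 0 (rounded eps L lo xs) i)%:~R)).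
  apply: (@le_trans _ _ (expR (\sum_(i < L) \sum_(j < L | (i < j)%N) (- w - (2 / kap ^+ 2) * B i j)))).
    rewrite ler_expR.
    have -> : \sum_(i < L) \sum_(j < L | (i < j)%N) (- w - (2 / kap ^+ 2) * B i j) =
        \sum_(i < L) \sum_(j < L | (i < j)%N) (- w) - (2 / kap ^+ 2) * S2.
      rewrite mulr_sumr -sumrN -big_split /=; apply: eq_bigr => i _.
      by rewrite big_split /= mulr_sumr -sumrN.
    rewrite lerD2r.
    have -> : - (L%:R ^+ 2 * w) = \sum_(i < L) \sum_(j < L) (- w).
      rewrite [RHS](eq_bigr (fun=> L%:R * (- w))); last first.
        by move=> i _; rewrite sumr_const card_ord mulr_natl.
      by rewrite sumr_const card_ord -mulr_natl; ring.
    apply: ler_sum => i _; rewrite [leLHS](bigID (fun j : 'I_L => (i < j)%N)) /=.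
    by rewrite gerDl; apply: sumr_le0 => j _; rewrite oppr_le0.
  rewrite expR_sum; apply: ler_prod => i _; rewrite expR_ge0/=.
  rewrite expR_sum; apply: ler_prod => j ij; rewrite expR_ge0/=.
  rewrite !nth_mkseq//.
  have -> : - w - (2 / kap ^+ 2) * B i j = - (2 * N%:R * eps * eta) +
      - (2 * N%:R * eps * theta) + - (2 / kap ^+ 2) * B i j.
    by rewrite /w; ring.
  rewrite !expRD -(pair_untruncated (ltn_ord i) (ltn_ord j)); last first.
    exact: le_lt_trans (BT i j ij) TK.
  rewrite mulrACA ler_pM ?mulr_ge0 ?expR_ge0//.
    exact: (vandermonde_factor eps0 LN d0 xs_srt sxs xsD eta0 ij (ltn_ord j)).
  exact: (vandermonde_factor eps0 LN d0 xs_srt sxs xsD theta0 ij (ltn_ord j)).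
have gw : expR (- (N%:R / kap * SV) - L%:R * e) <=
    \prod_(i < L) gwd zeta rho c eps n at_ lo (nth 0 (rounded eps L lo xs) i).
  have -> : - (N%:R / kap * SV) - L%:R * e = \sum_(i < L) (- (N%:R / kap * V i) - e).
    rewrite big_split /= sumr_const card_ord mulNrn -[e *+ L]mulr_natl; congr (_ - _).
    by rewrite mulr_sumr sumrN.
  rewrite expR_sum; apply: ler_prod => i _; rewrite expR_ge0/= nth_mkseq//.
  exact: (gwd_lower zeta0 rho0 c_gt0 kap0 eps0 nE atE LN d0 xsD (ltn_ord i) Kd (Kn i)).
apply: (@le_trans _ _ (expR (- (L%:R ^+ 2 * w) - (2 / kap ^+ 2) * S2) *
   expR (- (N%:R / kap * SV) - L%:R * e))); last by rewrite /gweight ler_pM ?expR_ge0.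
rewrite -expRD ler_expR.
have -> : - (L%:R ^+ 2 * w) - (2 / kap ^+ 2) * S2 + (- (N%:R / kap * SV) - L%:R * e) =
   - ((2 * S2 + L%:R * SV) / kap ^+ 2) - (L%:R ^+ 2 * w + L%:R * e).
  have -> : N%:R / kap = L%:R / kap ^+ 2.
    by rewrite LE; have : kap != 0 by [rewrite gt_eqF]; move=> ?; field.
  by have : kap != 0 by [rewrite gt_eqF]; move=> ?; field.
by rewrite lerD2r lerN2 ler_pM2r ?invr_gt0.
Qed.

End RoundingWeight.

Lemma sum_uniq_sub {R : realFieldType} (I : eqType) (X Y : seq I) (f : I -> R) :
  (forall i, 0 <= f i) -> uniq X -> {subset X <= Y} ->
  \sum_(i <- X) f i <= \sum_(i <- Y) f i.
Proof.
move=> f0; elim: X Y => [|x X ih] Y /=.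
  by rewrite big_nil => _ _; apply: sumr_ge0.
move=> /andP[xX uX] XY; have xY : x \in Y by apply: XY; rewrite mem_head.
rewrite big_cons (big_rem x xY) /= lerD2l; apply: ih => // y yX.
have yx : y != x by apply: contraNneq xX => <-.
have : y \in Y by apply: XY; rewrite in_cons yX orbT.
by rewrite (perm_mem (perm_to_rem xY)) in_cons (negbTE yx).
Qed.

(** * Summation of geometric weights over configurations *)

Section GeometricBound.
Context {R : realType}.
Variable a : R.
Hypothesis a0 : 0 < a.

Fixpoint all_seqs (B L : nat) : seq (seq int) :=
  if L is L'.+1 then [seq (Posz x) :: s | x <- iota 0 B, s <- all_seqs B L'] else [:: [::]].

Lemma mem_all_seqs B L (s : seq int) : size s = L -> all (fun x : int => 0 <= x < B%:Z) s ->
  s \in all_seqs B L.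
Proof.
elim: L s => [|L ih] [|x s] //= [ss] /andP[/andP[x0 xB] al].
case: x x0 xB => // x _; rewrite ltz_nat => xB.
by apply: (allpairs_f (fun x s => Posz x :: s)); rewrite ?mem_iota//; exact: ih.
Qed.

Lemma sum_all_seqs B L :
  \sum_(s <- all_seqs B L) \prod_(x <- s) expR (- (a * x%:~R)) =
  (\sum_(k < B) expR (- a) ^+ k) ^+ L.
Proof.
elim: L => [|L ih]; first by rewrite big_seq1 big_nil expr0.
rewrite /= big_allpairs_dep exprS -ih mulr_suml -(big_mkord xpredT (fun k => expR (- a) ^+ k *
   \sum_(s <- all_seqs B L) \prod_(x <- s) expR (- (a * x%:~R)))) /index_iota subn0.
apply: eq_bigr => k _; rewrite mulr_sumr; apply: eq_bigr => s _.
by rewrite big_cons -expRM_natr mulNr.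
Qed.

Lemma geometric_sum_le B : \sum_(k < B) expR (- a) ^+ k <= (1 - expR (- a))^-1.
Proof.
have r1 : expR (- a) < 1 by rewrite expR_lt1 oppr_lt0.
rewrite -[leRHS]mul1r ler_pdivlMr ?subr_gt0//.
have := subrX1 (expR (- a)) B; set S := \sum_(k < B) _ => h.
have : S * (1 - expR (- a)) = 1 - expR (- a) ^+ B.
  by rewrite -[RHS]opprB h -opprB; ring.
by move=> ->; rewrite gerBl exprn_ge0// expR_ge0.
Qed.

(** Dropping the order of the particles and letting each range over all nonnegative integers, the
    sum factorises into [L] geometric series. Any finite set of configurations lies in a box
    [all_seqs B L], on which the product formula is finite. *)
Lemma esum_geometric_bound (L : nat) (C : R) (A : set (seq int)) (w : seq int -> R) :
  0 <= C -> (forall s, A s -> [/\ size s = L, all (fun x : int => 0 <= x) s &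
    0 <= w s <= C * \prod_(x <- s) expR (- (a * x%:~R))]) ->
  (\esum_(s in A) (w s)%:E <= (C * (1 - expR (- a))^-1 ^+ L)%:E)%E.
Proof.
move=> C0 HA; apply: ge_ereal_sup => _ [F [finF FA] <-].
rewrite fsbig_finite// sumEFin lee_fin.
set X := finmap.enum_fset (fset_set F).
have XA s : s \in X -> A s by rewrite in_fset_set// inE => /FA.
pose B := (\max_(s <- X) \max_(x <- s) `|x|%N).+1.
pose f (s : seq int) := C * \prod_(x <- s) expR (- (a * x%:~R)).
have f0 s : 0 <= f s by rewrite mulr_ge0//; apply: prodr_ge0 => i _; exact: expR_ge0.
apply: (@le_trans _ _ (\sum_(s <- X) f s)).
  rewrite big_seq [leRHS]big_seq; apply: ler_sum => s.
  by move=> /XA/HA[_ _ /andP[]].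
apply: (@le_trans _ _ (\sum_(s <- all_seqs B L) f s)).
  apply: sum_uniq_sub => //; first exact: finmap.fset_uniq.
  move=> s sF; have [ss s0 _] := HA _ (XA _ sF).
  apply: mem_all_seqs => //; apply/allP => x xs.
  have x0 := allP s0 _ xs; rewrite x0/= -(gez0_abs x0) ltz_nat /B ltnS.
  apply: (@leq_trans (\max_(x <- s) `|x|%N)).
    exact: (@leq_bigmax_seq _ _ xpredT (fun x : int => `|x|%N)).
  exact: (@leq_bigmax_seq _ _ xpredT (fun s : seq int => \max_(x <- s) `|x|%N)).
rewrite /f -mulr_sumr sum_all_seqs ler_wpM2l//.
apply: lerXn2r; rewrite ?nnegrE ?geometric_sum_le//.
  by apply: sumr_ge0 => k _; rewrite exprn_ge0// expR_ge0.
by rewrite invr_ge0 subr_ge0 ltW// expR_lt1 oppr_lt0.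
Qed.

End GeometricBound.

(** * Integrals against empirical measures *)

Section Empirical.
Context {R : realType}.
Variables (N M : nat) (t : int) (eps : R) (s : seq int).
Local Notation L := (Lnum N M t).
Local Notation I01 := (`[0%R, 1%R]%classic : set R).
Local Notation pos := (pos eps).
Hypotheses (eps0 : 0 < eps) (L0 : (0 < L)%N).
Hypothesis s0 : forall i, (i < L)%N -> 0 <= nth 0 s i.

Let p i := pos (nth 0 s i).

Let p01 i : (i < L)%N -> I01 (p i).
Proof. by move=> iL; rewrite /= in_itv /=; have /andP[/ltW -> ->] := pos01 eps0 (s0 iL). Qed.

Lemma empiricalE (A : set R) :
  empirical N M t eps s A = ((L%:R^-1)%:E * \sum_(i < L) \d_(p i) A)%E.
Proof. by []. Qed.

Lemma empirical_P01 : P01 (empirical N M t eps s).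
Proof.
split; rewrite empiricalE.
  rewrite (eq_bigr (fun=> 1%E)) => [|i _]; last by rewrite diracT.
  rewrite sumEFin sumr_const card_ord -EFinM -[_ *+ _]/(L%:R) mulVf//.
  by rewrite pnatr_eq0 -lt0n.
rewrite big1 ?mule0// => i _; rewrite diracE memNset//; apply; exact: p01.
Qed.

Lemma empirical_ge0_integral (h : R -> R) : measurable_fun I01 h ->
  (forall x, I01 x -> 0 <= h x) ->
  (\int[empirical N M t eps s]_(x in I01) (h x)%:E =
   (L%:R^-1 * \sum_(i < L) h (p i))%:E)%E.
Proof.
move=> mh h0; have m01 := @measurable_I01 R.
have mE : measurable_fun I01 (fun x => (h x)%:E) by apply/measurable_EFinP.
have h0E x : I01 x -> (0 <= (h x)%:E)%E by move=> /h0; rewrite lee_fin.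
rewrite /empirical ge0_integral_mscale// ge0_integral_measure_sum//.
rewrite (eq_bigr (fun i : 'I_L => (h (p i))%:E)) => [|i _]; last first.
  by rewrite integral_dirac// diracE mem_set ?mul1e//; exact: p01.
by rewrite sumEFin EFinM.
Qed.

(** Adding the bound [B] reduces the claim to a nonnegative integrand, for which integration splits
    over the sum of Dirac measures. *)
Lemma av_empirical (h : R -> R) : bmeas I01 h ->
  av (empirical N M t eps s) I01 h = L%:R^-1 * \sum_(i < L) h (p i).
Proof.
move=> bh; have [mh [B hB]] := bh.
have m01 := @measurable_I01 R; have P := empirical_P01; have f := P01_lty P.
have bB : bmeas I01 (fun=> B : R) by exact: bmeas_cst.
have -> : av (empirical N M t eps s) I01 h =
    av (empirical N M t eps s) I01 (fun x => h x + B) - B.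
  by rewrite (avD m01 f bh bB) av_cst// P01_fine// mulr1 addrK.
rewrite {1}/av empirical_ge0_integral.
- rewrite /= big_split /= sumr_const card_ord mulrDr -[B *+ _]mulr_natl mulKf ?addrK//.
  by rewrite pnatr_eq0 -lt0n.
- by have [] := bmeasD bh bB.
- by move=> x /hB; rewrite ler_norml => /andP[? _]; rewrite -lerBlDr sub0r.
Qed.

End Empirical.

(** A discrete layer-cake formula: the integral of a logarithm reduces to the masses of the sets
    where its argument is below [exp(- n)]. *)
Lemma lnt_le_count {R : realType} (K : nat) (r : R) :
  - lnt K%:R r <= \sum_(n < K) ((r < expR (- n%:R))%R)%:R.
Proof.
elim: K => [|K ih].
  by rewrite big_ord0 oppr_le0 (le_trans _ (lnt_ge _ _))// oppr0.
rewrite big_ord_recr /=; case: ltP => [h|h].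
  have := lnt_ge K.+1%:R r; have e1 : lnt K%:R r = - K%:R.
    by rewrite /lnt max_r ?expRK// ltW.
  rewrite e1 opprK in ih; rewrite -natr1 => h2.
  by rewrite (le_trans _ (lerD ih (lexx 1)))// lerNl.
rewrite addr0; apply: le_trans ih; rewrite !lntE//.
by rewrite (le_trans _ h)// ler_expR lerN2 ler_nat.
Qed.

Lemma lnt_ge_ln {R : realType} (K r r0 : R) : 0 < r0 -> r0 <= r -> ln r0 <= lnt K r.
Proof.
by move=> r00 rr; rewrite /lnt ler_ln ?posrE ?lnt_max_gt0// le_max rr.
Qed.

(** For [y <= x <= 1] one has [ln x - ln y >= x - y], and [exp z >= 1 + z] transfers this to powers:
    [x^p - y^p = y^p * (exp(p * (ln x - ln y)) - 1)]. *)
Lemma powR_dist_ge {R : realType} (p b x y : R) : 0 < p -> 0 < b -> b <= x <= 1 -> b <= y <= 1 ->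
  p * b `^ p * `|x - y| <= `|x `^ p - y `^ p|.
Proof.
move=> p0 b0; wlog yx : x y / y <= x.
  move=> H xb yb; have [yx|/ltW xy] := leP y x; first exact: H.
  by rewrite distrC [leRHS]distrC; exact: H.
move=> /andP[bx x1] /andP[by_ y1].
have x0 := lt_le_trans b0 bx; have y0 := lt_le_trans b0 by_.
have ypos : 0 < y `^ p by rewrite powR_gt0.
have h : x `^ p = y `^ p * expR (p * (ln x - ln y)).
  rewrite /powR !gt_eqF// -expRD; congr expR; ring.
have h1 : x - y <= ln x - ln y.
  have h2 : (x - y) / x <= ln x - ln y.
    have : ln (1 + (y / x - 1)) <= y / x - 1.
      by apply: le_ln1Dx; rewrite ltrBrDr addNr divr_gt0.
    rewrite addrC subrK ln_div ?posrE// mulrBl divff ?gt_eqF// => ?.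
    by rewrite -lerN2 !opprB.
  apply: le_trans h2; rewrite ler_pdivlMr// ler_piMr// subr_ge0//.
have h3 : 1 + p * (x - y) <= expR (p * (ln x - ln y)).
  apply: le_trans (expR_ge1Dx _); rewrite lerD2l ler_wpM2l ?(ltW p0)//.
have h4 : b `^ p <= y `^ p by rewrite ge0_ler_powR ?nnegrE ?(ltW p0) ?(ltW b0) ?(ltW y0).
have h5 : y `^ p * (p * (x - y)) <= x `^ p - y `^ p.
  rewrite h; set E := expR _ in h3 *.
  have -> : y `^ p * E - y `^ p = y `^ p * (E - 1) by ring.
  by rewrite ler_wpM2l ?(ltW ypos)// lerBrDl.
rewrite !ger0_norm ?subr_ge0//; last by rewrite ge0_ler_powR ?nnegrE ?(ltW p0) ?(ltW x0) ?(ltW y0).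
apply: le_trans h5; rewrite [p * _]mulrC -mulrA ler_wpM2r// mulr_ge0 ?subr_ge0// ltW//.
Qed.

(** * A measure of finite energy *)

Section FiniteEnergy.
Context {R : realType}.
Local Notation I01 := (`[0%R, 1%R]%classic : set R).
Local Notation J := (`[4^-1, 3 / 4]%classic : set R).

(** Density 2 on [1/4, 3/4]: an interval of radius [r] has mass at most [4 * r], and the support
    avoids 0 and 1, where [ln x] and [ln(1 - x^zeta)] are unbounded. *)
Lemma uniform_measure : exists mu : Meas R, [/\ P01 mu, mu (~` J) = 0%E &
  forall x r : R, 0 <= r -> (mu `](x - r)%R, (x + r)%R[%classic <= (4 * r)%:E)%E].
Proof.
have mJ : measurable (J : set (measurableTypeR R)) by exact: measurable_itv.
pose P : {measure set (measurableTypeR R) -> \bar R} :=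
  mscale (NngNum (ler0n R 2)) (mrestr (@lebesgue_measure R) mJ).
have PE A : P A = (2%:E * lebesgue_measure (A `&` J))%E by [].
have [mu muP] := measurableTypeR_Meas P.
have muE A : mu A = (2%:E * lebesgue_measure (A `&` J))%E by rewrite muP.
have lJ : (4^-1 < 3 / 4 :> R) by lra.
have muJ : mu (~` J) = 0%E by rewrite muE setICl measure0 mule0.
exists mu; split => //.
  split.
    rewrite muE setTI lebesgue_measure_itv/= lte_fin lJ -EFinB -EFinM; congr EFin; lra.
  apply/eqP; rewrite eq_le measure_ge0 andbT -muJ; apply: le_measure; rewrite ?inE.
  - by apply: measurableC; exact: measurable_I01.
  - by apply: measurableC; exact: measurable_itv.
  - apply: subsetC => x /=; rewrite !in_itv /= => /andP[? ?]; apply/andP; split; lra.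
move=> x r r0; rewrite muE.
have -> : ((4 * r)%:E = 2%:E * (2 * r)%:E)%E by rewrite -EFinM; congr EFin; ring.
rewrite lee_wpmul2l ?lee_fin//.
apply: (@le_trans _ _ (lebesgue_measure `]x - r, x + r[%classic)).
  apply: le_measure; rewrite ?inE; last by move=> y [].
    by apply: measurableI => //; exact: measurable_itv.
  exact: measurable_itv.
rewrite lebesgue_measure_itv/= lte_fin; case: ifPn => _.
  by rewrite -EFinB lee_fin; lra.
by rewrite lee_fin mulr_ge0.
Qed.

Lemma av_le_support (mu : Meas R) (h : R -> R) (C : R) : P01 mu -> mu (~` J) = 0%E ->
  bmeas I01 h -> (forall x, 4^-1 <= x <= 3 / 4 -> h x <= C) -> av mu I01 h <= C.
Proof.
move=> P muJ bh hC; have m01 := @measurable_I01 R; have f := P01_lty P.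
have mJ : measurable J by exact: measurable_itv.
have [_ [B hB]] := bh.
(* This dominates [h] on all of [0,1], and its integral is [C] because the complement of [J] is
   null. *)
pose g x : R := C + (`|B| + `|C|) * \1_(~` J) x.
have b1 : bmeas I01 (\1_(~` J) : R -> R).
  split; first by apply: measurable_indic; exact: measurableC.
  by exists 1 => x _; rewrite indicE; case: (_ \in _); rewrite ?normr1 ?normr0.
have bg : bmeas I01 g by apply: bmeasD; [exact: bmeas_cst|exact: bmeasZ].
apply: (@le_trans _ _ (av mu I01 g)).
  apply: av_le => // x xI; rewrite /g indicE; case: (boolP (x \in ~` J)) => [_|].
    have h1 := hB _ xI; have h2 := ler_norm B; have h3 := ler_norm (- C).
    have h4 := ler_norm (h x); rewrite normrN in h3; rewrite mulr1.
    move: h1 h2 h3 h4; move: (h x) `|h x| `|B| `|C| => a a' b' c'; lra.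
  rewrite mulr0 addr0 => /negP xJ; apply: hC.
  have : J x by apply: contrapT => nJ; apply: xJ; rewrite inE.
  by rewrite /= in_itv.
rewrite /g avD//; [|exact: bmeas_cst|exact: bmeasZ].
rewrite av_cst// avZ// P01_fine// mulr1.
have -> : av mu I01 (\1_(~` J)) = 0.
  rewrite /av integral_indic//; last exact: measurableC.
  suff -> : mu (~` J `&` I01) = 0%E by [].
  apply/eqP; rewrite eq_le measure_ge0 andbT -muJ; apply: le_measure; rewrite ?inE.
  - by apply: measurableI => //; exact: measurableC.
  - exact: measurableC.
  - by move=> x [].
by rewrite mulr0 addr0.
Qed.

Variables (eta theta zeta kap c0 c1 : R).
Hypotheses (eta0 : 0 < eta) (theta0 : 0 < theta) (zeta0 : 0 < zeta).
Hypotheses (kap0 : 0 < kap) (c00 : 0 <= c0) (c10 : 0 <= c1).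

(** By the layer-cake bound the potential is at most the sum of the masses of the intervals of
    radius [exp(- n) / c] around [x], a geometric series; the bound depends neither on [K] nor on
    [x]. *)
Lemma lnt_powR_av (mu : Meas R) (p : R) : P01 mu -> mu (~` J) = 0%E -> 0 < p ->
  (forall x r : R, 0 <= r -> (mu `](x - r)%R, (x + r)%R[%classic <= (4 * r)%:E)%E) ->
  exists C : R, forall (K : nat) x, 4^-1 <= x <= 3 / 4 ->
    av mu I01 (fun y => - lnt K%:R `|x `^ p - y `^ p|) <= C.
Proof.
move=> P muJ p0 mub; have m01 := @measurable_I01 R; have f := P01_lty P.
pose c : R := p * 4^-1 `^ p.
have c_gt0 : 0 < c by rewrite mulr_gt0// powR_gt0// invr_gt0.
exists (4 / c * (1 - expR (- 1))^-1) => K x /andP[x1 x2].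
pose H y : R := \sum_(n < K) \1_(`]x - expR (- n%:R) / c, x + expR (- n%:R) / c[%classic) y.
have bi (A : set R) : measurable A -> bmeas I01 (\1_A : R -> R).
  move=> mA; split; first exact: measurable_indic.
  by exists 1 => y _; rewrite indicE; case: (_ \in _); rewrite ?normr1 ?normr0.
have bH : bmeas I01 H by apply: bmeas_sum => n; apply: bi; exact: measurable_itv.
have bl : bmeas I01 (fun y => - lnt K%:R `|x `^ p - y `^ p|).
  apply: ucont01_bmeas => //.
  apply: (@ucont01_lip _ (expR K%:R) _ (fun y => y `^ p)); last exact: ucont01_powR.
  move=> y z; rewrite -opprD normrN (le_trans (lnt_lip_norm _ _ _))// ler_wpM2l ?expR_ge0//.
  rewrite (le_trans (ler_dist_dist _ _))//.
  have -> : x `^ p - y `^ p - (x `^ p - z `^ p) = z `^ p - y `^ p by ring.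
  by rewrite distrC.
apply: (@le_trans _ _ (av mu I01 H)).
  rewrite -subr_le0 -avB//; apply: av_le_support => //; first exact: bmeasB.
  move=> y /andP[y1 y2]; rewrite subr_le0.
  have cxy : c * `|x - y| <= `|x `^ p - y `^ p|.
    by apply: powR_dist_ge; rewrite ?invr_gt0//; apply/andP; split; lra.
  apply: (@le_trans _ _ (- lnt K%:R (c * `|x - y|))); first by rewrite lerN2 lnt_leK.
  rewrite (le_trans (lnt_le_count _ _))// /H; apply: ler_sum => n _.
  rewrite indicE ler_nat; case: (ltP (c * `|x - y|)) => // cn.
  rewrite mem_set//= in_itv /=.
  have : `|x - y| < expR (- n%:R) / c by rewrite ltr_pdivlMr// mulrC.
  by move: (_ / c) => d; rewrite ltr_norml => /andP[? ?]; apply/andP; split; lra.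
rewrite /H av_sum//; last by move=> n; apply: bi; exact: measurable_itv.
apply: (@le_trans _ _ (\sum_(n < K) 4 / c * expR (- 1) ^+ n)).
  apply: ler_sum => n _; rewrite /av integral_indic//.
  have e0 : 0 <= expR (- n%:R) / c by rewrite divr_ge0 ?expR_ge0// ltW.
  rewrite -lee_fin fineK; last first.
    rewrite ge0_fin_numE//; apply: le_lt_trans f; apply: le_measure; rewrite ?inE//.
    by apply: measurableI => //; exact: measurable_itv.
  have e1 : 4 / c * expR (- 1) ^+ n = 4 * (expR (- n%:R) / c).
    by rewrite -expRM_natr mulN1r; ring.
  rewrite e1; apply: le_trans (mub x _ e0); apply: le_measure; rewrite ?inE//.
  by apply: measurableI => //; exact: measurable_itv.
rewrite -mulr_sumr ler_wpM2l ?divr_ge0 ?(ltW c_gt0)//.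
exact: geometric_sum_le.
Qed.

(** This makes the infimum of the rate functional finite, so that it can be subtracted. *)
Lemma exists_finite_energy : exists mu : Meas R, P01 mu /\
  exists C : R, (Igen eta theta zeta kap c0 c1 mu <= C%:E)%E.
Proof.
have [mu [P muJ mub]] := uniform_measure.
have m01 := @measurable_I01 R; have f := P01_lty P.
have [C1 HC1] := lnt_powR_av P muJ theta0 mub.
have [C2 HC2] := lnt_powR_av P muJ eta0 mub.
pose C3 : R := - (c0 * ln (1 - (3 / 4) `^ zeta)) - c1 * ln 4^-1.
exists mu; split => //; exists (kap ^+ 2 / 2 * (C1 + C2) + C3).
rewrite leNgt; apply/negP => /(Igen_gt eta0 theta0 zeta0 kap0 c00 c10 P) [K].
rewrite ltNge => /negP; apply; rewrite /IK; apply: lerD.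
  apply: av_le_support => //.
    by apply: ucont01_bmeas => //; exact: ucont01_av_BK.
  move=> x x34; have x01 : 0 <= x <= 1 by move: x34 => /andP[? ?]; apply/andP; split; lra.
  have bl (p : R) : 0 < p -> bmeas I01 (fun y => - lnt K%:R `|x `^ p - y `^ p|).
    move=> p0; apply: ucont01_bmeas => //.
    apply: (@ucont01_lip _ (expR K%:R) _ (fun y => y `^ p)); last exact: ucont01_powR.
    move=> y z; rewrite -opprD normrN (le_trans (lnt_lip_norm _ _ _))// ler_wpM2l ?expR_ge0//.
    rewrite (le_trans (ler_dist_dist _ _))//.
    have -> : x `^ p - y `^ p - (x `^ p - z `^ p) = z `^ p - y `^ p by ring.
    by rewrite distrC.
  rewrite /BK avZ//; last exact: (bmeasD (bl _ theta0) (bl _ eta0)).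
  rewrite (avD m01 f (bl _ theta0) (bl _ eta0)) ler_wpM2l ?divr_ge0 ?sqr_ge0//.
  exact: (lerD (HC1 K x x34) (HC2 K x x34)).
apply: av_le_support => //.
  by apply: ucont01_bmeas => //; exact: ucont01_VK.
move=> x /andP[x1 x2]; rewrite /VK /C3.
have q1 : (3 / 4 : R) `^ zeta < 1.
  have : (3 / 4 : R) `^ zeta < 1 `^ zeta by rewrite gt0_ltr_powR ?nnegrE//; lra.
  by rewrite powR1.
have h1 : ln (1 - (3 / 4) `^ zeta) <= lnt K%:R (1 - x `^ zeta).
  apply: lnt_ge_ln; first by rewrite subr_gt0.
  by rewrite lerD2l lerN2 ge0_ler_powR ?nnegrE ?(ltW zeta0)//; lra.
have h2 : ln 4^-1 <= lnt K%:R x by apply: lnt_ge_ln; rewrite ?invr_gt0.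
by apply: lerD; rewrite lerN2 ler_wpM2l.
Qed.

End FiniteEnergy.

(** * Partition sum estimates *)

Section UpperBound.
Context {R : realType}.
Variables (eta theta zeta rho c nu tau kap alpha eps : R) (N M n at_ lo : nat) (t : int).
Local Notation L := (Lnum N M t).
Local Notation I01 := (`[0%R, 1%R]%classic : set R).
Hypotheses (eta0 : 0 < eta) (theta0 : 0 < theta) (zeta0 : 0 < zeta) (rho0 : 0 < rho).
Hypotheses (c_gt0 : 0 < c) (nu0 : 0 <= nu) (tau0 : 0 <= tau) (kap0 : 0 < kap) (eps0 : 0 < eps).
Hypotheses (LE : L%:R = kap * N%:R) (nE : n%:R = nu * N%:R) (atE : at_%:R = tau * N%:R).
Hypotheses (N0 : (0 < N)%N).
Hypothesis loE : M%:Z - L%:Z = lo%:Z.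
Hypothesis wE : weight eta theta alpha N M t eps =1 gweight eta theta zeta rho c eps L n at_ lo.

Local Notation BK := (BK eta theta kap).
Local Notation VK := (VK zeta (kap * nu) (kap * rho * tau)).
Local Notation IK := (IK eta theta zeta kap (kap * nu) (kap * rho * tau)).
Local Notation emp := (empirical N M t eps).
Local Notation wt := (weight eta theta alpha N M t eps).

Let N0R : 0 < N%:R :> R. Proof. by rewrite ltr0n. Qed.
Let L0 : (0 < L)%N. Proof. by rewrite -(ltr0n R) LE mulr_gt0. Qed.

Lemma StatesP s : States N M t s ->
  [/\ size s = L, sorted (fun a b : int => b < a) s & all (fun x => lo%:Z <= x) s].
Proof. by move=> [ss [srt al]]; split => //; rewrite -loE. Qed.

Lemma States_ge0 s i : States N M t s -> (i < L)%N -> 0 <= nth 0 s i.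
Proof.
move=> /StatesP[ss _ al] iL; apply: (@le_trans _ _ lo%:Z) => //.
by apply: (allP al); rewrite mem_nth// ss.
Qed.

Lemma empirical_IK K s : States N M t s ->
  IK K (emp s) = L%:R^-1 * (\sum_(i < L) (L%:R^-1 *
     \sum_(j < L) BK K (pos eps (nth 0 s i)) (pos eps (nth 0 s j)))) +
   L%:R^-1 * \sum_(i < L) VK K (pos eps (nth 0 s i)).
Proof.
move=> Ss; have s0 i := @States_ge0 s i Ss.
have P := empirical_P01 eps0 L0 s0; have f := P01_lty P; have m01 := @measurable_I01 R.
rewrite /IK (av_empirical eps0 L0 s0); last first.
  by apply: ucont01_bmeas => //; exact: ucont01_av_BK.
rewrite (av_empirical eps0 L0 s0); last first.
  by apply: ucont01_bmeas => //; exact: ucont01_VK.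
congr (_ * _ + _); apply: eq_bigr => i _.
have p01 : 0 <= pos eps (nth 0 s i) <= 1.
  by have /andP[/ltW -> ->] := pos01 eps0 (s0 i (ltn_ord i)).
by rewrite (av_empirical eps0 L0 s0 (bmeas_BK eta0 theta0 kap0 K p01)).
Qed.

Lemma weight_ge0 s : States N M t s -> 0 <= wt s.
Proof.
move=> /StatesP[ss srt al]; rewrite wE.
by have /andP[] := gweight_upper c eta0 theta0 zeta0 rho0 kap0 eps0 nE atE 0 ss srt al.
Qed.

(** As [L = kap * N], the factors [1 / kap ^+ 2] and [N / kap] turn the sums over particles into
    [N ^+ 2] times averages. *)
Lemma weight_le_IK K s : States N M t s ->
  wt s <= expR (- (N%:R ^+ 2 * IK K (emp s)) +
     L%:R * (K%:R + n%:R * (expR K%:R * (eps * zeta * (n%:R + 1))))) *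
   \prod_(x <- s) expR (- (c * eps * x%:~R)).
Proof.
move=> Ss; have [ss srt al] := StatesP Ss; rewrite wE.
have /andP[_ h] := gweight_upper c eta0 theta0 zeta0 rho0 kap0 eps0 nE atE K ss srt al.
apply: (le_trans h); rewrite mulrC (big_nth 0) big_mkord ss ler_wpM2r//.
  by apply: prodr_ge0 => i _; exact: expR_ge0.
rewrite ler_expR empirical_IK// -mulr_sumr.
set b := \sum_(i < L) _; set v := \sum_(i < L) VK _ _; set d := L%:R * _.
rewrite lerD2r LE le_eqVlt; apply/orP; left; apply/eqP.
have : kap != 0 by rewrite gt_eqF.
have : N%:R != 0 :> R by rewrite gt_eqF.
by move=> ? ?; field; apply/andP.
Qed.

(** From [z * exp(- z) <= 1 - exp(- z)]. With [z = c * eps], the term [- ln z], taken once per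
    particle, is the reason for requiring [ln eps = o(N)]. *)
Lemma inv_1subexp_le (z : R) : 0 < z -> (1 - expR (- z))^-1 <= expR (z - ln z).
Proof.
move=> z0; have z1 : 0 < 1 + z by rewrite addr_gt0.
have -> : expR (z - ln z) = expR z / z by rewrite expRD expRN lnK ?posrE.
have h : z * expR (- z) <= 1 - expR (- z).
  have h0 : (1 + z) * expR (- z) <= 1.
    apply: (@le_trans _ _ (expR z * expR (- z))).
      by rewrite ler_wpM2r ?expR_ge0 ?expR_ge1Dx.
    by rewrite expRxMexpNx_1.
  by rewrite lerBrDl; move: h0; rewrite mulrDl mul1r.
have p : 0 < z * expR (- z) by rewrite mulr_gt0 ?expR_gt0.
rewrite -[leRHS]invrK lef_pV2 ?posrE ?invr_gt0 ?divr_gt0 ?expR_gt0//.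
  by rewrite invfM invrK -expRN mulrC.
exact: lt_le_trans h.
Qed.

Lemma esum_weight_le K (c0 : R) (A : set (Meas R)) :
  (forall mu, A mu -> P01 mu -> c0 <= IK K mu) ->
  (\esum_(s in States N M t `&` [set s | A (emp s)]) (wt s)%:E <=
   (expR (- (N%:R ^+ 2 * c0) + L%:R * (K%:R + n%:R * (expR K%:R * (eps * zeta * (n%:R + 1))))
     + L%:R * (c * eps - ln (c * eps))))%:E)%E.
Proof.
move=> HA; set d := L%:R * (K%:R + _).
have ce : 0 < c * eps by rewrite mulr_gt0.
have C0 : 0 <= expR (- (N%:R ^+ 2 * c0) + d) by exact: expR_ge0.
apply: le_trans (esum_geometric_bound (w := wt) (L := L) ce C0 _) _ => [s [Ss As]|].
  have [ss srt al] := StatesP Ss; split => //.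
    by apply: sub_all al => x; exact: le_trans.
  rewrite weight_ge0//= (le_trans (weight_le_IK K Ss))// ler_wpM2r//.
    by apply: prodr_ge0 => i _; exact: expR_ge0.
  rewrite ler_expR lerD2r lerN2 ler_wpM2l ?sqr_ge0//; apply: HA => //.
  by apply: empirical_P01 => // i iL; exact: States_ge0.
rewrite lee_fin [leRHS]expRD ler_wpM2l ?expR_ge0// expRM_natl.
apply: lerXn2r; rewrite ?nnegrE ?expR_ge0 ?inv_1subexp_le//.
by rewrite invr_ge0 subr_ge0 expR_le1 oppr_le0 ltW.
Qed.

Lemma esum_weight_at_lty (A : set (Meas R)) :
  (\esum_(s in States N M t `&` [set s | A (emp s)]) (wt s)%:E < +oo)%E.
Proof.
apply: le_lt_trans (@esum_weight_le 0 0 A _) _; last by rewrite ltry.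
move=> mu _ Pmu; rewrite /IK addr_ge0//.
  by apply: av_ge0 => x /in_I01 x01; apply: av_ge0 => y /in_I01; exact: BK_ge0.
apply: av_ge0 => x /in_I01; apply: VK_ge0 => //; rewrite !mulr_ge0 ?(ltW kap0) ?(ltW rho0)//.
Qed.

End UpperBound.

(** * Measures of finite energy and their restrictions away from 0 *)

Section EnergySampling.
Context {R : realType}.
Variables (eta theta zeta kap c0 c1 : R).
Hypotheses (eta0 : 0 < eta) (theta0 : 0 < theta) (zeta0 : 0 < zeta).
Hypotheses (kap0 : 0 < kap) (c00 : 0 <= c0) (c10 : 0 <= c1).

Local Notation I01 := (`[0%R, 1%R]%classic : set R).
Local Notation BK := (BK eta theta kap).
Local Notation VK := (VK zeta c0 c1).
Local Notation IK := (IK eta theta zeta kap c0 c1).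

Lemma av_subset (mu : Meas R) (D : set R) (h : R -> R) : P01 mu -> measurable D ->
  D `<=` I01 -> bmeas I01 h -> (forall x, 0 <= x <= 1 -> 0 <= h x) ->
  av mu D h <= av mu I01 h.
Proof.
move=> P mD DI bh h0; have m01 := @measurable_I01 R; have f := P01_lty P.
have fD : (mu D < +oo)%E.
  by apply: le_lt_trans f; apply: le_measure; rewrite ?inE.
have bD : bmeas D h.
  have [mh [B hB]] := bh; split; first exact: measurable_funS mh.
  by exists B => x /DI; exact: hB.
rewrite -lee_fin !av_EFin//; apply: ge0_subset_integral => //.
by apply/measurable_EFinP; case: bh.
Qed.

Lemma BK_near0_ge (K : nat) (Y x y : R) : 0 <= Y -> (theta + eta) * Y <= K%:R ->
  0 <= x < expR (- Y) -> 0 <= y < expR (- Y) ->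
  kap ^+ 2 / 2 * ((theta + eta) * Y) <= BK K x y.
Proof.
move=> Y0 YK xY yY.
have H (p : R) : 0 < p -> p * Y <= K%:R -> p * Y <= - lnt K%:R `|x `^ p - y `^ p|.
  move=> p0 pK; rewrite lerNr.
  have e1 (z : R) : 0 <= z < expR (- Y) -> 0 <= z `^ p <= expR (- (p * Y)).
    move=> /andP[z0 zY]; rewrite powR_ge0/= -mulrN mulrC expRM.
    by rewrite ge0_ler_powR ?nnegrE ?expR_ge0 ?(ltW p0)// ltW.
  have r1 : `|x `^ p - y `^ p| <= expR (- (p * Y)).
    have /andP[? ?] := e1 _ xY; have /andP[? ?] := e1 _ yY.
    by rewrite ler_norml; apply/andP; split; lra.
  apply: le_trans (lnt_leK K%:R r1) _.
  by rewrite lntE ?expRK// ler_expR lerN2.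
have tY : 0 <= theta * Y by rewrite mulr_ge0 ?(ltW theta0).
have eY : 0 <= eta * Y by rewrite mulr_ge0 ?(ltW eta0).
rewrite mulrDl in YK *.
rewrite /BK ler_wpM2l ?divr_ge0 ?sqr_ge0//; apply: lerD; apply: H => //.
  by apply: le_trans YK; rewrite lerDl.
by apply: le_trans YK; rewrite lerDr.
Qed.

(** Any two points below [exp(- Y)] interact with strength at least of order [Y], so the energy is
    at least that strength times the squared mass of [0, delta). In particular, finite energy
    excludes an atom at 0. *)
Lemma mass_away_from0 (mu : Meas R) (C w : R) : P01 mu -> (forall K, IK K mu <= C) -> 0 < w ->
  exists2 delta, 0 < delta < 1 & 1 - w <= fine (mu `[delta, 1%R]%classic).
Proof.
move=> P HC w0; have m01 := @measurable_I01 R; have f := P01_lty P.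
have k2 : 0 < kap ^+ 2 / 2 * (theta + eta).
  by rewrite mulr_gt0 ?addr_gt0// divr_gt0// exprn_gt0.
(* Chosen so that the strength [b] below satisfies [b * w ^+ 2 > C]; [K] is then taken large enough
   not to truncate this interaction. *)
pose Y := `|C| / (kap ^+ 2 / 2 * (theta + eta) * w ^+ 2) + 1.
have Y0 : 0 < Y by rewrite ltr_wpDl// divr_ge0// mulr_ge0 ?sqr_ge0// ltW.
pose K := (Num.truncn ((theta + eta) * Y)).+1.
have YK : (theta + eta) * Y <= K%:R by rewrite ltW// truncnS_gt.
have [delta dE] : exists delta, delta = expR (- Y) by exists (expR (- Y)).
have d1 : 0 < delta < 1 by rewrite dE expR_gt0 expR_lt1 oppr_lt0.
exists delta => //; have /andP[d0 dlt] := d1.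
pose A : set R := `[0%R, delta[%classic.
have mA : measurable A by exact: measurable_itv.
have AI : A `<=` I01.
  by move=> x; rewrite /A /= !in_itv /= => /andP[? ?]; apply/andP; split; lra.
have fA : (mu A < +oo)%E by apply: le_lt_trans f; apply: le_measure; rewrite ?inE.
have fB : (mu `[delta, 1%R]%classic < +oo)%E.
  apply: le_lt_trans f; apply: le_measure; rewrite ?inE//.
  by move=> x; rewrite /= !in_itv /= => /andP[? ?]; apply/andP; split; lra.
have split1 : fine (mu A) + fine (mu `[delta, 1%R]%classic) = 1.
  rewrite -fineD ?ge0_fin_numE// -measureU//; last first.
    by apply/seteqP; split=> x //= []; rewrite /A /= !in_itv /= => /andP[? ?] /andP[? ?]; lra.
  rewrite -[RHS](P01_fine P); congr (fine (mu _)).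
  apply/seteqP; split=> x /=.
    rewrite /A /= !in_itv /= => -[/andP[h1 h2]|/andP[h1 h2]].
      by rewrite h1 ltW// (lt_trans h2).
    by rewrite h2 andbT ltW// (lt_le_trans d0).
  rewrite /A /= !in_itv /= => /andP[x0 x1]; rewrite x0 x1/= andbT.
  by case: (ltP x delta) => h; [left|right].
rewrite lerBlDr addrC -[leLHS]split1 lerD2r leNgt; apply/negP => wA.
pose b := kap ^+ 2 / 2 * ((theta + eta) * Y).
have b0 : 0 <= b by rewrite /b mulrA mulr_ge0 ?(ltW k2) ?(ltW Y0).
have bi : bmeas I01 (\1_A : R -> R).
  split; first exact: measurable_indic.
  by exists 1 => x _; rewrite indicE; case: (_ \in _); rewrite ?normr1 ?normr0.
have avA : av mu I01 (\1_A) = fine (mu A).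
  by rewrite /av integral_indic// setIidl.
have bA : bmeas I01 (fun x => av mu I01 (BK K x)).
  by apply: ucont01_bmeas => //; exact: ucont01_av_BK.
have : b * fine (mu A) ^+ 2 <= C.
  apply: le_trans (HC K).
  have -> : b * fine (mu A) ^+ 2 = av mu I01 (fun x => (b * fine (mu A)) * \1_A x).
    by rewrite avZ// avA expr2 mulrA.
  rewrite /IK -[leLHS]addr0 lerD//; last first.
    by apply: av_ge0 => x /in_I01; exact: VK_ge0.
  apply: (av_le m01 f (bmeasZ _ bi) bA) => x xI; have x01 := in_I01 xI.
  have bx := bmeas_BK eta0 theta0 kap0 K x01.
  rewrite indicE; case: (boolP (x \in A)) => [|_]; last first.
    by rewrite mulr0; apply: av_ge0 => y /in_I01; exact: BK_ge0.
  rewrite inE /A /= in_itv /= => xA; rewrite mulr1 -avA -avZ//.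
  apply: (av_le m01 f (bmeasZ _ bi) bx) => y yI; have y01 := in_I01 yI.
  rewrite indicE; case: (boolP (y \in A)) => [|_]; last by rewrite mulr0; exact: BK_ge0.
  by rewrite inE /A /= in_itv /= => yA; rewrite mulr1; apply: (@BK_near0_ge K Y) => //; rewrite -?dE// ltW.
apply/negP; rewrite -ltNge; apply: (@lt_le_trans _ _ (b * w ^+ 2)); last first.
  by apply: ler_wpM2l => //; apply: lerXn2r; rewrite ?nnegrE ?fine_ge0 ?(ltW w0) ?(ltW wA).
rewrite /b mulrA /Y.
have w2 : 0 < kap ^+ 2 / 2 * (theta + eta) * w ^+ 2 by rewrite mulr_gt0// exprn_gt0.
rewrite mulrAC mulrDr mulr1 mulrCA divff ?gt_eqF// mulr1.
by rewrite (le_lt_trans (ler_norm _))// ltrDl.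
Qed.

Variables (mu : Meas R) (delta : R).
Local Notation D := (`[delta, 1%R]%classic : set R).
Local Notation m := (fine (mu D)).
Hypotheses (P : P01 mu) (d01 : 0 < delta < 1) (m0 : 0 < m).

Let m01 := @measurable_I01 R.
Let f := P01_lty P.
Let DI : D `<=` I01.
Proof. by have /andP[? ?] := d01; move=> x; rewrite /= !in_itv /= => /andP[? ?]; apply/andP; split; lra. Qed.
Let mD : measurable D. Proof. exact: measurable_itv. Qed.
Let fD : (mu D < +oo)%E.
Proof. by apply: le_lt_trans f; apply: le_measure; rewrite ?inE. Qed.

Lemma mass_le1 : m <= 1.
Proof.
rewrite -[leRHS](P01_fine P); apply: fine_le; rewrite ?ge0_fin_numE//.
by apply: le_measure; rewrite ?inE.
Qed.

Lemma ucont01_bmeasD h : ucont01 h -> bmeas D h.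
Proof. by move=> uh; apply: ucont01_bmeas. Qed.

Lemma mean_norm_le (h : R -> R) (B : R) : ucont01 h ->
  (forall x, 0 <= x <= 1 -> `|h x| <= B) -> `|mean mu D h| <= B.
Proof.
move=> uh hB; rewrite /mean normrM [`|_^-1|]gtr0_norm ?invr_gt0// ler_pdivrMr//.
by apply: av_norm_le => //; [exact: ucont01_bmeasD|move=> x /DI/in_I01; exact: hB].
Qed.

(** The functions [B + h] and [B - h] are nonnegative, so their integrals decrease on restriction to
    [D]; this accounts for one [B * (1 - m)] and the normalisation by [m] for the other. *)
Lemma mean_close (h : R -> R) (B : R) : ucont01 h ->
  (forall x, 0 <= x <= 1 -> `|h x| <= B) ->
  `|mean mu D h - av mu I01 h| <= 2 * B * (1 - m).
Proof.
move=> uh hB.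
have bh : bmeas I01 h by apply: ucont01_bmeas.
have bB (E : set R) c : bmeas E (fun=> c : R) by exact: bmeas_cst.
pose g1 x := B + h x; pose g2 x := B - h x.
have u1 : ucont01 g1 by apply: ucont01D => //; exact: ucont01_cst.
have u2 : ucont01 g2.
  have := ucont01D (ucont01_cst B) (ucont01Z (-1) uh).
  by under eq_fun do rewrite mulN1r.
have p1 x : 0 <= x <= 1 -> 0 <= g1 x.
  by move=> /hB; rewrite ler_norml => /andP[? _]; rewrite /g1 -lerBlDl sub0r.
have p2 x : 0 <= x <= 1 -> 0 <= g2 x.
  by move=> /hB; rewrite ler_norml => /andP[_ ?]; rewrite subr_ge0.
have s1 : av mu D g1 <= av mu I01 g1 by apply: av_subset => //; exact: ucont01_bmeas.
have s2 : av mu D g2 <= av mu I01 g2 by apply: av_subset => //; exact: ucont01_bmeas.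
have e1 E : measurable E -> (mu E < +oo)%E -> E `<=` I01 -> av mu E g1 = B * fine (mu E) + av mu E h.
  by move=> mE fE EI; rewrite avD// ?av_cst//; exact: ucont01_bmeas.
have e2 E : measurable E -> (mu E < +oo)%E -> E `<=` I01 -> av mu E g2 = B * fine (mu E) - av mu E h.
  by move=> mE fE EI; rewrite avB// ?av_cst//; exact: ucont01_bmeas.
rewrite !e1// in s1; rewrite !e2// in s2; rewrite P01_fine// mulr1 in s1 s2.
have hm := mean_norm_le uh hB; have m1 := mass_le1.
have eA : av mu D h = mean mu D h * m by rewrite /mean divfK// gt_eqF.
rewrite eA in s1 s2; move: s1 s2 hm m1.
move: (mean mu D h) (av mu I01 h) m m0 => a b m' m'0.
rewrite !ler_norml => s1 s2 /andP[h3 h4] m1; apply/andP; split; nra.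
Qed.

End EnergySampling.

Lemma sample_cost_le {R : realFieldType} (l a b c p q : R) :
  l * a <= l * (c + l * q) -> l ^+ 2 * (p + q) <= l ^+ 2 * b -> 0 <= l * p ->
  l * (l - 1) * p + l * a <= l ^+ 2 * b + l * c.
Proof. by move=> ? ? ?; lra. Qed.

Section EnergySample.
Context {R : realType}.
Variables (eta theta zeta kap c0 c1 : R).
Hypotheses (eta0 : 0 < eta) (theta0 : 0 < theta) (zeta0 : 0 < zeta).
Hypotheses (kap0 : 0 < kap) (c00 : 0 <= c0) (c10 : 0 <= c1).

Local Notation I01 := (`[0%R, 1%R]%classic : set R).
Local Notation BK := (BK eta theta kap).
Local Notation VK := (VK zeta c0 c1).
Local Notation IK := (IK eta theta zeta kap c0 c1).
Variables (mu : Meas R) (delta : R).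
Local Notation D := (`[delta, 1%R]%classic : set R).
Local Notation m := (fine (mu D)).
Hypotheses (P : P01 mu) (d01 : 0 < delta < 1) (m0 : 0 < m).
Variables (n0 : nat) (fs : 'I_n0 -> R -> R) (Bf Lam : R) (L K : nat).
Hypotheses (ufs : forall j, ucont01 (fs j)) (Bf0 : 0 <= Bf) (Lam0 : 0 <= Lam).
Hypothesis (fsB : forall j x, 0 <= x <= 1 -> `|fs j x| <= Bf).

Let m01 := @measurable_I01 R.
Let f := P01_lty P.
Let DI : D `<=` I01.
Proof. by have /andP[? ?] := d01; move=> x; rewrite /= !in_itv /= => /andP[? ?]; apply/andP; split; lra. Qed.
Let mD : measurable D. Proof. exact: measurable_itv. Qed.
Let fD : (mu D < +oo)%E.
Proof. by apply: le_lt_trans f; apply: le_measure; rewrite ?inE. Qed.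

Let ft j x : R := fs j x - mean mu D (fs j).

Let uft j : ucont01 (ft j).
Proof.
apply: (ucont01D (ufs j)); exact: (ucont01_cst (- mean mu D (fs j))).
Qed.

Let bD (h : R -> R) : ucont01 h -> bmeas D h.
Proof. by move=> uh; apply: ucont01_bmeas. Qed.

Let mean_ft j : mean mu D (ft j) = 0.
Proof.
have -> : mean mu D (ft j) = mean mu D (fs j) + mean mu D (fun=> - mean mu D (fs j)).
  by apply: (meanD mD fD (bD (ufs j))); exact: bmeas_cst.
by rewrite (mean_cst mD m0) subrr.
Qed.

Let mean_ge0 (h : R -> R) : (forall x, D x -> 0 <= h x) -> 0 <= mean mu D h.
Proof. by move=> h0; apply: divr_ge0; [exact: av_ge0|exact: ltW]. Qed.

(** Summed over all pairs, the second term of [W] is the penalty, [Lam] times the squared sums of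
    the centred test functions; its mean in either variable vanishes, so only its diagonal
    contributes to the expected cost. [U] scales the external field by [L] and removes the
    self-interaction [kap ^+ 2 * K], which would not be bounded uniformly in [K]. *)
Let W x y : R := BK K x y + Lam * \sum_(j < n0) ft j x * ft j y.
Let U x : R := L%:R * VK K x - BK K x x.

Let D01 x : D x -> 0 <= x <= 1. Proof. by move=> /DI/in_I01. Qed.

Let bB x : D x -> bmeas D (BK K x).
Proof. by move=> Dx; apply: bD; apply: ucont01_BK => //; exact: D01. Qed.

Let bS x : bmeas D (fun y => \sum_(j < n0) ft j x * ft j y).
Proof. by apply: bmeas_sum => j; apply: bmeasZ; exact: bD. Qed.

Let bW x : D x -> bmeas D (W x).
Proof. by move=> Dx; apply: bmeasD; [exact: bB|apply: bmeasZ; exact: bS]. Qed.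

Let mean_W x : D x -> mean mu D (W x) = mean mu D (BK K x).
Proof.
move=> Dx; have -> : mean mu D (W x) = mean mu D (BK K x) +
    mean mu D (fun y => Lam * \sum_(j < n0) ft j x * ft j y).
  by apply: (meanD mD fD (bB Dx)); apply: bmeasZ; exact: bS.
rewrite (meanZ mD fD _ (bS x)).
have bj j : bmeas D (fun y => ft j x * ft j y) by apply: bmeasZ; exact: bD.
rewrite (mean_sum mD fD _ bj).
rewrite big1 ?mulr0 ?addr0// => j _.
by rewrite (meanZ mD fD _ (bD (uft j))) mean_ft mulr0.
Qed.

Let bg0 : bmeas D (fun x => mean mu D (BK K x)).
Proof.
have := bmeasZ (fine (mu D))^-1 (bD (ucont01_av_BK eta0 theta0 kap0 K DI mD fD)).
by congr bmeas; apply/funext => x; rewrite /mean mulrC.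
Qed.

Let bg : bmeas D (fun x => mean mu D (W x)).
Proof.
have [mg [B hB]] := bg0; split.
  by apply: eq_measurable_fun mg => x; rewrite inE => Dx; rewrite mean_W.
by exists B => x Dx; rewrite mean_W//; exact: hB.
Qed.

Let VE x : W x x + U x = Lam * (\sum_(j < n0) ft j x ^+ 2) + L%:R * VK K x.
Proof.
rewrite /W /U; under eq_bigr do rewrite -expr2.
by move: (BK K x x) => b; ring.
Qed.

Let bsq : bmeas D (fun x => \sum_(j < n0) ft j x ^+ 2).
Proof.
have -> : (fun x => \sum_(j < n0) ft j x ^+ 2) = (fun x => \sum_(j < n0) ft j x * ft j x).
  by apply/funext => x; apply: eq_bigr => j _; rewrite expr2.
by apply: bmeas_sum => j; apply: bmeasM; exact: bD.
Qed.

Let bVK : bmeas D (VK K). Proof. by apply: bD; exact: ucont01_VK. Qed.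

Let bV : bmeas D (fun x => W x x + U x).
Proof.
have := bmeasD (bmeasZ Lam bsq) (bmeasZ L%:R bVK).
by congr bmeas; apply/funext => x; rewrite VE.
Qed.

Let ft_le j x : D x -> ft j x ^+ 2 <= (2 * Bf) ^+ 2.
Proof.
move=> /D01 x01; rewrite -real_normK ?num_real//.
apply: lerXn2r; rewrite ?nnegrE ?mulr_ge0//.
rewrite (le_trans (ler_normB _ _))//.
have -> : 2 * Bf = Bf + Bf by ring.
apply: lerD; first exact: fsB.
exact: (mean_norm_le P d01 m0 (ufs j) (fsB j)).
Qed.

Let mean_le_av (h : R -> R) : bmeas I01 h -> (forall x, 0 <= x <= 1 -> 0 <= h x) ->
  mean mu D h <= av mu I01 h / m.
Proof. by move=> bh h0; rewrite /mean ler_pM2r ?invr_gt0//; apply: av_subset. Qed.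

(** All integrands are nonnegative, so replacing [mu] by its normalised restriction to [D] costs a
    factor [1 / m] for each averaging, two in the interaction. *)
Let mean_BK : mean mu D (fun x => mean mu D (BK K x)) + mean mu D (VK K) <= IK K mu / m ^+ 2.
Proof.
have m1 := mass_le1 P d01.
rewrite /IK mulrDl; apply: lerD; last first.
  apply: le_trans (mean_le_av _ _) _.
  - by apply: ucont01_bmeas => //; exact: ucont01_VK.
  - by move=> x; exact: VK_ge0.
  rewrite ler_wpM2l//; first by apply: av_ge0 => x /in_I01; exact: VK_ge0.
  by rewrite lef_pV2 ?posrE ?exprn_gt0// expr2 ler_piMl// ltW.
have bI : bmeas I01 (fun x => av mu I01 (BK K x)).
  by apply: ucont01_bmeas => //; exact: ucont01_av_BK.
have bI' : bmeas I01 (fun x => m^-1 * av mu I01 (BK K x)) by exact: bmeasZ.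
have bID : bmeas D (fun x => m^-1 * av mu I01 (BK K x)).
  by apply: bmeasZ; apply: bD; exact: ucont01_av_BK.
apply: (@le_trans _ _ (mean mu D (fun x => m^-1 * av mu I01 (BK K x)))).
  rewrite /mean ler_pM2r ?invr_gt0//; apply: (av_le mD fD bg0 bID) => x Dx.
  rewrite mulrC; apply: mean_le_av; first exact: (bmeas_BK eta0 theta0 kap0 K (D01 Dx)).
  by move=> y; apply: BK_ge0 => //; exact: D01.
apply: le_trans (mean_le_av bI' _) _.
  move=> x x01; rewrite mulr_ge0 ?invr_ge0 ?(ltW m0)//.
  by apply: av_ge0 => y /in_I01; exact: BK_ge0.
by rewrite (avZ m01 f _ bI) expr2 invfM mulrA [X in X / m]mulrC.
Qed.

(** For a given bound [C], the right-hand side does not involve [K], so [K] may later be chosen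
    depending on it. *)
Lemma energy_sample (C : R) : IK K mu <= C ->
  exists xs : seq R, [/\ size xs = L, sorted <=%R xs,
    forall i, (i < L)%N -> delta <= nth 0 xs i <= 1 &
    \sum_(i < L) \sum_(j < L) BK K (nth 0 xs i) (nth 0 xs j) -
      \sum_(i < L) BK K (nth 0 xs i) (nth 0 xs i) + L%:R * \sum_(i < L) VK K (nth 0 xs i) +
      Lam * \sum_(j < n0) (\sum_(i < L) fs j (nth 0 xs i) - L%:R * mean mu D (fs j)) ^+ 2 <=
    L%:R ^+ 2 * (C / m ^+ 2) + L%:R * (Lam * (n0%:R * (2 * Bf) ^+ 2))].
Proof.
move=> IC.
have Wsym x y : W x y = W y x.
  by rewrite /W BK_sym; congr (_ + Lam * _); apply: eq_bigr => j _; rewrite mulrC.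
have [s [ss sD cs]] := sample mD fD m0 Wsym bW bg bV L.
pose xs := sort <=%R s.
have ps : perm_eq xs s by rewrite perm_sort.
have sxs : size xs = L by rewrite size_sort.
exists xs; split => //.
- exact/sort_sorted/le_total.
- move=> i iL; have : nth 0 xs i \in s by rewrite -(perm_mem ps) mem_nth// sxs.
  by move=> /sD; rewrite /= in_itv.
have EM : mean mu D (fun x => mean mu D (W x)) = mean mu D (fun x => mean mu D (BK K x)).
  exact: (congr1 (fun z => z / m) (eq_av mu mean_W)).
have EV : mean mu D (fun x => W x x + U x) <=
    Lam * (n0%:R * (2 * Bf) ^+ 2) + L%:R * mean mu D (VK K).
  have -> : mean mu D (fun x => W x x + U x) =
      mean mu D (fun x => Lam * (\sum_(j < n0) ft j x ^+ 2) + L%:R * VK K x).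
    by congr (mean mu D _); apply/funext => x; rewrite VE.
  rewrite (meanD mD fD (bmeasZ Lam bsq) (bmeasZ L%:R bVK)) (meanZ mD fD _ bsq).
  rewrite (meanZ mD fD _ bVK) lerD2r; apply: (ler_wpM2l Lam0).
  rewrite -(mean_cst mD m0 (n0%:R * (2 * Bf) ^+ 2)) /mean.
  have mi : 0 <= m^-1 by rewrite invr_ge0 ltW.
  apply: (ler_wpM2r mi).
  apply: (av_le mD fD bsq (bmeas_cst _ _)) => x Dx.
  rewrite mulr_natl -[X in _ *+ X]card_ord -sumr_const.
  by apply: ler_sum => j _; exact: ft_le.
have mB0 : 0 <= mean mu D (fun x => mean mu D (BK K x)).
  apply: mean_ge0 => x Dx; apply: mean_ge0 => y Dy.
  exact: (BK_ge0 eta0 theta0 kap0 K (D01 Dx) (D01 Dy)).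
have cost_le : pair_cost W U s <= L%:R ^+ 2 * (C / m ^+ 2) + L%:R * (Lam * (n0%:R * (2 * Bf) ^+ 2)).
  apply: (le_trans cs); rewrite EM.
  have h1 := ler_wpM2l (ler0n R L) EV.
  have h2 : L%:R ^+ 2 * (mean mu D (fun x => mean mu D (BK K x)) + mean mu D (VK K)) <=
      L%:R ^+ 2 * (C / m ^+ 2).
    apply: (ler_wpM2l (sqr_ge0 _)); apply: (le_trans mean_BK).
    by apply: ler_wpM2r; [rewrite invr_ge0 sqr_ge0|exact: IC].
  have h3 : 0 <= L%:R * mean mu D (fun x => mean mu D (BK K x)) by rewrite mulr_ge0.
  move: h1 h2 h3; move: (mean mu D (fun x => mean mu D (BK K x))) (mean mu D (VK K)).
  move: (mean mu D (fun x => W x x + U x)) (C / m ^+ 2) (Lam * _) => a b c p q.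
  exact: sample_cost_le.
apply: le_trans cost_le; rewrite /pair_cost.
have big_s (h : R -> R) : \sum_(x <- s) h x = \sum_(i < L) h (nth 0 xs i).
  by rewrite -(perm_big _ ps) (big_nth 0) big_mkord sxs.
have -> : \sum_(x <- s) \sum_(y <- s) W x y =
    \sum_(i < L) \sum_(j < L) BK K (nth 0 xs i) (nth 0 xs j) +
    Lam * \sum_(j < n0) (\sum_(i < L) fs j (nth 0 xs i) - L%:R * mean mu D (fs j)) ^+ 2.
  have E1 j : \sum_(i < L) fs j (nth 0 xs i) - L%:R * mean mu D (fs j) = \sum_(x <- s) ft j x.
    rewrite big_s sumrB; congr (_ - _).
    by rewrite sumr_const card_ord mulr_natl.
  have -> : \sum_(j < n0) (\sum_(i < L) fs j (nth 0 xs i) - L%:R * mean mu D (fs j)) ^+ 2 =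
      \sum_(j < n0) (\sum_(x <- s) ft j x) ^+ 2 by apply: eq_bigr => j _; rewrite E1.
  have -> : \sum_(i < L) \sum_(j < L) BK K (nth 0 xs i) (nth 0 xs j) =
      \sum_(x <- s) \sum_(y <- s) BK K x y.
    by rewrite big_s; apply: eq_bigr => i _; rewrite big_s.
  have E2 x : \sum_(y <- s) W x y =
      \sum_(y <- s) BK K x y + Lam * (\sum_(j < n0) ft j x * \sum_(y <- s) ft j y).
    rewrite /W [LHS]big_split /=; congr (_ + _).
    rewrite -[LHS]mulr_sumr exchange_big /=; congr (Lam * _).
    by apply: eq_bigr => j _; rewrite mulr_sumr.
  rewrite (eq_bigr _ (fun x _ => E2 x)) [LHS]big_split /=; congr (_ + _).
  rewrite -[LHS]mulr_sumr exchange_big /=; congr (Lam * _).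
  by apply: eq_bigr => j _; rewrite expr2 -mulr_suml.
have -> : \sum_(x <- s) U x = L%:R * (\sum_(i < L) VK K (nth 0 xs i)) -
    \sum_(i < L) BK K (nth 0 xs i) (nth 0 xs i).
  rewrite -(big_s (VK K)) -(big_s (fun x => BK K x x)) /U sumrB; congr (_ - _).
  by rewrite mulr_sumr.
set A := \sum_(i < L) \sum_(j < L) _; set B2 := \sum_(i < L) BK _ _ _.
set B1 := \sum_(i < L) _; set Q := \sum_(j < n0) _.
rewrite le_eqVlt; apply/orP; left; apply/eqP; ring.
Qed.

End EnergySample.

Lemma exists_nat_gt {R : realType} (a b c : R) :
  exists K : nat, [/\ a < K%:R, b < K%:R & c < K%:R].
Proof.
exists (Num.truncn (`|a| + `|b| + `|c|)).+1.
have h := truncnS_gt (`|a| + `|b| + `|c|).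
have ha := normr_ge0 a; have hb := normr_ge0 b; have hc := normr_ge0 c.
split; apply: le_lt_trans h; apply: le_trans (ler_norm _) _.
- by rewrite -addrA lerDl addr_ge0.
- by rewrite addrAC lerDr addr_ge0.
- by rewrite lerDr addr_ge0.
Qed.

Section LowerBound.
Context {R : realType}.
Variables (eta theta zeta rho c nu tau kap alpha eps : R) (N M n at_ lo : nat) (t : int).
Local Notation L := (Lnum N M t).
Local Notation I01 := (`[0%R, 1%R]%classic : set R).
Hypotheses (eta0 : 0 < eta) (theta0 : 0 < theta) (zeta0 : 0 < zeta) (rho0 : 0 < rho).
Hypotheses (c_gt0 : 0 < c) (nu0 : 0 <= nu) (tau0 : 0 <= tau) (kap0 : 0 < kap) (eps0 : 0 < eps).
Hypotheses (LE : L%:R = kap * N%:R) (nE : n%:R = nu * N%:R) (atE : at_%:R = tau * N%:R).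
Hypotheses (N0 : (0 < N)%N) (LN : (L + lo <= 2 * N)%N).
Hypothesis loE : M%:Z - L%:Z = lo%:Z.
Hypothesis wE : weight eta theta alpha N M t eps =1 gweight eta theta zeta rho c eps L n at_ lo.

Local Notation IK := (IK eta theta zeta kap (kap * nu) (kap * rho * tau)).
Local Notation emp := (empirical N M t eps).
Local Notation wt := (weight eta theta alpha N M t eps).

Variables (mu : Meas R) (delta C : R).
Local Notation D := (`[delta, 1%R]%classic : set R).
Local Notation m := (fine (mu D)).
Hypotheses (P : P01 mu) (d01 : 0 < delta < 1) (m0 : 0 < m).
Hypothesis IC : forall K, IK K mu <= C.
Variables (n0 : nat) (fs : 'I_n0 -> R -> R) (Bf Lam w : R).
Hypotheses (ufs : forall j, ucont01 (fs j)) (Bf0 : 0 <= Bf) (Lam0 : 0 < Lam).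
Hypothesis (fsB : forall j x, 0 <= x <= 1 -> `|fs j x| <= Bf).
Hypothesis fsw : forall j x y, 0 <= x <= 1 -> 0 <= y <= 1 -> `|x - y| <= 2 * N%:R * eps ->
  `|fs j x - fs j y| <= w.

Let N0R : 0 < N%:R :> R. Proof. by rewrite ltr0n. Qed.
Let L0 : (0 < L)%N. Proof. by rewrite -(ltr0n R) LE mulr_gt0. Qed.
Let L0R : 0 < L%:R :> R. Proof. by rewrite ltr0n. Qed.

Lemma exists_good_state : exists s, [/\ States N M t s,
  expR (- (N%:R ^+ 2 * (C / m ^+ 2) + N%:R * (Lam * (n0%:R * (2 * Bf) ^+ 2)) / kap) -
   (L%:R ^+ 2 * (2 * N%:R * eps * (eta + theta)) +
    L%:R * (c * (2 * N%:R * eps - ln delta) + 2 * N%:R * eps * rho * at_%:R))) <= wt s &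
  forall j, exists2 a : R, `|av (emp s) I01 (fs j) - a| <= w &
    (a - mean mu D (fs j)) ^+ 2 <= C / m ^+ 2 / Lam + n0%:R * (2 * Bf) ^+ 2 / L%:R].
Proof.
have /andP[dl0 dl1] := d01.
set B0 := n0%:R * (2 * Bf) ^+ 2.
pose T := L%:R ^+ 2 * (C / m ^+ 2) + L%:R * (Lam * B0).
(* [K] is chosen after the cost bound [T], large enough to leave every logarithm at the sampled
   points untruncated. If [nu = 0] the second quotient is 0 by convention, and that case is settled
   by [n = 0]. *)
have [K [K1 K2 K3]] := exists_nat_gt (T / kap ^+ 2) (T / (kap * nu)) (- ln delta).
have c00 : 0 <= kap * nu by rewrite mulr_ge0 ?(ltW kap0).
have c10 : 0 <= kap * rho * tau by rewrite !mulr_ge0 ?(ltW kap0) ?(ltW rho0).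
have [xs [sxs srt xsD H]] := energy_sample eta0 theta0 zeta0 kap0 c00 c10 P d01 m0
  L ufs Bf0 (ltW Lam0) fsB (IC K).
rewrite -/B0 -/T in H.
set X := _ - _ + _ in H; set Q := \sum_(j < n0) _ in H.
have Q0 : 0 <= Lam * Q by rewrite mulr_ge0 ?(ltW Lam0)//; apply: sumr_ge0 => j _; exact: sqr_ge0.
have XT : X <= T by rewrite (le_trans _ H)// lerDl.
have x01 k : (k < L)%N -> 0 <= nth 0 xs k <= 1.
  by move=> /xsD/andP[h ->]; rewrite (le_trans _ h)// ltW.
have X0 : 0 <= X.
  rewrite /X addr_ge0//; last first.
    rewrite mulr_ge0//; apply: sumr_ge0 => i _.
    exact: (VK_ge0 zeta0 c00 c10 K (x01 _ (ltn_ord i))).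
  rewrite -sumrB; apply: sumr_ge0 => i _; rewrite (bigD1 i)//= addrAC subrr add0r.
  apply: sumr_ge0 => j _.
  exact: (BK_ge0 eta0 theta0 kap0 K (x01 _ (ltn_ord i)) (x01 _ (ltn_ord j))).
have Kd : expR (- K%:R) <= delta.
  by rewrite -[leRHS](lnK (x := delta)) ?posrE// ler_expR lerNl ltW.
have TK : T < kap ^+ 2 * K%:R by rewrite mulrC -ltr_pdivrMr ?exprn_gt0.
have Tn : n = 0%N \/ T < kap * nu * K%:R.
  have [nu00|nu_neq] := eqVneq nu 0.
    by left; apply/eqP; rewrite -(eqr_nat R) nE nu00 mul0r.
  right; rewrite mulrC -ltr_pdivrMr// mulr_gt0// lt_neqAle eq_sym nu_neq//.
have wl := gweight_lower eta0 theta0 zeta0 rho0 c_gt0 nu0 tau0 kap0 eps0 LE nE atE LN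
  dl0 srt sxs xsD Kd XT TK Tn.
have [rs1 rs2 rs3] := rounded_state lo eps0 dl0 srt sxs xsD.
have SS : States N M t (rounded eps L lo xs).
  by split => //; split => //; rewrite loE.
have s0 i : (i < L)%N -> 0 <= nth 0 (rounded eps L lo xs) i by exact: (States_ge0 loE SS).
exists (rounded eps L lo xs); split => //.
  rewrite wE; apply: le_trans wl; rewrite ler_expR lerD2r lerN2 /T.
  rewrite le_eqVlt; apply/orP; left; apply/eqP; rewrite LE.
  have k00 : kap != 0 by rewrite gt_eqF.
  by move: (C / m ^+ 2) (Lam * B0) => a b; field.
(* The witness is the average over the sampled points before rounding; [w] accounts for the
   rounding. *)
move=> j; exists (L%:R^-1 * \sum_(i < L) fs j (nth 0 xs i)).
  rewrite (av_empirical eps0 L0 s0); last exact: ucont01_bmeas (ufs j).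
  rewrite -mulrBr -sumrB normrM gtr0_norm ?invr_gt0//.
  rewrite ler_pdivrMl//; apply: (le_trans (ler_norm_sum _ _ _)).
  have -> : L%:R * w = \sum_(i < L) w by rewrite sumr_const card_ord mulr_natl.
  apply: ler_sum => i _; rewrite nth_mkseq//; apply: fsw; last exact: round_close xsD _ (ltn_ord i).
    by have := s0 i (ltn_ord i); rewrite nth_mkseq// => /(pos01 eps0)/andP[/ltW -> ->].
  exact: x01.
(* The energy part [X] is nonnegative, so the penalty alone is bounded by [T], and so is each of its
   summands. *)
have Qj : (\sum_(i < L) fs j (nth 0 xs i) - L%:R * mean mu D (fs j)) ^+ 2 <= T / Lam.
  rewrite ler_pdivlMr// mulrC.
  apply: (@le_trans _ _ (Lam * Q)); last by rewrite (le_trans _ H)// lerDr.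
  apply: (ler_wpM2l (ltW Lam0)).
  apply: (@le_sum1 _ _ xpredT (fun j => (\sum_(i < L) fs j (nth 0 xs i) - L%:R * mean mu D (fs j)) ^+ 2)) => //.
  by move=> j' _; exact: sqr_ge0.
have -> : L%:R^-1 * \sum_(i < L) fs j (nth 0 xs i) - mean mu D (fs j) =
   L%:R^-1 * (\sum_(i < L) fs j (nth 0 xs i) - L%:R * mean mu D (fs j)).
  by rewrite mulrBr mulKf// gt_eqF.
rewrite exprMn.
apply: (@le_trans _ _ (L%:R^-1 ^+ 2 * (T / Lam))).
  by apply: (ler_wpM2l _ Qj); rewrite exprn_ge0// invr_ge0 ltW.
rewrite le_eqVlt; apply/orP; left; apply/eqP; rewrite /T.
have l0 : L%:R != 0 :> R by rewrite gt_eqF.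
have lam0 : Lam != 0 by rewrite gt_eqF.
by move: (C / m ^+ 2) => a; field; apply/andP.
Qed.

End LowerBound.

Lemma mass_inv_sq_le {R : realFieldType} (m w : R) : 0 <= w -> w <= 2^-1 -> 1 - w <= m ->
  (m ^+ 2)^-1 <= 1 + 6 * w.
Proof.
move=> w0 w1 wm.
have h : 0 < 1 - w by lra.
have m0 : 0 < m by lra.
apply: (@le_trans _ _ ((1 - w) ^+ 2)^-1).
  rewrite lef_pV2 ?posrE ?exprn_gt0//; by apply: lerXn2r; rewrite ?nnegrE ?(ltW h) ?(ltW m0).
rewrite -[leRHS]mul1r -[leLHS]mul1r ler_pdivrMr ?exprn_gt0// mul1r.
(* This is [(1 + 6 * w) * (1 - w) ^+ 2 - 1] in factored form. *)
have : 0 <= w * ((4 - 3 * w) * (1 - 2 * w)) by rewrite !mulr_ge0//; lra.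
by rewrite expr2; lra.
Qed.

(** * Partition sums as N tends to infinity *)

Section Asymptotics.
Context {R : realType}.
Variables (eta theta zeta rho c nu tau kap alpha : R).
Variables (Ns Ms ns ats los : nat -> nat) (ts : nat -> int) (eps : nat -> R).
Local Notation Ls k := (Lnum (Ns k) (Ms k) (ts k)).
Hypotheses (eta0 : 0 < eta) (theta0 : 0 < theta) (zeta0 : 0 < zeta) (rho0 : 0 < rho).
Hypotheses (c_gt0 : 0 < c) (nu0 : 0 <= nu) (tau0 : 0 <= tau) (kap0 : 0 < kap).
Hypothesis eps0 : forall k, 0 < eps k.
Hypothesis LE : forall k, (0 < Ns k)%N -> (Ls k)%:R = kap * (Ns k)%:R.
Hypothesis nE : forall k, (0 < Ns k)%N -> (ns k)%:R = nu * (Ns k)%:R.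
Hypothesis atE : forall k, (0 < Ns k)%N -> (ats k)%:R = tau * (Ns k)%:R.
Hypothesis LN : forall k, (0 < Ns k)%N -> (Ls k + los k <= 2 * Ns k)%N.
Hypothesis loE : forall k, (0 < Ns k)%N -> (Ms k)%:Z - (Ls k)%:Z = (los k)%:Z.
Hypothesis wE : forall k, (0 < Ns k)%N -> weight eta theta alpha (Ns k) (Ms k) (ts k) (eps k)
  =1 gweight eta theta zeta rho c (eps k) (Ls k) (ns k) (ats k) (los k).
Hypothesis small : forall d : R, 0 < d -> exists k0, forall k, (k0 <= k)%N ->
  [/\ (0 < Ns k)%N, 1 < d * (Ns k)%:R, (Ns k)%:R * eps k < d & - ln (eps k) <= d * (Ns k)%:R].

Local Notation I01 := (`[0%R, 1%R]%classic : set R).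
Local Notation IK := (IK eta theta zeta kap (kap * nu) (kap * rho * tau)).
Local Notation Igen := (Igen eta theta zeta kap (kap * nu) (kap * rho * tau)).
Local Notation emp k := (empirical (Ns k) (Ms k) (ts k) (eps k)).
Local Notation wt k := (weight eta theta alpha (Ns k) (Ms k) (ts k) (eps k)).

Definition esum_weight k (A : set (Meas R)) : \bar R :=
  \esum_(s in States (Ns k) (Ms k) (ts k) `&` [set s | A (emp k s)]) (wt k s)%:E.

Let c00 : 0 <= kap * nu. Proof. by rewrite mulr_ge0 ?(ltW kap0). Qed.
Let c10 : 0 <= kap * rho * tau. Proof. by rewrite !mulr_ge0 ?(ltW kap0) ?(ltW rho0). Qed.

(** A Dini argument: the open sets [U K] cover [P01], finitely many suffice, and by monotonicity in
    [K] the largest level works on all of [F]. *)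
Lemma closed_IK_gt (F : set (Meas R)) (a : R) : wclosed F ->
  (forall mu, F mu -> P01 mu -> (a%:E < Igen mu)%E) ->
  exists K, forall mu, F mu -> P01 mu -> a <= IK K mu.
Proof.
move=> cF HF.
pose U (K : nat) : set (Meas R) := [set mu | ~ F mu \/ a < IK K mu].
have oU K : Defs.wopen (U K).
  move=> mu Pmu [nF|aI].
    have [n [fs [d [d0 [ufs H]]]]] := cF mu Pmu nF.
    by exists n, fs, d; split => //; split => // nu' Pnu /(H _ Pnu); left.
  have [n [fs [d [d0 [ufs H]]]]] := IK_gt_wopen eta0 theta0 zeta0 kap0 Pmu aI.
  by exists n, fs, d; split => //; split => // nu' Pnu /(H _ Pnu); right.
have [_ /(_ nat U oU)] := @P01_wcompact R.
case.
  move=> mu Pmu; have [Fmu|nF] := pselect (F mu); last by exists 0%N; left.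
  have [K aK] := Igen_gt eta0 theta0 zeta0 kap0 c00 c10 Pmu (HF _ Fmu Pmu).
  by exists K; right.
move=> n [g Hg]; exists (\max_(i < n) g i) => mu Fmu Pmu.
have [j [//|aj]] := Hg _ Pmu.
apply: (le_trans (ltW aj)); apply: (IK_homo eta0 theta0 zeta0 kap0 c00 c10 Pmu).
exact: (@leq_bigmax _ (fun i => g i) j).
Qed.

Lemma esum_weight_eventually_le (F : set (Meas R)) (a e : R) : wclosed F -> 0 < e ->
  (forall mu, F mu -> P01 mu -> (a%:E < Igen mu)%E) ->
  exists k0, forall k, (k0 <= k)%N ->
    (esum_weight k F <= (expR (- ((Ns k)%:R ^+ 2 * (a - e))))%:E)%E.
Proof.
move=> cF e0 HF; have [K HK] := closed_IK_gt cF HF.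
pose E := expR K%:R : R.
(* One summand per error source: diagonal terms, Pochhammer shifts, [c * eps], [ln c] and
   [- ln eps]. Each error is at most its summand times [d * N], and [kap * Cst * d <= e]. *)
pose Cst := K%:R + nu * E * zeta * (nu + 1) + c + `|ln c| + 1.
have E0 : 0 <= E := expR_ge0 _.
have Cst0 : 0 < Cst.
  by rewrite ltr_wpDl// !addr_ge0// ?(ltW c_gt0)// !mulr_ge0 ?addr_ge0 ?(ltW zeta0).
pose d := Num.min 1 (e / (kap * Cst)).
have d0 : 0 < d by rewrite lt_min ltr01 divr_gt0// mulr_gt0.
have [k0 Hk0] := small d0; exists k0 => k /Hk0 [N0 dN Ned lnd].
apply: le_trans (esum_weight_le eta0 theta0 zeta0 rho0 c_gt0 kap0 (eps0 k) (LE N0) (nE N0)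
  (atE N0) N0 (loE N0) (wE N0) HK) _.
rewrite lee_fin ler_expR.
have N0R : 0 < (Ns k)%:R :> R by rewrite ltr0n.
have N1 : 1 <= (Ns k)%:R :> R by rewrite ler1n.
have ek := eps0 k.
have dle1 : d <= 1 by rewrite ge_min lexx.
have dC : d * (kap * Cst) <= e.
  by rewrite -ler_pdivlMr ?mulr_gt0// ge_min lexx orbT.
rewrite LE// nE// lnM ?posrE// -/E.
set N := (Ns k)%:R in N0R N1 dN Ned lnd *; set ep := eps k in ek Ned lnd *.
have t1 : K%:R <= K%:R * (d * N) by rewrite ler_peMr// ltW.
have t2 : N * ep <= d * N by apply: le_trans (ltW Ned) _; rewrite ler_peMr// ltW.
have ep_le : ep <= d * N by apply: le_trans t2; rewrite ler_peMl// ltW.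
have t3 : ep * N <= d by rewrite mulrC ltW.
have t4 : nu * N * (E * (ep * zeta * (nu * N + 1))) <= nu * E * zeta * (nu + 1) * (d * N).
  have q0 : 0 <= nu * E * zeta by rewrite !mulr_ge0 ?(ltW zeta0).
  have -> : nu * N * (E * (ep * zeta * (nu * N + 1))) =
     nu * E * zeta * (nu * ((ep * N) * N) + ep * N) by ring.
  have -> : nu * E * zeta * (nu + 1) * (d * N) = nu * E * zeta * (nu * (d * N) + d * N) by ring.
  apply: (ler_wpM2l q0); apply: lerD; last by rewrite mulrC.
  by apply: (ler_wpM2l nu0); rewrite ler_wpM2r// ltW.
have t5 : c * ep <= c * (d * N) by rewrite ler_wpM2l// ltW.
have t6 : - ln c <= `|ln c| * (d * N).
  by rewrite (le_trans (ler_norm _))// normrN ler_peMr// ltW.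
have t7 : kap * N * (K%:R + nu * N * (E * (ep * zeta * (nu * N + 1)))) +
    kap * N * (c * ep - (ln c + ln ep)) <= N ^+ 2 * e.
  have -> : kap * N * (K%:R + nu * N * (E * (ep * zeta * (nu * N + 1)))) +
    kap * N * (c * ep - (ln c + ln ep)) = kap * N *
    (K%:R + nu * N * (E * (ep * zeta * (nu * N + 1))) + c * ep + - ln c + - ln ep) by ring.
  apply: (@le_trans _ _ (kap * N * (Cst * (d * N)))).
    apply: ler_wpM2l; first by rewrite mulr_ge0 ?(ltW kap0) ?(ltW N0R).
    have -> : Cst * (d * N) = K%:R * (d * N) + nu * E * zeta * (nu + 1) * (d * N) +
       c * (d * N) + `|ln c| * (d * N) + d * N by rewrite /Cst; ring.
    by do 4 apply: lerD => //.
  have -> : kap * N * (Cst * (d * N)) = N ^+ 2 * (d * (kap * Cst)) by ring.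
  by rewrite ler_wpM2l ?sqr_ge0.
have -> : - (N ^+ 2 * (a - e)) = - (N ^+ 2 * a) + N ^+ 2 * e by ring.
by rewrite -addrA lerD2l.
Qed.

Lemma esum_weight_lty k A : (0 < Ns k)%N -> (esum_weight k A < +oo)%E.
Proof.
move=> N0; exact: (esum_weight_at_lty eta0 theta0 zeta0 rho0 c_gt0 nu0 tau0 kap0 (eps0 k)
  (LE N0) (nE N0) (atE N0) N0 (loE N0) (wE N0)).
Qed.

(** The tolerance [e1] of the weak neighbourhood is spent in quarters on rounding, on the deviations
    of the sample and on the restriction to [D]; the last quarter makes the inequality strict.
    [delta] and [Lam] are fixed before N grows. *)
Lemma esum_weight_eventually_ge (G : set (Meas R)) (mu : Meas R) (a e : R) :
  Defs.wopen G -> G mu -> P01 mu -> 0 < e -> (Igen mu <= a%:E)%E ->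
  exists k0, forall k, (k0 <= k)%N ->
    ((expR (- ((Ns k)%:R ^+ 2 * (a + e))))%:E <= esum_weight k G)%E.
Proof.
move=> oG Gmu Pmu e0 Ia.
have IC K : IK K mu <= a.
  by rewrite -lee_fin (le_trans _ Ia)//; exact: IK_le_Igen.
have a0 : 0 <= a by rewrite -lee_fin (le_trans _ Ia)//; exact: Igen_ge0.
have [n0 [fs [e1 [e10 [cfs HG]]]]] := oG mu Pmu Gmu.
have ufs j : ucont01 (fs j) by exact: within_ucont01.
have [Bf Bf0 fsB] : exists2 Bf : R, 0 < Bf & forall j x, 0 <= x <= 1 -> `|fs j x| <= Bf.
  have /choice[B HB] : forall j, exists B : R, 0 < B /\ forall x, 0 <= x <= 1 -> `|fs j x| <= B.
    by move=> j; have [B ? ?] := ucont01_bounded (ufs j); exists B.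
  exists (1 + \sum_j B j) => [|j x x01].
    by rewrite ltr_pwDl//; apply: sumr_ge0 => j _; rewrite ltW//; case: (HB j).
  rewrite (le_trans ((HB j).2 x x01))// ler_wpDl//.
  by apply: (@le_sum1 _ _ xpredT B) => // j' _; rewrite ltW//; case: (HB j').
have e4 : 0 < e1 / 4 by rewrite divr_gt0.
have [d' d'0 fsd] : exists2 d' : R, 0 < d' & forall j x y, 0 <= x <= 1 -> 0 <= y <= 1 ->
    `|x - y| < d' -> `|fs j x - fs j y| < e1 / 4.
  have /choice[B HB] : forall j, exists d : R, 0 < d /\ forall x y, 0 <= x <= 1 -> 0 <= y <= 1 ->
    `|x - y| < d -> `|fs j x - fs j y| < e1 / 4.
    by move=> j; have [B ? ?] := ufs j _ e4; exists B.
  exists (\big[Num.min/1]_j B j) => [|j x y x01 y01 xy].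
    by apply: lt_bigmin => // j _; case: (HB j).
  by apply: (HB j).2 => //; rewrite (lt_le_trans xy)// bigmin_le_cond.
(* The caps serve, in order, [mass_inv_sq_le], the estimate [2 * Bf * (1 - m) <= e1 / 4], and
   [6 * a * w <= e / 2]. *)
pose w := Num.min 2^-1 (Num.min (e1 / (8 * Bf)) (e / (12 * (a + 1)))).
have w0 : 0 < w by rewrite !lt_min invr_gt0 ltr0n !divr_gt0 ?mulr_gt0// ltr_wpDl.
have [delta d01 wm] := mass_away_from0 eta0 theta0 zeta0 kap0 c00 c10 Pmu IC w0.
set D := `[delta, 1%R]%classic in wm; set m := fine (mu D) in wm.
have w2 : w <= 2^-1 by rewrite ge_min lexx.
have m0 : 0 < m by apply: lt_le_trans wm; lra.
have mi := mass_inv_sq_le (ltW w0) w2 wm.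
have am : a / m ^+ 2 <= a + e / 2.
  apply: (@le_trans _ _ (a * (1 + 6 * w))); first exact: ler_wpM2l.
  rewrite mulrDr mulr1 lerD2l.
  have : w <= e / (12 * (a + 1)) by rewrite !ge_min lexx !orbT.
  rewrite ler_pdivlMr ?mulr_gt0 ?ltr_wpDl// => h.
  have hw : 0 <= w by exact: ltW.
  move: h hw; move: (w) => w'; lra.
have am4 : a / m ^+ 2 <= 4 * a.
  rewrite mulrC ler_wpM2r// (le_trans mi)//; lra.
have Bw : 2 * Bf * (1 - m) <= e1 / 4.
  have : w <= e1 / (8 * Bf) by rewrite !ge_min lexx !orbT.
  rewrite ler_pdivlMr ?mulr_gt0// => h.
  have : Bf * (1 - m) <= Bf * w by rewrite ler_wpM2l ?(ltW Bf0)// lerBlDr -lerBlDl.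
  rewrite -mulrA; move: h; rewrite mulrCA [w * Bf]mulrC.
  by move: (Bf * (1 - m)) (Bf * w) => z z'; lra.
pose q := (e1 / 4) ^+ 2.
have q0 : 0 < q by rewrite exprn_gt0.
(* Since [a / m ^+ 2 <= 4 * a], the part of the squared deviation that does not vanish with [L] is
   at most [q / 2]. *)
pose Lam := 8 * a / q + 1.
have Lam0 : 0 < Lam by rewrite ltr_wpDl// divr_ge0 ?(ltW q0)// mulr_ge0.
pose B0 := n0%:R * (2 * Bf) ^+ 2.
have B00 : 0 <= B0 by rewrite mulr_ge0 ?sqr_ge0.
have LB0 : 0 <= Lam * B0 by rewrite mulr_ge0 ?(ltW Lam0).
(* Losses from the penalty, the Vandermonde factors, the geometric factors and the power factors;
   the final 1 keeps the constant positive. *)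
pose Cst := Lam * B0 / kap + kap ^+ 2 * (2 * (eta + theta)) +
   kap * (c * (2 + `|ln delta|)) + kap * (2 * rho * tau) + 1.
have Cst0 : 0 < Cst.
  have s1 : 0 <= Lam * B0 / kap by rewrite divr_ge0 ?(ltW kap0).
  have s2 : 0 <= kap ^+ 2 * (2 * (eta + theta)).
    by rewrite !mulr_ge0 ?sqr_ge0 ?addr_ge0 ?(ltW eta0) ?(ltW theta0) ?(ltW kap0).
  have s3 : 0 <= kap * (c * (2 + `|ln delta|)).
    apply: mulr_ge0; first exact: ltW.
    by apply: mulr_ge0; [exact: ltW|rewrite addr_ge0].
  have s4 : 0 <= kap * (2 * rho * tau) by rewrite !mulr_ge0 ?(ltW kap0) ?(ltW rho0).
  by rewrite ltr_wpDl// (addr_ge0 (addr_ge0 (addr_ge0 s1 s2) s3) s4).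
(* [d' / 2] keeps the displacement [2 * N * eps] below the modulus of the test functions, the third
   entry bounds all losses by [e / 2], and the last one gives [B0 / L <= q / 2]. *)
pose d := Num.min (Num.min 1 (d' / 2)) (Num.min (e / (2 * Cst)) (q * kap / (2 * (B0 + 1)))).
have d0 : 0 < d.
  by rewrite !lt_min ltr01 !divr_gt0// ?mulr_gt0// ltr_wpDl.
have [k0 Hk0] := small d0; exists k0 => k /Hk0 [N0 dN Ned _].
have N0R : 0 < (Ns k)%:R :> R by rewrite ltr0n.
have ek := eps0 k.
have dle1 : d <= 1 by rewrite !ge_min lexx.
have dd' : d <= d' / 2 by rewrite !ge_min lexx !orbT.
have fsw j x y : 0 <= x <= 1 -> 0 <= y <= 1 -> `|x - y| <= 2 * (Ns k)%:R * eps k ->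
    `|fs j x - fs j y| <= e1 / 4.
  move=> x01 y01 xy; apply/ltW/fsd => //; apply: (le_lt_trans xy).
  rewrite -mulrA; move: Ned dd'; move: (_ * eps k) => z; lra.
have [s [Ss ws Hs]] := exists_good_state eta0 theta0 zeta0 rho0 c_gt0 nu0 tau0 kap0 (eps0 k)
  (LE N0) (nE N0) (atE N0) N0 (LN N0) (loE N0) (wE N0) Pmu d01 m0 IC ufs (ltW Bf0) Lam0 fsB fsw.
have L0 : (0 < Ls k)%N by rewrite -(ltr0n R) LE// mulr_gt0.
have Gs : G (emp k s).
  apply: HG; first by apply: empirical_P01 => // i; exact: (States_ge0 (loE N0) Ss).
  move=> j; have [b h1 h2] := Hs j.
  have h3 := mean_close Pmu d01 m0 (ufs j) (fsB j).
  have h4 : `|b - mean mu D (fs j)| <= e1 / 4.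
    rewrite -(ler_pXn2r (n := 2)) ?nnegrE ?(ltW e4)// real_normK ?num_real//.
    apply: (le_trans h2); rewrite -/m -/B0 -/q.
    have g1 : a / m ^+ 2 / Lam <= q / 2.
      rewrite ler_pdivrMr//; apply: (le_trans am4).
      have -> : q / 2 * Lam = 4 * a + q / 2.
        by rewrite /Lam; have : q != 0 by [rewrite gt_eqF]; move=> ?; field.
      by rewrite lerDl divr_ge0 ?(ltW q0).
    have g2 : B0 / (Ls k)%:R <= q / 2.
      rewrite ler_pdivrMr ?ltr0n// LE//.
      have h5 : d * (2 * (B0 + 1)) <= q * kap.
        by rewrite -ler_pdivlMr ?mulr_gt0 ?ltr_wpDl// !ge_min lexx !orbT.
      have h6 : B0 <= B0 * (d * (Ns k)%:R) by rewrite ler_peMr// ltW.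
      apply: (le_trans h6).
      have h7 : B0 * d <= q * kap / 2 by move: h5 d0 B00; nra.
      rewrite mulrA; have -> : q / 2 * (kap * (Ns k)%:R) = q * kap / 2 * (Ns k)%:R by ring.
      by rewrite ler_wpM2r// ltW.
    by rewrite [leRHS](splitr q); apply: lerD.
  rewrite -/D -/m in h3.
  have h5 : `|av (emp k s) I01 (fs j) - av mu I01 (fs j)| <= e1 / 4 + e1 / 4 + e1 / 4.
    apply: dist_trans4 h1 h4 _; exact: (le_trans h3 Bw).
  by apply: (le_lt_trans h5); lra.
apply: esum_ge; exists [set s].
  by split; [exact: finite_set1|move=> _ -> /=; split].
rewrite fsbig_set1 lee_fin; apply: le_trans ws; rewrite ler_expR -/m -/B0.
rewrite LE// atE//.
have dC : d * Cst <= e / 2.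
  rewrite -ler_pdivlMr// -mulrA -invfM !ge_min lexx !orbT//.
set N := (Ns k)%:R in N0R dN Ned *; set ep := eps k in ek Ned *.
have N1 : 1 <= N by rewrite /N ler1n.
have t0 : N <= N ^+ 2 * d by rewrite expr2 -mulrA [N * d]mulrC ler_peMr// ltW.
have t1 : N * (Lam * B0) / kap <= N ^+ 2 * (d * (Lam * B0 / kap)).
  rewrite -mulrA [leRHS]mulrA ler_wpM2r// divr_ge0// ltW//.
have t2 : (kap * N) ^+ 2 * (2 * N * ep * (eta + theta)) <=
    N ^+ 2 * (d * (kap ^+ 2 * (2 * (eta + theta)))).
  have -> : (kap * N) ^+ 2 * (2 * N * ep * (eta + theta)) =
    N ^+ 2 * ((N * ep) * (kap ^+ 2 * (2 * (eta + theta)))) by ring.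
  rewrite ler_wpM2l ?sqr_ge0// ler_wpM2r ?(ltW Ned)//.
  by rewrite !mulr_ge0 ?sqr_ge0 ?addr_ge0 ?(ltW eta0) ?(ltW theta0) ?(ltW kap0).
have t3 : kap * N * (c * (2 * N * ep - ln delta)) <= N ^+ 2 * (d * (kap * (c * (2 + `|ln delta|)))).
  have -> : N ^+ 2 * (d * (kap * (c * (2 + `|ln delta|)))) =
     kap * N * (c * (2 * (d * N) + `|ln delta| * (d * N))) by ring.
  apply: ler_wpM2l; first by rewrite mulr_ge0 ?(ltW kap0) ?(ltW N0R).
  apply: (ler_wpM2l (ltW c_gt0)); apply: lerD.
    rewrite -mulrA ler_wpM2l// (le_trans (ltW Ned))// ler_peMr// ltW//.
  by rewrite (le_trans (ler_norm _))// normrN ler_peMr// ltW.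
have t4 : kap * N * (2 * N * ep * rho * (tau * N)) <= N ^+ 2 * (d * (kap * (2 * rho * tau))).
  have -> : kap * N * (2 * N * ep * rho * (tau * N)) =
    N ^+ 2 * ((N * ep) * (kap * (2 * rho * tau))) by ring.
  rewrite ler_wpM2l ?sqr_ge0// ler_wpM2r ?(ltW Ned)//.
  by rewrite !mulr_ge0 ?(ltW kap0) ?(ltW rho0).
have t5 : N ^+ 2 * (a / m ^+ 2) <= N ^+ 2 * (a + e / 2) by rewrite ler_wpM2l ?sqr_ge0.
have t6 : N ^+ 2 * (d * Cst) <= N ^+ 2 * (e / 2) by rewrite ler_wpM2l ?sqr_ge0.
have t7 : N ^+ 2 * (d * Cst) = N ^+ 2 * (d * (Lam * B0 / kap)) +
   N ^+ 2 * (d * (kap ^+ 2 * (2 * (eta + theta)))) +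
   N ^+ 2 * (d * (kap * (c * (2 + `|ln delta|)))) + N ^+ 2 * (d * (kap * (2 * rho * tau))) +
   N ^+ 2 * d by rewrite /Cst; ring.
have t8 : 0 <= N ^+ 2 * d by rewrite mulr_ge0 ?sqr_ge0 ?(ltW d0).
have t9 : N ^+ 2 * (a + e) = N ^+ 2 * (a + e / 2) + N ^+ 2 * (e / 2) by field.
rewrite [kap * N * (_ + _)]mulrDr -opprD lerN2 t9.
rewrite t7 in t6.
move: t1 t2 t3 t4 t5 t6 t8.
move: (N * (Lam * B0) / kap) (N ^+ 2 * (d * (Lam * B0 / kap))) => x1 x2.
move: ((kap * N) ^+ 2 * _) (N ^+ 2 * (d * (kap ^+ 2 * _))) => x3 x4.
move: (kap * N * (c * _)) (N ^+ 2 * (d * (kap * (c * _)))) => x5 x6.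
move: (kap * N * _) (N ^+ 2 * (d * (kap * _))) => x7 x8.
move: (N ^+ 2 * (a / m ^+ 2)) (N ^+ 2 * (a + e / 2)) (N ^+ 2 * d) (N ^+ 2 * (e / 2)) => x9 x10 x11 x12.
lra.
Qed.

End Asymptotics.

(** * From bounds to the large deviation principle *)

Section ExtendedReals.
Context {R : realType}.

Lemma lee_of_lt_EFin (d z : \bar R) : (forall r : R, (r%:E < d)%E -> (r%:E <= z)%E) -> (d <= z)%E.
Proof.
case: d => [d| |] H.
- apply/lee_subgt0Pr => e e0; rewrite -EFinB; apply: H.
  by rewrite lte_fin ltrBlDr ltrDl.
- rewrite leye_eq; apply/eqP/eqyP => r r0; apply: H; exact: ltry.
- exact: leNye.
Qed.

Lemma limn_esup_le_eventually (u : (\bar R)^nat) (x : \bar R) k0 :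
  (forall k, (k0 <= k)%N -> (u k <= x)%E) -> (limn_esup u <= x)%E.
Proof.
move=> H; apply: ge_ereal_inf.
exists (ereal_sup [set u k | k in [set k | (k0 <= k)%N]]).
  by exists [set k | (k0 <= k)%N] => //; exists k0.
by apply: ge_ereal_sup => _ [k /= kk0 <-]; exact: H.
Qed.

Lemma limn_einf_ge_eventually (u : (\bar R)^nat) (x : \bar R) k0 :
  (forall k, (k0 <= k)%N -> (x <= u k)%E) -> (x <= limn_einf u)%E.
Proof.
move=> H; rewrite /limn_einf leeNr; apply: (@limn_esup_le_eventually _ _ k0) => k kk0.
by rewrite leeN2; exact: H.
Qed.

Lemma elog_le (r b : R) : r <= expR b -> (elog r <= b%:E)%E.
Proof.
rewrite /elog; case: ifP => [r0 h|_ _]; last exact: leNye.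
by rewrite lee_fin -[leRHS]expRK ler_ln ?posrE ?expR_gt0.
Qed.

Lemma elog_ge (r b : R) : expR b <= r -> (b%:E <= elog r)%E.
Proof.
move=> h; have r0 : 0 < r := lt_le_trans (expR_gt0 b) h.
by rewrite /elog r0 lee_fin -[leLHS]expRK ler_ln ?posrE ?expR_gt0.
Qed.

End ExtendedReals.

Section LDPAssembly.
Context {R : realType}.

(** The complement of [F] joins the cover as the index [None]; in the extracted subfamily [None] is
    replaced by a default index, which exists because [F] is nonempty in that case. *)
Lemma wclosed_wcompact (F : set (Meas R)) : F `<=` @P01 R -> wclosed F -> wcompact F.
Proof.
move=> FP cF; split => // I U oU cU.
have [[mu0 Fmu0]|F0] := pselect (exists mu, F mu); last first.
  exists 0%N, (fun i : 'I_0 => match i with Ordinal m Hm => match notF Hm with end end).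
  by move=> mu Fmu; case: F0; exists mu.
have [i0 _] := cU _ Fmu0.
pose V (o : option I) : set (Meas R) := if o is Some i then U i else ~` F.
have oV o : Defs.wopen (V o) by case: o => [i|]; [exact: oU|exact: cF].
have [_ /(_ (option I) V oV)] := @P01_wcompact R.
case.
  move=> mu Pmu; have [Fmu|nF] := pselect (F mu); last by exists None.
  by have [i Ui] := cU _ Fmu; exists (Some i).
move=> n [f Hf]; exists n, (fun j => odflt i0 (f j)) => mu Fmu.
have [j] := Hf _ (FP _ Fmu); rewrite /V; case E : (f j) => [i|] H.
  by exists j; rewrite E.
by case: H.
Qed.

Lemma wclosed_setT : wclosed (setT : set (Meas R)).
Proof. by move=> mu _ h; case: h. Qed.

Lemma wopen_setT : Defs.wopen (setT : set (Meas R)).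
Proof.
move=> mu _ _; exists 0%N, (fun _ _ => 0), 1; split => //; split => // -[] //.
Qed.

Variables (I : Meas R -> \bar R) (Z : nat -> set (Meas R) -> \bar R) (Ns : nat -> nat).
Hypothesis I_ge0 : forall mu, P01 mu -> (0 <= I mu)%E.
Hypothesis I_fin : exists mu, P01 mu /\ exists C : R, (I mu <= C%:E)%E.
Hypothesis I_lsc : forall a : R, Defs.wopen [set mu | P01 mu /\ (a%:E < I mu)%E].
Hypothesis Ns_gt0 : exists k0, forall k, (k0 <= k)%N -> (0 < Ns k)%N.
Hypothesis Z_lty : forall k A, (0 < Ns k)%N -> (Z k A < +oo)%E.
Hypothesis Z_ge0 : forall k A, (0 < Ns k)%N -> (0 <= Z k A)%E.
Hypothesis Z_upper : forall (F : set (Meas R)) (a e : R), wclosed F -> 0 < e ->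
  (forall mu, F mu -> P01 mu -> (a%:E < I mu)%E) ->
  exists k0, forall k, (k0 <= k)%N -> (Z k F <= (expR (- ((Ns k)%:R ^+ 2 * (a - e))))%:E)%E.
Hypothesis Z_lower : forall (G : set (Meas R)) (mu : Meas R) (a e : R),
  Defs.wopen G -> G mu -> P01 mu -> 0 < e -> (I mu <= a%:E)%E ->
  exists k0, forall k, (k0 <= k)%N -> ((expR (- ((Ns k)%:R ^+ 2 * (a + e))))%:E <= Z k G)%E.

Let i0 := fine (infJ I setT).

Let infE : infJ I setT = i0%:E.
Proof.
rewrite /i0 fineK//; have [mu [Pmu [C IC]]] := I_fin.
rewrite ge0_fin_numE.
  apply: le_lt_trans (ltry C); apply: le_trans IC.
  by apply: ereal_inf_lbound; exists mu.
by apply: le_ereal_inf_tmp => _ [nu [_ Pnu] <-]; exact: I_ge0.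
Qed.

Let I_ge mu : P01 mu -> (i0%:E <= I mu)%E.
Proof. by move=> Pmu; rewrite -infE; apply: ereal_inf_lbound; exists mu. Qed.

Let J mu : \bar R := (I mu - infJ I setT)%E.

Let JE mu : J mu = (I mu - i0%:E)%E. Proof. by rewrite /J infE. Qed.

Let J_lt mu (r : R) : (r%:E < J mu)%E = ((r + i0)%:E < I mu)%E.
Proof. by rewrite JE lteBrDr// EFinD. Qed.

Lemma rate_good : good_rate J.
Proof.
have cl (a : R) : wclosed [set mu | P01 mu /\ (J mu <= a%:E)%E].
  move=> mu Pmu /= nJ.
  have aI : ((a + i0)%:E < I mu)%E.
    by rewrite -J_lt ltNge; apply/negP => h; apply: nJ.
  have [n [fs [d [d0 [ufs H]]]]] := I_lsc Pmu (conj Pmu aI).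
  exists n, fs, d; split => //; split => // nu Pnu /(H _ Pnu) [_ +] [_].
  by rewrite -J_lt leNgt => ->.
split; first by move=> mu Pmu; rewrite JE sube_ge0//; exact: I_ge.
by split => // a; apply: wclosed_wcompact => // mu [].
Qed.

Definition normalized k (A : set (Meas R)) : R := fine (Z k A) / fine (Z k setT).

Let Z_fine_le k A b : (0 < Ns k)%N -> (Z k A <= (expR b)%:E)%E -> fine (Z k A) <= expR b.
Proof. by move=> N0 h; rewrite -lee_fin fineK// ge0_fin_numE ?Z_lty ?Z_ge0. Qed.

Let Z_fine_ge k A b : (0 < Ns k)%N -> ((expR b)%:E <= Z k A)%E -> expR b <= fine (Z k A).
Proof. by move=> N0 h; rewrite -lee_fin fineK// ge0_fin_numE ?Z_lty ?Z_ge0. Qed.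

(** The bounds applied to the whole space give the normalising constant: one [e] comes from an
    almost minimising measure, the other from the bound itself. *)
Lemma total_lower e : 0 < e -> exists k0, forall k, (k0 <= k)%N ->
  expR (- ((Ns k)%:R ^+ 2 * (i0 + 2 * e))) <= fine (Z k setT).
Proof.
move=> e0; have [kN HN] := Ns_gt0.
have : (infJ I setT < (i0 + e)%:E)%E by rewrite infE lte_fin ltrDl.
move=> /ereal_inf_lt[_ [mu [_ Pmu] <-] Imu].
have [k1 Hk1] := Z_lower wopen_setT (Logic.I : setT mu) Pmu e0 (ltW Imu).
exists (maxn kN k1) => k; rewrite geq_max => /andP[kkN kk1].
apply: Z_fine_ge; first exact: HN.
have -> : i0 + 2 * e = i0 + e + e by ring.
exact: Hk1.
Qed.

Lemma total_upper e : 0 < e -> exists k0, forall k, (k0 <= k)%N ->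
  fine (Z k setT) <= expR (- ((Ns k)%:R ^+ 2 * (i0 - 2 * e))).
Proof.
move=> e0; have [kN HN] := Ns_gt0.
have [mu _ Pmu|k1 Hk1] := Z_upper (a := i0 - e) wclosed_setT e0.
  by apply: lt_le_trans (I_ge Pmu); rewrite lte_fin ltrBlDr ltrDl.
exists (maxn kN k1) => k; rewrite geq_max => /andP[kkN kk1].
apply: Z_fine_le; first exact: HN.
have -> : i0 - 2 * e = i0 - e - e by ring.
exact: Hk1.
Qed.

Lemma LDP_of_bounds : LDP normalized (fun k => (Ns k)%:R ^+ 2) J.
Proof.
have [kN HN] := Ns_gt0.
have scale k (x : R) : (0 < Ns k)%N -> ((((Ns k)%:R ^+ 2)^-1)%:E * (- ((Ns k)%:R ^+ 2 * x))%:E = (- x)%:E)%E.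
  move=> N0; rewrite -EFinM mulrN mulKf// expf_neq0// pnatr_eq0 -lt0n//.
have sge0 k : (0 <= (((Ns k)%:R ^+ 2)^-1 : R)%:E)%E by rewrite lee_fin invr_ge0 sqr_ge0.
split; first exact: rate_good.
split => [F cF|G oG].
  (* Testing against reals [r] below the infimum treats finite and infinite infima alike. *)
  rewrite leeNr; apply: lee_of_lt_EFin => r rJ; rewrite leeNr -EFinN.
  apply/lee_addgt0Pr => e e0; rewrite -EFinD.
  (* One third is lost in the numerator and two thirds in the normalising constant. *)
  have e30 : 0 < e / 3 by rewrite divr_gt0.
  have HF mu : F mu -> P01 mu -> ((r + i0)%:E < I mu)%E.
    move=> Fmu Pmu; rewrite -J_lt; apply: (lt_le_trans rJ).
    by apply: ereal_inf_lbound; exists mu.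
  have [k1 Hk1] := Z_upper cF e30 HF.
  have [k2 Hk2] := total_lower e30.
  apply: (@limn_esup_le_eventually _ _ _ (maxn kN (maxn k1 k2))) => k.
  rewrite !geq_max => /and3P[/HN N0 /Hk1 h1 /Hk2 h2].
  have {}h1 := Z_fine_le N0 h1.
  rewrite -[- r + e]opprK -(scale k _ N0); apply: lee_wpmul2l => //.
  apply: elog_le; rewrite /normalized.
  have Zp : 0 < fine (Z k setT) by apply: lt_le_trans h2; exact: expR_gt0.
  rewrite ler_pdivrMr//; apply: (le_trans h1).
  apply: (@le_trans _ _ (expR (- ((Ns k)%:R ^+ 2 * - (- r + e))) *
     expR (- ((Ns k)%:R ^+ 2 * (i0 + 2 * (e / 3)))))); last by rewrite ler_wpM2l ?expR_ge0.
  rewrite -expRD ler_expR le_eqVlt; apply/orP; left; apply/eqP.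
  by field.
rewrite leeNl; apply: le_ereal_inf_tmp => _ [mu [Gmu Pmu] <-]; rewrite leeNl.
(* At a measure of infinite rate the required lower bound is [-oo]. *)
have [Iy|] := boolP (I mu == +oo%E).
  by rewrite JE (eqP Iy) /= leNye.
rewrite -ltey => Ilt.
have Ifin : I mu \is a fin_num by rewrite ge0_fin_numE// I_ge0.
pose a := fine (I mu).
have IE : I mu = a%:E by rewrite fineK.
have -> : (- J mu)%E = (i0 - a)%:E by rewrite JE IE -EFinB -EFinN opprB.
apply/lee_subgt0Pr => e e0; rewrite -EFinB.
have e30 : 0 < e / 3 by rewrite divr_gt0.
have Ia : (I mu <= a%:E)%E by rewrite IE.
have [k1 Hk1] := Z_lower oG Gmu Pmu e30 Ia.
have [k2 Hk2] := total_upper e30.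
have [k3 Hk3] := total_lower e30.
apply: (@limn_einf_ge_eventually _ _ _ (maxn kN (maxn k1 (maxn k2 k3)))) => k.
rewrite !geq_max => /and4P[/HN N0 /Hk1 h1 /Hk2 h2 /Hk3 h3].
have {}h1 := Z_fine_ge N0 h1.
rewrite -[i0 - a - e]opprK -(scale k _ N0); apply: lee_wpmul2l => //.
apply: elog_ge; rewrite /normalized.
have Zp : 0 < fine (Z k setT) by apply: lt_le_trans h3; exact: expR_gt0.
rewrite ler_pdivlMr//; apply: le_trans h1.
apply: (@le_trans _ _ (expR (- ((Ns k)%:R ^+ 2 * - (i0 - a - e))) *
   expR (- ((Ns k)%:R ^+ 2 * (i0 - 2 * (e / 3)))))); first by rewrite ler_wpM2l ?expR_ge0.
rewrite -expRD ler_expR le_eqVlt; apply/orP; left; apply/eqP.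
by field.
Qed.

End LDPAssembly.

(** * The diagonal slice of a plane partition *)

Section SliceModel.
Context {R : realType}.
Variables (eta theta alpha gamma xi eps : R) (N M : nat) (t : int).
Hypotheses (eta0 : 0 < eta) (theta0 : 0 < theta) (gamma0 : 0 < gamma) (gamma1 : gamma < 1).
Hypotheses (xi_gt : - gamma ^+ 2 < xi) (xi_lt : xi < 1) (N0 : (0 < N)%N).
Hypotheses (ME : M%:R = gamma ^+ 2 * N%:R) (tE : t%:~R = xi * N%:R).

Local Notation at_ := (`|t|%N).

(** Parameters that bring the slice to the generic model: [slice_zeta] is the exponent in the
    Pochhammer base, [slice_rho] the exponent multiplying [|t|], [slice_nu] the number of Pochhammer
    factors divided by N, and [slice_lo] equals [M - L]. *)
Definition slice_zeta : R := if xi <= 1 - gamma ^+ 2 then theta else eta.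
Definition slice_rho : R := if xi <= 0 then eta else theta.
Definition slice_nu : R := `|1 - gamma ^+ 2 - xi|.
Definition slice_lo : nat :=
  if t <= 0 then at_ else if (M <= N - at_)%N then 0%N else (M - (N - at_))%N.
Definition slice_n : nat :=
  if t <= 0 then (N - (M - at_))%N else if (M <= N - at_)%N then (N - at_ - M)%N
  else (M - (N - at_))%N.

Let N0R : 0 < N%:R :> R. Proof. by rewrite ltr0n. Qed.

Let g2 : gamma ^+ 2 <= 1. Proof. by rewrite expr_le1 ?ltW. Qed.

Lemma slice_t_le0 : (t <= 0) = (xi <= 0).
Proof. by rewrite -(ler_int R) tE pmulr_lle0. Qed.

Lemma slice_at : at_%:R = `|xi| * N%:R :> R.
Proof. by rewrite natr_absz intr_norm tE normrM (ger0_norm (ltW N0R)). Qed.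

Lemma slice_at_le : (at_ <= N)%N.
Proof.
rewrite -(ler_nat R) slice_at ler_piMl ?ler0n// ler_norml (ltW xi_lt) andbT.
by rewrite (le_trans _ (ltW xi_gt))// lerN2.
Qed.

Lemma slice_M_le : (M <= N)%N.
Proof. by rewrite -(ler_nat R) ME ler_piMl. Qed.

Lemma slice_at_le_M : xi <= 0 -> (at_ <= M)%N.
Proof.
move=> xi0; rewrite -(ler_nat R) slice_at ME ler_wpM2r// ler0_norm// lerNl ltW//.
Qed.

Lemma slice_M_le_sub : 0 < xi -> (M <= N - at_)%N = (xi <= 1 - gamma ^+ 2).
Proof.
move=> xi0; rewrite -(ler_nat R) natrB ?slice_at_le// ME slice_at gtr0_norm//.
rewrite -[X in _ <= X - _]mul1r -mulrBl ler_pM2r//.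
by rewrite lerBrDr -lerBrDl.
Qed.

(** The code tests the three ranges on integers and the rate function tests them on reals; one case
    analysis decides both kinds of tests. *)
Variant slice_spec : Prop :=
| SliceLeft of xi <= 0 & t <= 0 & (at_ <= M)%N & xi <= 1 - gamma ^+ 2
| SliceMiddle of 0 < xi & (t <= 0) = false & (M <= N - at_)%N & xi <= 1 - gamma ^+ 2
| SliceRight of 0 < xi & (t <= 0) = false & (M <= N - at_)%N = false &
    (xi <= 1 - gamma ^+ 2) = false.

Lemma sliceP : slice_spec.
Proof.
have [xi0|xi0] := leP xi 0.
  apply: SliceLeft => //; first by rewrite slice_t_le0.
    exact: slice_at_le_M.
  by rewrite (le_trans xi0)// subr_ge0.
have t0 : (t <= 0) = false by rewrite slice_t_le0 leNgt xi0.
have [MN|MN] := boolP (M <= N - at_)%N.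
  by apply: SliceMiddle => //; rewrite -slice_M_le_sub.
by apply: SliceRight => //; [exact: negbTE|rewrite -slice_M_le_sub//; exact: negbTE].
Qed.

Lemma slice_L : (Lnum N M t)%:R = kappa gamma xi * N%:R.
Proof.
rewrite /Lnum /kappa; case: sliceP => [xi0 t0 aM xg|xi0 t0 MN xg|xi0 t0 MN xg].
- by rewrite t0 xi0 natrB// ME slice_at mulrBl.
- by rewrite t0 MN leNgt xi0/= xg.
- rewrite t0 MN leNgt xi0/= xg natrB ?slice_at_le// slice_at gtr0_norm//.
  by rewrite mulrBl mul1r.
Qed.

Lemma slice_nE : slice_n%:R = slice_nu * N%:R :> R.
Proof.
rewrite /slice_n /slice_nu.
case: sliceP => [xi0 t0 aM xg|xi0 t0 MN xg|xi0 t0 MN xg].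
- rewrite t0 natrB; last by rewrite (leq_trans (leq_subr _ _)) ?slice_M_le.
  rewrite natrB// ME slice_at ler0_norm// ger0_norm; last by rewrite subr_ge0.
  by ring.
- rewrite t0 MN natrB// natrB ?slice_at_le// ME slice_at gtr0_norm// ger0_norm ?subr_ge0//.
  by ring.
- rewrite t0 MN natrB; last by rewrite ltnW// ltnNge MN.
  rewrite natrB ?slice_at_le// ME slice_at gtr0_norm// ltr0_norm; last first.
    by rewrite subr_lt0 ltNge xg.
  by ring.
Qed.

Lemma slice_LN : (Lnum N M t + slice_lo <= 2 * N)%N.
Proof.
apply: (@leq_trans M); last by rewrite (leq_trans slice_M_le)// leq_pmull.
rewrite /Lnum /slice_lo; case: sliceP => [xi0 t0 aM xg|xi0 t0 MN xg|xi0 t0 MN xg].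
- by rewrite t0 subnK.
- by rewrite t0 MN addn0.
- by rewrite t0 MN subnKC// ltnW// ltnNge MN.
Qed.

Lemma slice_loE : M%:Z - (Lnum N M t)%:Z = slice_lo%:Z.
Proof.
rewrite /Lnum /slice_lo; case: sliceP => [xi0 t0 aM xg|xi0 t0 MN xg|xi0 t0 MN xg].
- by rewrite t0 subzn ?leq_subr// subKn.
- by rewrite t0 MN subrr.
- by rewrite t0 MN subzn// ltnW// ltnNge MN.
Qed.

Lemma qpochE (z y : R) n : qpoch (qp eps z y) (qp eps z 1) n =
  \prod_(i < n) (1 - expR (- (eps * z * (y + i%:R)))).
Proof.
rewrite /qpoch; apply: eq_bigr => i _; rewrite /qp -expRM_natr -expRD.
by congr (1 - expR _); ring.
Qed.

(** The factors [a^x] and [(Q * Qtilde)^(x/2)] merge into the geometric factor, and the first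
    argument of each Pochhammer symbol has exponent [x - slice_lo + 1]. *)
Lemma wdE (x : int) : wd eta theta alpha N M t eps x =
  gwd slice_zeta slice_rho (alpha + (eta + theta) / 2) eps slice_n at_ slice_lo x.
Proof.
have base : expR (- (alpha * eps * x%:~R)) * qp eps ((eta + theta) / 2) x%:~R =
    expR (- ((alpha + (eta + theta) / 2) * eps * x%:~R)).
  by rewrite /qp -expRD; congr expR; ring.
rewrite /wd /gwd /slice_zeta /slice_rho /slice_n /slice_lo base !qpochE /qp.
case: sliceP => [xi0 t0 aM xg|xi0 t0 MN xg|xi0 t0 MN xg].
- rewrite t0 xi0 xg; congr (_ * _ * _).
- rewrite t0 MN leNgt xi0/= xg; congr (_ * _ * _).
  by apply: eq_bigr => i _; rewrite subr0.
- rewrite t0 MN leNgt xi0/= xg; congr (_ * _ * _).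
  apply: eq_bigr => i _; rewrite natrB; last by rewrite ltnW// ltnNge MN.
  by rewrite natrB ?slice_at_le//; congr (1 - expR (- (_ * _ * _))); ring.
Qed.

Lemma slice_weightE : weight eta theta alpha N M t eps =1
  gweight eta theta slice_zeta slice_rho (alpha + (eta + theta) / 2) eps
    (Lnum N M t) slice_n at_ slice_lo.
Proof.
move=> s; rewrite /weight /gweight; congr (_ * _).
by apply: eq_bigr => i _; exact: wdE.
Qed.

End SliceModel.

Section SliceRate.
Context {R : realType}.
Variables (eta theta gamma xi : R).
Hypothesis gamma0 : 0 < gamma.

(** The absolute values in [slice_nu] and [|xi|] absorb the signs by which the cases differ. *)
Lemma Ifun_Igen : Ifun eta theta gamma xi =
  Igen eta theta (slice_zeta eta theta gamma xi) (kappa gamma xi)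
    (kappa gamma xi * slice_nu gamma xi)
    (kappa gamma xi * slice_rho eta theta xi * `|xi|).
Proof.
apply/funext => mu; rewrite /Ifun /Igen /Hfun /K0fun /Mfun /slice_zeta /slice_nu /slice_rho.
congr (_ - _ - _)%E.
  case: ifP => xg; first by rewrite ger0_norm// subr_ge0.
  rewrite ltr0_norm; last by rewrite subr_lt0 ltNge xg.
  by congr ((_ * _)%:E * _)%E; ring.
by case: ifP => // /negbT; rewrite -ltNge => /gtr0_norm ->.
Qed.

Lemma kappa_gt0 : - gamma ^+ 2 < xi -> xi < 1 -> 0 < kappa gamma xi.
Proof.
move=> xi_gt xi_lt; rewrite /kappa; case: ifP => [xi0|_].
  by rewrite subr_gt0 ler0_norm// ltrNl.
by case: ifP => _; rewrite ?exprn_gt0// subr_gt0.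
Qed.

End SliceRate.

Lemma Igen_gt_wopen {R : realType} (eta theta zeta kap c0 c1 a : R) :
  0 < eta -> 0 < theta -> 0 < zeta -> 0 < kap -> 0 <= c0 -> 0 <= c1 ->
  Defs.wopen [set mu | P01 mu /\ (a%:E < Igen eta theta zeta kap c0 c1 mu)%E].
Proof.
move=> eta0 theta0 zeta0 kap0 c00 c10 mu Pmu [_ aI].
have [K aK] := Igen_gt eta0 theta0 zeta0 kap0 c00 c10 Pmu aI.
have [n [fs [d [d0 [ufs H]]]]] := IK_gt_wopen eta0 theta0 zeta0 kap0 Pmu aK.
exists n, fs, d; split => //; split => // nu Pnu /(H _ Pnu) aKnu; split => //.
apply: lt_le_trans (IK_le_Igen eta0 theta0 zeta0 kap0 c00 c10 K Pnu).
by rewrite lte_fin.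
Qed.

(** Strict growth gives [Ns k >= k], so N tends to infinity along the sequence; a single [d] then
    expresses all the smallness used in the two bounds. *)
Lemma eventually_small {R : realType} (Ns : nat -> nat) (eps : nat -> R) :
  (forall k, (Ns k < Ns k.+1)%N) ->
  (fun k => (Ns k)%:R * eps k) @ \oo --> 0 ->
  (fun k => ln (eps k) / (Ns k)%:R) @ \oo --> 0 ->
  forall d : R, 0 < d -> exists k0, forall k, (k0 <= k)%N ->
  [/\ (0 < Ns k)%N, 1 < d * (Ns k)%:R, (Ns k)%:R * eps k < d & - ln (eps k) <= d * (Ns k)%:R].
Proof.
move=> Ns_lt /cvgrPdist_lt cv1 /cvgrPdist_lt cv2 d d0.
have Ns_ge k : (k <= Ns k)%N.
  by elim: k => // k ih; apply: leq_ltn_trans ih (Ns_lt k).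
have [k1 _ H1] := cv1 d d0; have [k2 _ H2] := cv2 d d0.
pose k3 := (Num.truncn d^-1).+1.
exists (maxn k1 (maxn k2 k3)) => k; rewrite !geq_max => /and3P[/H1 h1 /H2 h2 h3].
have N0 : (0 < Ns k)%N by apply: leq_trans (Ns_ge k); exact: leq_trans h3.
have N0R : 0 < (Ns k)%:R :> R by rewrite ltr0n.
split => //.
- rewrite mulrC -ltr_pdivrMr// mul1r (lt_le_trans (truncnS_gt _))// ler_nat.
  exact: leq_trans h3 (Ns_ge k).
- move: h1; rewrite /= sub0r normrN; apply: le_lt_trans; exact: ler_norm.
- rewrite -ler_pdivrMr// mulNr; move: h2; rewrite /= sub0r => /ltW.
  by apply: le_trans; exact: ler_norm.
Qed.

Theorem mainTheorem8 (R : realType) (eta theta gamma alpha xi : R)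
  (Ns : nat -> nat) (Ms : nat -> nat) (ts : nat -> int) (eps : nat -> R) :
  0 < eta -> 0 < theta -> 0 < gamma -> gamma < 1 ->
  0 < alpha + (eta + theta) / 2 ->
  - gamma ^+ 2 < xi -> xi < 1 ->
  (forall k, (Ns k < Ns k.+1)%N) ->
  (forall k, (Ms k)%:R = gamma ^+ 2 * (Ns k)%:R) ->
  (forall k, (ts k)%:~R = xi * (Ns k)%:R) ->
  (forall k, 0 < eps k) ->
  (fun k => (Ns k)%:R * eps k) @ \oo --> 0 ->
  (fun k => ln (eps k) / (Ns k)%:R) @ \oo --> 0 ->
  LDP (fun k => prob_emp eta theta alpha (Ns k) (Ms k) (ts k) (eps k))
      (fun k => ((Ns k)%:R) ^+ 2)
      (Jfun eta theta gamma xi).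
Proof.
move=> eta0 theta0 gamma0 gamma1 c_gt0 xi_gt xi_lt Ns_lt ME tE eps0 cv1 cv2.
have small := eventually_small Ns_lt cv1 cv2.
pose zeta := slice_zeta eta theta gamma xi.
pose rho := slice_rho eta theta xi.
pose nu := slice_nu gamma xi.
pose kap := kappa gamma xi.
have zeta0 : 0 < zeta by rewrite /zeta /slice_zeta; case: ifP.
have rho0 : 0 < rho by rewrite /rho /slice_rho; case: ifP.
have nu0 : 0 <= nu by exact: normr_ge0.
have tau0 : 0 <= `|xi| by exact: normr_ge0.
have kap0 : 0 < kap by exact: kappa_gt0.
have c00 : 0 <= kap * nu by rewrite mulr_ge0 ?(ltW kap0).
have c10 : 0 <= kap * rho * `|xi| by rewrite !mulr_ge0 ?(ltW kap0) ?(ltW rho0).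
pose ns k := slice_n (Ns k) (Ms k) (ts k).
pose ats k := `|ts k|%N.
pose los k := slice_lo (Ns k) (Ms k) (ts k).
have LE k (N0 : (0 < Ns k)%N) : (Lnum (Ns k) (Ms k) (ts k))%:R = kap * (Ns k)%:R.
  exact: (slice_L gamma0 gamma1 xi_gt xi_lt N0 (ME k) (tE k)).
have nE k (N0 : (0 < Ns k)%N) : (ns k)%:R = nu * (Ns k)%:R.
  exact: (slice_nE gamma0 gamma1 xi_gt xi_lt N0 (ME k) (tE k)).
have atE k (N0 : (0 < Ns k)%N) : (ats k)%:R = `|xi| * (Ns k)%:R.
  exact: (slice_at N0 (tE k)).
have LN k (N0 : (0 < Ns k)%N) : (Lnum (Ns k) (Ms k) (ts k) + los k <= 2 * Ns k)%N.
  exact: (slice_LN gamma0 gamma1 xi_gt xi_lt N0 (ME k) (tE k)).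
have loE k (N0 : (0 < Ns k)%N) : (Ms k)%:Z - (Lnum (Ns k) (Ms k) (ts k))%:Z = (los k)%:Z.
  exact: (slice_loE gamma0 gamma1 xi_gt xi_lt N0 (ME k) (tE k)).
have wE k (N0 : (0 < Ns k)%N) : weight eta theta alpha (Ns k) (Ms k) (ts k) (eps k) =1
    gweight eta theta zeta rho (alpha + (eta + theta) / 2) (eps k)
      (Lnum (Ns k) (Ms k) (ts k)) (ns k) (ats k) (los k).
  exact: (slice_weightE eta theta alpha (eps k) gamma0 gamma1 xi_gt xi_lt N0 (ME k) (tE k)).
pose Z := esum_weight eta theta alpha Ns Ms ts eps.
have IE := Ifun_Igen eta theta gamma xi.
(* The denominator of [prob_emp] is the sum over all states, that is, [Z k] of the whole space. *)
have -> : (fun k => prob_emp eta theta alpha (Ns k) (Ms k) (ts k) (eps k)) = normalized Z.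
  apply/funext => k; apply/funext => A; rewrite /normalized /Z /esum_weight /prob_emp.
  congr (_ / fine (esum _ _)); apply/seteqP; split => s //= [].
  by [].
rewrite /Jfun IE.
apply: LDP_of_bounds.
- by move=> mu Pmu; exact: Igen_ge0.
- exact: exists_finite_energy.
- by move=> a; exact: Igen_gt_wopen.
- by have [k0 H] := small 1 ltr01; exists k0 => k /H[].
- move=> k A N0.
  exact: (esum_weight_lty eta0 theta0 zeta0 rho0 c_gt0 nu0 tau0 kap0 eps0 LE nE atE loE wE).
- move=> k A N0; apply: esum_ge0 => s [Ss _]; rewrite lee_fin.
  exact: (weight_ge0 eta0 theta0 zeta0 rho0 kap0 (eps0 k) (nE _ N0) (atE _ N0) (loE _ N0) (wE _ N0)).
- exact: (esum_weight_eventually_le eta0 theta0 zeta0 rho0 c_gt0 nu0 tau0 kap0 eps0 LE nE atE loE wE small).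
- exact: (esum_weight_eventually_ge eta0 theta0 zeta0 rho0 c_gt0 nu0 tau0 kap0 eps0 LE nE atE LN loE wE small).
Qed.
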